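(* For $m\in(1,2]$ the quantity $\mathcal{L}(m)$ is given by \[ \mathcal{L}(m) = \begin{cases} g_{\sigma(1\overline{0})}(m) & \text{if } m \in [\mu_{\sigma(1\overline{0})}, \mu_{\sigma(01\overline{0})}] \text{ for some } \sigma \in \{L,M,R\}^* M, \\[.5ex] f_{\sigma(0\overline{1})}(m) & \text{if } m \in [\mu_{\sigma(10\overline{1})}, \mu_{\sigma(0\overline{1})}] \text{ for some } \sigma \in \{L,M,R\}^* M, \\[.5ex] g_{0\overline{1}}(m) & \text{if } m \in [\mu_{0\overline{1}},2], \\[.5ex] f_\mathbf{u}(m) & \text{if } m = \mu_\mathbf{u} \text{ for some } \mathbf{u} \in \mathcal{S}_{\{L,M,R\}}, \end{cases} \] and these cases cover all $m\in(1,2]$. Moreover, for every $m\in(1,2]$ and every $\beta > \mathcal{L}(m)$, the Hausdorff dimension of $\pi_\beta(U_\beta(m))\subset\mathbb{R}$ is positive.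
   Context: For $\beta>1$ and a sequence $\mathbf u=u_1u_2\cdots$ of real digits, $\pi_\beta(\mathbf u)=\sum_{k\ge1}u_k\beta^{-k}$. For $m\in(1,2]$, $U_\beta(m)$ is the set of $\mathbf u\in\{0,1,m\}^{\mathbb N}$ such that $\pi_\beta(\mathbf u)\ne\pi_\beta(\mathbf v)$ for all $\mathbf v\in\{0,1,m\}^{\mathbb N}\setminus\{\mathbf u\}$, and $\mathcal L(m)=\inf\{\beta>1:\ U_\beta(m)\cap\{0,1\}^{\mathbb N}\text{ is uncountable}\}$. $\overline{w}$ denotes the infinite repetition of a finite word $w$; infinite words over $\{0,1\}$ are ordered lexicographically. For $\mathbf u=u_1u_2\cdots\in\{0,1\}^{\mathbb N}$, $O(\mathbf u)=\{u_ku_{k+1}\cdots:k\ge1\}$, $\sup(\mathbf u)=\sup O(\mathbf u)$, $\inf(\mathbf u)=\inf O(\mathbf u)$ (lexicographic). For $m\in(1,2]$: $g_{\mathbf u}(m)$ is the unique positive real $\beta$ with $(\beta-1)(1+\pi_\beta(\inf(\mathbf u)))=m$; if $\mathbf u$ contains at least two ones, $f_{\mathbf u}(m)$ is the unique positive real $\beta$ with $\beta\,\pi_\beta(\sup(\mathbf u))=m$, and $\mu_{\mathbf u}$ is the unique $m\in(1,2]$ with $f_{\mathbf u}(m)=g_{\mathbf u}(m)$. The substitutions (monoid morphisms on words, extended letterwise to infinite words) are $L:0\mapsto0,1\mapsto01$; $M:0\mapsto01,1\mapsto10$; $R:0\mapsto01,1\mapsto1$. $\{L,M,R\}^*$ is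 the monoid they generate under composition (including the identity), and $\{L,M,R\}^*M=\{\tau M:\tau\in\{L,M,R\}^*\}$. A sequence $(\sigma_n)_{n\ge1}\in\{L,M,R\}^{\mathbb N}$ is primitive if it is not eventually constantly $L$ and not eventually constantly $R$. An infinite word $\mathbf u$ is a limit word of $(\sigma_n)$ if there are infinite words $\mathbf u^{(n)}$ with $\mathbf u^{(1)}=\mathbf u$ and $\mathbf u^{(n)}=\sigma_n(\mathbf u^{(n+1)})$ for all $n\ge1$. $\mathcal S_{\{L,M,R\}}$ is the set of limit words of primitive sequences in $\{L,M,R\}^{\mathbb N}$. *)

(* Defs.v *)
From Stdlib Require Import Reals Lra Lia List Classical ClassicalEpsilon.
Import ListNotations.
Open Scope R_scope.

(* A sequence u_1 u_2 ... is represented as u : nat -> R with u k = u_{k+1}. *)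

Definition pi_is (beta : R) (u : nat -> R) (x : R) : Prop :=
  infinite_sum (fun k => u k / beta ^ (S k)) x.

Definition digits01m (m : R) (u : nat -> R) : Prop :=
  forall k, u k = 0 \/ u k = 1 \/ u k = m.

Definition digits01 (u : nat -> R) : Prop :=
  forall k, u k = 0 \/ u k = 1.

Definition Ubeta (beta m : R) (u : nat -> R) : Prop :=
  digits01m m u /\
  forall v : nat -> R, digits01m m v -> v <> u ->
    forall x y, pi_is beta u x -> pi_is beta v y -> x <> y.

Definition countable {T : Type} (A : T -> Prop) : Prop :=
  exists f : T -> nat, forall x y, A x -> A y -> f x = f y -> x = y.

Definition uncountable {T : Type} (A : T -> Prop) : Prop := ~ countable A.

Definition is_lower_bound (E : R -> Prop) (b : R) : Prop := forall y, E y -> b <= y.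
Definition is_glb (E : R -> Prop) (b : R) : Prop :=
  is_lower_bound E b /\ forall c, is_lower_bound E c -> c <= b.

Definition calL (m : R) : R :=
  epsilon (inhabits 0)
    (is_glb (fun beta => 1 < beta /\
               uncountable (fun u => Ubeta beta m u /\ digits01 u))).

Definition bword := nat -> bool.

Definition bin (u : bword) : nat -> R := fun k => if u k then 1 else 0.

Definition lex_lt (u v : bword) : Prop :=
  exists n, (forall i, (i < n)%nat -> u i = v i) /\ u n = false /\ v n = true.
Definition lex_le (u v : bword) : Prop := (forall i, u i = v i) \/ lex_lt u v.

Definition orbit (u : bword) (v : bword) : Prop :=
  exists k, forall i, v i = u (k + i)%nat.

Definition is_lex_sup (E : bword -> Prop) (w : bword) : Prop :=
  (forall v, E v -> lex_le v w) /\
  (forall b, (forall v, E v -> lex_le v b) -> lex_le w b).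
Definition is_lex_inf (E : bword -> Prop) (w : bword) : Prop :=
  (forall v, E v -> lex_le w v) /\
  (forall b, (forall v, E v -> lex_le b v) -> lex_le b w).

Definition supw (u : bword) : bword :=
  epsilon (inhabits (fun _ => false)) (is_lex_sup (orbit u)).
Definition infw (u : bword) : bword :=
  epsilon (inhabits (fun _ => false)) (is_lex_inf (orbit u)).

(* g_u(m): the unique positive beta with (beta-1)(1+pi_beta(inf u)) = m *)
Definition g_fun (u : bword) (m : R) : R :=
  epsilon (inhabits 0) (fun beta => 0 < beta /\
    exists x, pi_is beta (bin (infw u)) x /\ (beta - 1) * (1 + x) = m).

(* f_u(m): the unique positive beta with beta * pi_beta(sup u) = m *)
Definition f_fun (u : bword) (m : R) : R :=
  epsilon (inhabits 0) (fun beta => 0 < beta /\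
    exists x, pi_is beta (bin (supw u)) x /\ beta * x = m).

(* mu_u: the unique m in (1,2] with f_u(m) = g_u(m) *)
Definition mu (u : bword) : R :=
  epsilon (inhabits 0) (fun m => 1 < m <= 2 /\ f_fun u m = g_fun u m).

Inductive sub := SL | SM | SR.

Definition img (t : sub) (b : bool) : list bool :=
  match t, b with
  | SL, false => [false]
  | SL, true  => [false; true]
  | SM, false => [false; true]
  | SM, true  => [true; false]
  | SR, false => [false; true]
  | SR, true  => [true]
  end.

(* letterwise extension to infinite words: since every image is nonempty,
   the n-th letter of t(u) lies in t(u_0 ... u_n). *)
Definition subst_inf (t : sub) (u : bword) : bword :=
  fun n => nth n (concat (map (fun k => img t (u k)) (seq 0 (S n)))) false.

Definition apply_subs (l : list sub) (u : bword) : bword :=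
  fold_right subst_inf u l.

Definition ends_with_M (l : list sub) : Prop := exists l', l = l' ++ [SM].

Definition primitive (s : nat -> sub) : Prop :=
  ~ (exists N, forall n, (N <= n)%nat -> s n = SL) /\
  ~ (exists N, forall n, (N <= n)%nat -> s n = SR).

Definition limit_word (s : nat -> sub) (u : bword) : Prop :=
  exists U : nat -> bword,
    U 0%nat = u /\ forall n, U n = subst_inf (s n) (U (S n)).

Definition S_LMR (u : bword) : Prop :=
  exists s, primitive s /\ limit_word s u.

Definition w10   : bword := fun n => Nat.eqb n 0.
Definition w010  : bword := fun n => Nat.eqb n 1.
Definition w01   : bword := fun n => negb (Nat.eqb n 0).
Definition w101  : bword := fun n => negb (Nat.eqb n 1).

Definition hausdorff_null (s : R) (A : R -> Prop) : Prop :=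
  forall delta eps, 0 < delta -> 0 < eps ->
    exists (C : nat -> R -> Prop) (d : nat -> R),
      (forall x, A x -> exists i, C i x) /\
      (forall i, 0 < d i <= delta) /\
      (forall i x y, C i x -> C i y -> Rabs (x - y) <= d i) /\
      exists S, infinite_sum (fun i => Rpower (d i) s) S /\ S < eps.

Definition hausdorff_dim (A : R -> Prop) (dim : R) : Prop :=
  is_glb (fun s => 0 <= s /\ hausdorff_null s A) dim.

Definition piU (beta m : R) : R -> Prop :=
  fun x => exists u, Ubeta beta m u /\ pi_is beta u x.

(* Main.v *)
From Stdlib Require Import Reals Ranalysis5 Lra Lia List Permutation.
From Stdlib Require Import Classical ClassicalEpsilon FunctionalExtensionality Cantor.
From Coquelicot Require Import Coquelicot.
Require Import Defs.
Import ListNotations.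
Open Scope R_scope.

(* For [2 < beta <= m + 1] a word over {0,1} is a unique expansion iff every tail [v]
   following a 1 satisfies [m/(beta-1) - 1 < pi(v) < m - 1]; since [beta >= 2], [pi] is
   lexicographically monotone, so only the infimum and the supremum of the orbit matter,
   through [G beta inf > m] and [F beta sup < m].

   Each substitution t in {L,M,R} acts on (inf, sup) by a pair of monotone maps
   ([Asub t], [Bsub t]), and a word whose orbit is squeezed by the image of such a pair is
   eventually a t-image. Let A, B be compositions of these maps along the same list tau.
   If [G beta (A p) <= m <= F beta (B q)] with (p, q) = (01^w, 1^w) or (0^w, 10^w), then
   desubstituting leaves only eventually periodic words; if [G beta (A 0^w) > m > F beta (B 1^w)],
   then all of tau(M({0,1}^N)) consists of unique expansions, a Cantor set of positive dimension.
   A and B lengthen common prefixes, so the two criteria meet on a curve, which is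
   self-similar: it runs through its L-image, a plateau, its M-image, a plateau, its R-image. *)

(** Only letters 1 carry a condition: for [beta > 2] the rest of a binary word is worth less than 1,
    so a digit 0 cannot be traded for 1 or m. Sufficiency of the condition needs [beta > 2];
    necessity needs [beta <= m + 1], when the expansions over {0,1,m} fill [0, m/(beta-1)] and a
    failed inequality produces a second expansion. The critical base always lies in [2, m + 1]. The
    obstacle is that [f_fun], [g_fun] and [mu] are known only through their equations and must be
    compared along infinitely many words. Comparisons with [mu] are therefore turned into strict
    inequalities at one witness base, and these depend on finitely many letters only. A finite
    prefix of substitutions then decides on which side of [mu] a given m lies. An m on no plateau
    descends for ever into smaller images of the curve; a tail of L's or R's would squeeze it onto
    an end of such an image, where a strict inequality fails, and this is where primitivity comes
    from. *)

(** * Words, shifts, substitutions and common prefixes *)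

Definition wcons (b : bool) (u : bword) : bword :=
  fun n => match n with O => b | S k => u k end.
Definition shift (u : bword) : bword := fun n => u (S n).
Definition shiftn (k : nat) (u : bword) : bword := fun i => u (k + i)%nat.
Definition wapp (l : list bool) (u : bword) : bword := fold_right wcons u l.
Definition cst (b : bool) : bword := fun _ => b.

Lemma wcons_shift u : wcons (u 0%nat) (shift u) = u.
Proof. apply functional_extensionality; intros [|n]; reflexivity. Qed.

Lemma shift_wcons b u : shift (wcons b u) = u.
Proof. reflexivity. Qed.

Lemma shiftn0 u : shiftn 0 u = u.
Proof. reflexivity. Qed.

Lemma shiftn_shiftn j k u : shiftn j (shiftn k u) = shiftn (k + j) u.
Proof.
  apply functional_extensionality; intros i; unfold shiftn; f_equal; lia.
Qed.

Lemma shift_shiftn k u : shift (shiftn k u) = shiftn (S k) u.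
Proof.
  apply functional_extensionality; intros i; unfold shift, shiftn; f_equal; lia.
Qed.

Lemma shiftn_S k u : shiftn (S k) u = shiftn k (shift u).
Proof. reflexivity. Qed.

Lemma shiftn_expand k u : shiftn k u = wcons (u k) (shiftn (S k) u).
Proof.
  rewrite <- (wcons_shift (shiftn k u)) at 1. rewrite shift_shiftn.
  unfold shiftn at 1. now rewrite Nat.add_0_r.
Qed.

Lemma shiftn_wapp l u : shiftn (length l) (wapp l u) = u.
Proof.
  induction l as [|b l IH]; [reflexivity|].
  simpl length. rewrite shiftn_S. exact IH.
Qed.

Lemma wapp_shiftn k u : exists l, length l = k /\ u = wapp l (shiftn k u).
Proof.
  revert u; induction k as [|k IH]; intros u; [exists []; auto|].
  destruct (IH (shift u)) as (l & Hl & E).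
  exists (u 0%nat :: l); split; [simpl; lia|].
  simpl. rewrite shiftn_S, <- E. symmetry; apply wcons_shift.
Qed.

Lemma cst_wcons b : cst b = wcons b (cst b).
Proof. apply functional_extensionality; intros [|n]; reflexivity. Qed.

Lemma img_nonempty t b : (1 <= length (img t b))%nat.
Proof. destruct t, b; simpl; lia. Qed.

Lemma length_concat_img t (f : nat -> bool) l :
  (length l <= length (concat (map (fun k => img t (f k)) l)))%nat.
Proof.
  induction l as [|x l IH]; simpl; [lia|].
  rewrite length_app. generalize (img_nonempty t (f x)); lia.
Qed.

Lemma nth_wapp l u n :
  wapp l u n = if Nat.ltb n (length l) then nth n l false else u (n - length l)%nat.
Proof.
  revert n; induction l as [|b l IH]; intros n; simpl.
  - now rewrite Nat.sub_0_r.
  - destruct n as [|n]; simpl; [reflexivity|]. rewrite IH. reflexivity.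
Qed.

(** The block recursion behind the letterwise definition. Past the first block, [S n'] further
    images already contain the letter sought, since no image is empty, and the surplus images are
    cut off. *)
Lemma subst_cons t b u : subst_inf t (wcons b u) = wapp (img t b) (subst_inf t u).
Proof.
  apply functional_extensionality; intros n.
  rewrite nth_wapp. unfold subst_inf at 1.
  change (seq 0 (S n)) with (0%nat :: seq 1 n). rewrite <- seq_shift.
  simpl. rewrite map_map. simpl.
  destruct (Nat.ltb_spec n (length (img t b))) as [H|H].
  - now apply app_nth1.
  - rewrite app_nth2 by lia. unfold subst_inf.
    generalize (img_nonempty t b); intros H1.
    set (n' := (n - length (img t b))%nat).
    assert (E : n = (S n' + (n - S n'))%nat) by lia.
    rewrite E at 1. rewrite seq_app, map_app, concat_app, app_nth1; [reflexivity|].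
    eapply Nat.lt_le_trans; [|apply length_concat_img]. rewrite length_seq. lia.
Qed.

Lemma subst_unfold t u :
  subst_inf t u = wapp (img t (u 0%nat)) (subst_inf t (shift u)).
Proof. rewrite <- subst_cons. f_equal. symmetry; apply wcons_shift. Qed.

Definition agr (N : nat) (x y : bword) : Prop := forall i, (i < N)%nat -> x i = y i.

Lemma agr_le N N' x y : (N' <= N)%nat -> agr N x y -> agr N' x y.
Proof. intros H A i Hi; apply A; lia. Qed.

Lemma agr_trans N x y z : agr N x y -> agr N y z -> agr N x z.
Proof. intros H1 H2 i Hi; rewrite H1; auto. Qed.

Lemma agr_sym N x y : agr N x y -> agr N y x.
Proof. intros H i Hi; symmetry; auto. Qed.

Lemma agr_refl N x : agr N x x.
Proof. intros i _; reflexivity. Qed.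

Lemma agr_wcons N b x y : agr N x y -> agr (S N) (wcons b x) (wcons b y).
Proof. intros H [|i] Hi; [reflexivity|]; apply H; lia. Qed.

Lemma agr_wapp N l x y : agr N x y -> agr (length l + N) (wapp l x) (wapp l y).
Proof.
  intros H; induction l as [|b l IH]; [exact H|]. now apply agr_wcons.
Qed.

Lemma agr_shift N x y : agr (S N) x y -> agr N (shift x) (shift y).
Proof. intros H i Hi; apply H; lia. Qed.

Lemma agr_eq x y : (forall N, agr N x y) -> x = y.
Proof. intros H; apply functional_extensionality; intros i; apply (H (S i)); lia. Qed.

Lemma agr_subst N t x y : agr N x y -> agr N (subst_inf t x) (subst_inf t y).
Proof.
  revert x y; induction N as [|N IH]; intros x y H; [intros i Hi; lia|].
  rewrite (subst_unfold t x), (subst_unfold t y), (H 0%nat) by lia.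
  eapply agr_le; [|apply agr_wapp, IH, agr_shift, H].
  generalize (img_nonempty t (y 0%nat)); lia.
Qed.

Lemma subst_L_0 u : subst_inf SL u 0%nat = false.
Proof. rewrite subst_unfold. now destruct (u 0%nat). Qed.

Lemma subst_0 t u : u 0%nat = false -> subst_inf t u 0%nat = false.
Proof. intros H; rewrite subst_unfold, H. now destruct t. Qed.

(** Every L-block starts with 0, so the letter after the common blocks is known too. *)
Lemma agr_subst_L N x y : agr N x y -> agr (S N) (subst_inf SL x) (subst_inf SL y).
Proof.
  revert x y; induction N as [|N IH]; intros x y H.
  - intros i Hi. replace i with 0%nat by lia. now rewrite !subst_L_0.
  - rewrite (subst_unfold SL x), (subst_unfold SL y), (H 0%nat) by lia.
    eapply agr_le; [|apply agr_wapp, IH, agr_shift, H].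
    generalize (img_nonempty SL (y 0%nat)); lia.
Qed.

(* [Asub t] and [Bsub t] transport the infimum and the supremum of the orbit
   of a word [u] to those of [t(u)]. *)
Definition Asub (t : sub) (u : bword) : bword :=
  match t with
  | SM => wcons false (subst_inf SM u)
  | _ => subst_inf t u
  end.
Definition Bsub (t : sub) (u : bword) : bword :=
  match t with
  | SL => shift (subst_inf SL u)
  | _ => wcons true (subst_inf t u)
  end.
Definition Asubs (l : list sub) (u : bword) : bword := fold_right Asub u l.
Definition Bsubs (l : list sub) (u : bword) : bword := fold_right Bsub u l.

Lemma Asubs_app l l' u : Asubs (l ++ l') u = Asubs l (Asubs l' u).
Proof. apply fold_right_app. Qed.
Lemma Bsubs_app l l' u : Bsubs (l ++ l') u = Bsubs l (Bsubs l' u).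
Proof. apply fold_right_app. Qed.

Lemma Asub_0 t u : u 0%nat = false -> Asub t u 0%nat = false.
Proof. intros H; destruct t; simpl; auto using subst_0. Qed.

Lemma Bsub_0 t u : u 0%nat = true -> Bsub t u 0%nat = true.
Proof.
  intros H; destruct t; simpl; auto. rewrite subst_unfold, H. reflexivity.
Qed.

Lemma Asubs_0 l u : u 0%nat = false -> Asubs l u 0%nat = false.
Proof. intros H; induction l; simpl; auto using Asub_0. Qed.

Lemma Bsubs_0 l u : u 0%nat = true -> Bsubs l u 0%nat = true.
Proof. intros H; induction l; simpl; auto using Bsub_0. Qed.

(** The contraction behind all limits of words. The letter gained is the 0 opening the next block
    for L, the prepended 0 for M, and the second letter of the head block 01 for R. *)
Lemma Asub_agr N t x y : x 0%nat = false ->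
  agr (S N) x y -> agr (S (S N)) (Asub t x) (Asub t y).
Proof.
  intros H0 H; destruct t; simpl.
  - now apply agr_subst_L.
  - now apply agr_wcons, agr_subst.
  - rewrite (subst_unfold SR x), (subst_unfold SR y), <- (H 0%nat), H0 by lia.
    simpl. now apply agr_wcons, agr_wcons, agr_subst, agr_shift.
Qed.

(** Under L the head block 01 makes up for the letter that [shift] removes; under M and R the
    prepended 1 is the gain. *)
Lemma Bsub_agr N t x y : x 0%nat = true ->
  agr (S N) x y -> agr (S (S N)) (Bsub t x) (Bsub t y).
Proof.
  intros H0 H; destruct t; simpl.
  - rewrite (subst_unfold SL x), (subst_unfold SL y), <- (H 0%nat), H0 by lia.
    simpl. rewrite !shift_wcons. now apply agr_wcons, agr_subst_L, agr_shift.
  - now apply agr_wcons, agr_subst.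
  - now apply agr_wcons, agr_subst.
Qed.

Lemma Asubs_agr N l x y : x 0%nat = false ->
  agr (S N) x y -> agr (length l + S N) (Asubs l x) (Asubs l y).
Proof.
  intros H0 H; induction l as [|t l IH]; [exact H|]. simpl.
  rewrite Nat.add_succ_r in *. apply Asub_agr; auto using Asubs_0.
Qed.

Lemma Bsubs_agr N l x y : x 0%nat = true ->
  agr (S N) x y -> agr (length l + S N) (Bsubs l x) (Bsubs l y).
Proof.
  intros H0 H; induction l as [|t l IH]; [exact H|]. simpl.
  rewrite Nat.add_succ_r in *. apply Bsub_agr; auto using Bsubs_0.
Qed.

Lemma Asubs_agr_0 l x y : x 0%nat = false -> y 0%nat = false ->
  agr (length l) (Asubs l x) (Asubs l y).
Proof.
  intros Hx Hy. eapply agr_le; [|apply (Asubs_agr 0); auto]; [lia|].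
  intros i Hi; replace i with 0%nat by lia; congruence.
Qed.

Lemma Bsubs_agr_0 l x y : x 0%nat = true -> y 0%nat = true ->
  agr (length l) (Bsubs l x) (Bsubs l y).
Proof.
  intros Hx Hy. eapply agr_le; [|apply (Bsubs_agr 0); auto]; [lia|].
  intros i Hi; replace i with 0%nat by lia; congruence.
Qed.

(** * Lexicographic order *)

Lemma lex_le_refl x : lex_le x x.
Proof. now left. Qed.

Lemma lex_le_eq x y : x = y -> lex_le x y.
Proof. intros ->; apply lex_le_refl. Qed.

Lemma lex_lt_wcons b x y : lex_lt x y -> lex_lt (wcons b x) (wcons b y).
Proof.
  intros (n & H & H1 & H2); exists (S n); repeat split; auto.
  now apply agr_wcons.
Qed.

Lemma lex_le_wcons b x y : lex_le x y -> lex_le (wcons b x) (wcons b y).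
Proof.
  intros [H|H].
  - left; intros [|i]; simpl; auto.
  - right; now apply lex_lt_wcons.
Qed.

Lemma lex_lt_wapp l x y : lex_lt x y -> lex_lt (wapp l x) (wapp l y).
Proof. intros H; induction l; simpl; auto using lex_lt_wcons. Qed.

Lemma lex_lt_wcons_inv b x y : lex_lt (wcons b x) (wcons b y) -> lex_lt x y.
Proof.
  intros ([|n] & H & H1 & H2); simpl in *; [congruence|].
  exists n; repeat split; auto. intros i Hi; apply (H (S i)); lia.
Qed.

Lemma lex_le_wcons_inv b x y : lex_le (wcons b x) (wcons b y) -> lex_le x y.
Proof.
  intros [H|H].
  - left; intros i; apply (H (S i)).
  - right; eapply lex_lt_wcons_inv; eauto.
Qed.

Lemma lex_lt_01 x y : lex_lt (wcons false x) (wcons true y).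
Proof. exists 0%nat; repeat split; intros; lia. Qed.

Lemma lex_lt_heads x y : x 0%nat = false -> y 0%nat = true -> lex_lt x y.
Proof. intros; exists 0%nat; repeat split; auto; intros; lia. Qed.

Lemma lex_le_heads x y : x 0%nat = false -> y 0%nat = true -> lex_le x y.
Proof. intros; right; now apply lex_lt_heads. Qed.

Lemma lex_lt_not_le x y : lex_lt x y -> ~ lex_le y x.
Proof.
  intros (n & H & H1 & H2) [E|(k & K & K1 & K2)].
  - congruence.
  - destruct (Nat.lt_trichotomy n k) as [L|[L|L]].
    + specialize (K n L); congruence.
    + subst; congruence.
    + specialize (H k L); congruence.
Qed.

Lemma first_diff {T} (d e : nat -> T) : d <> e ->
  exists k, (forall i, (i < k)%nat -> d i = e i) /\ d k <> e k.
Proof.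
  intros H. destruct (Wf_nat.dec_inh_nat_subset_has_unique_least_element
       (fun n => d n <> e n)) as (n & [Hn1 Hn2] & _).
  - intros k. destruct (classic (d k = e k)); tauto.
  - apply NNPP. intros N. apply H. apply functional_extensionality. intros i.
    apply NNPP. intros Hi. apply N. eauto.
  - exists n; split; auto. intros i Hi. apply NNPP. intros D.
    specialize (Hn2 i D). lia.
Qed.

Lemma lex_total x y : lex_le x y \/ lex_lt y x.
Proof.
  destruct (classic (x = y)) as [->|H]; [left; apply lex_le_refl|].
  destruct (first_diff _ _ H) as (n & A & D).
  destruct (x n) eqn:Ex, (y n) eqn:Ey; try congruence.
  - right; exists n; repeat split; auto. intros; symmetry; auto.
  - left; right; exists n; repeat split; auto.
Qed.

Lemma lex_le_trans x y z : lex_le x y -> lex_le y z -> lex_le x z.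
Proof.
  intros H1 H2. destruct (lex_total x z) as [|H]; auto. exfalso.
  destruct H1 as [H1|(n & N & N1 & N2)].
  - apply functional_extensionality in H1; subst. now apply (lex_lt_not_le _ _ H).
  - destruct H2 as [H2|(k & K & K1 & K2)].
    + apply functional_extensionality in H2; subst.
      apply (lex_lt_not_le _ _ H). right; exists n; auto.
    + apply (lex_lt_not_le _ _ H). right.
      destruct (Nat.lt_trichotomy n k) as [L|[L|L]].
      * exists n; repeat split; auto.
        -- intros i Hi; rewrite N by lia; apply K; lia.
        -- rewrite <- K; auto.
      * subst; congruence.
      * exists k; repeat split; auto.
        -- intros i Hi; rewrite N by lia; apply K; lia.
        -- rewrite N; auto.
Qed.

Lemma lex_le_antisym x y : lex_le x y -> lex_le y x -> x = y.
Proof.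
  intros [H|H] K; [now apply functional_extensionality|].
  now apply lex_lt_not_le in H.
Qed.

Lemma cst_false_le x : lex_le (cst false) x.
Proof.
  destruct (lex_total (cst false) x) as [|(n & _ & _ & H)]; [assumption|discriminate].
Qed.

Lemma le_cst_true x : lex_le x (cst true).
Proof.
  destruct (lex_total x (cst true)) as [|(n & _ & H & _)]; [assumption|discriminate].
Qed.

Lemma lex_le_limit_l (A : nat -> bword) a t :
  (forall n, agr n (A n) a) -> (forall n, lex_le (A n) t) -> lex_le a t.
Proof.
  intros HA H. destruct (lex_total a t) as [|(n & N & N1 & N2)]; auto. exfalso.
  apply (lex_lt_not_le t (A (S n))); auto. exists n; repeat split; auto.
  - intros i Hi. rewrite HA by lia. auto.
  - rewrite HA by lia. auto.
Qed.

Lemma lex_le_limit_r (A : nat -> bword) a t :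
  (forall n, agr n (A n) a) -> (forall n, lex_le t (A n)) -> lex_le t a.
Proof.
  intros HA H. destruct (lex_total t a) as [|(n & N & N1 & N2)]; auto. exfalso.
  apply (lex_lt_not_le (A (S n)) t); auto. exists n; repeat split; auto.
  - intros i Hi. rewrite HA by lia. auto.
  - rewrite HA by lia. auto.
Qed.

Lemma subst_lt t x y : lex_lt x y -> lex_lt (subst_inf t x) (subst_inf t y).
Proof.
  intros (n & H & H1 & H2).
  revert x y H H1 H2; induction n as [|n IH]; intros x y H H1 H2;
    rewrite (subst_unfold t x), (subst_unfold t y).
  - rewrite H1, H2. destruct t; simpl.
    + apply lex_lt_wcons, lex_lt_heads; auto using subst_L_0.
    + now apply lex_lt_heads.
    + now apply lex_lt_heads.
  - rewrite (H 0%nat) by lia. apply lex_lt_wapp, IH; auto.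
    intros i Hi; apply H; lia.
Qed.

Lemma subst_le t x y : lex_le x y -> lex_le (subst_inf t x) (subst_inf t y).
Proof.
  intros [H|H].
  - apply functional_extensionality in H; subst; apply lex_le_refl.
  - right; now apply subst_lt.
Qed.

Lemma subst_inj t x y : subst_inf t x = subst_inf t y -> x = y.
Proof.
  intros E. destruct (lex_total x y) as [[H|H]|H].
  - now apply functional_extensionality.
  - apply (subst_lt t), lex_lt_not_le in H. exfalso; apply H. now apply lex_le_eq.
  - apply (subst_lt t), lex_lt_not_le in H. exfalso; apply H. now apply lex_le_eq.
Qed.

(** If 1x were smaller, with first difference at n, the agreement before n would propagate the
    leading 1 through x, and 1x could not have a 0 at n. *)
Lemma wcons_true_ge x : lex_le x (wcons true x).
Proof.
  apply (lex_le_limit_r (fun n => wcons true x) (wcons true x)); auto using agr_refl.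
  intros _. destruct (lex_total x (wcons true x)) as [|(n & N & N1 & N2)]; auto.
  exfalso. assert (A : forall i, (i <= n)%nat -> x i = true).
  { induction i as [|i IH]; intros Hi.
    - destruct n; [assumption|]. rewrite <- (N 0%nat) by lia. reflexivity.
    - destruct (Nat.eq_dec (S i) n) as [->|D]; auto.
      rewrite <- (N (S i)) by lia. simpl. apply IH; lia. }
  destruct n as [|n]; simpl in N1; [discriminate|].
  rewrite A in N1 by lia; discriminate.
Qed.

Lemma wcons_false_M_le v : lex_le (wcons false (subst_inf SM v)) (subst_inf SM v).
Proof.
  rewrite (subst_unfold SM v). destruct (v 0%nat).
  - now apply lex_le_heads.
  - apply lex_le_wcons. now apply lex_le_heads.
Qed.

(** * Orbits of substituted words *)

Lemma shiftn_subst_cases t u k :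
  exists j, shiftn k (subst_inf t u) = subst_inf t (shiftn j u) \/
    exists c d, img t (u j) = [c; d] /\
      shiftn k (subst_inf t u) = wcons d (subst_inf t (shiftn (S j) u)).
Proof.
  induction k as [|k (j & [E|(c & d & Ej & E)])].
  - exists 0%nat; left; reflexivity.
  - rewrite <- shift_shiftn, E, (shiftn_expand j u), subst_cons.
    destruct (img t (u j)) as [|c [|d [|]]] eqn:Eq; try (destruct t, (u j); discriminate).
    + exists (S j); left; reflexivity.
    + exists j; right; exists c, d; auto.
  - rewrite <- shift_shiftn, E. exists (S j); left; reflexivity.
Qed.

Lemma shiftn_subst_of t u k :
  exists j, (k <= j)%nat /\ shiftn j (subst_inf t u) = subst_inf t (shiftn k u).
Proof.
  induction k as [|k (j & Hj & E)].
  - exists 0%nat; auto.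
  - exists (j + length (img t (u k)))%nat; split.
    + generalize (img_nonempty t (u k)); lia.
    + rewrite <- shiftn_shiftn, E, (shiftn_expand k u), subst_cons.
      apply shiftn_wapp.
Qed.

Lemma orbit_ge_subst t a u :
  (forall k, lex_le a (shiftn k u)) ->
  forall k, lex_le (Asub t a) (shiftn k (subst_inf t u)).
Proof.
  intros H k. destruct (shiftn_subst_cases t u k) as (j & [->|(c & d & Ej & ->)]).
  - destruct t; simpl; try now apply subst_le.
    eapply lex_le_trans; [apply lex_le_wcons, subst_le, H|apply wcons_false_M_le].
  - destruct t, (u j) eqn:Eu; simpl in Ej; inversion Ej; subst; simpl.
    + apply lex_le_heads; auto using subst_L_0.
    + now apply lex_le_wcons, subst_le.
    + now apply lex_le_heads.
    + eapply lex_le_trans; [apply subst_le, (H (S j))|].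
      change (wcons true (subst_inf SR (shiftn (S j) u)))
        with (wapp (img SR true) (subst_inf SR (shiftn (S j) u))).
      rewrite <- subst_cons. apply subst_le, wcons_true_ge.
Qed.

Lemma orbit_le_subst t b u : b 0%nat = true ->
  (forall k, lex_le (shiftn k u) b) ->
  forall k, lex_le (shiftn k (subst_inf t u)) (Bsub t b).
Proof.
  intros Hb H k. destruct (shiftn_subst_cases t u k) as (j & [->|(c & d & Ej & ->)]).
  - destruct t; simpl; try (eapply lex_le_trans; [apply subst_le, H|apply wcons_true_ge]).
    apply lex_le_heads; auto using subst_L_0.
    rewrite subst_unfold, Hb; reflexivity.
  - destruct t, (u j) eqn:Eu; simpl in Ej; inversion Ej; subst; simpl.
    + specialize (H j). rewrite shiftn_expand, Eu in H.
      rewrite <- (wcons_shift b), Hb in H |- *.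
      rewrite subst_cons; simpl. rewrite shift_wcons.
      apply lex_le_wcons, subst_le. eapply lex_le_wcons_inv; eauto.
    + now apply lex_le_heads.
    + now apply lex_le_wcons, subst_le.
    + now apply lex_le_wcons, subst_le.
Qed.

Lemma orbit_ge_substs l a u :
  (forall k, lex_le a (shiftn k u)) ->
  forall k, lex_le (Asubs l a) (shiftn k (apply_subs l u)).
Proof.
  intros H; induction l as [|t l IH]; [exact H|]. now apply orbit_ge_subst.
Qed.

Lemma orbit_le_substs l b u : b 0%nat = true ->
  (forall k, lex_le (shiftn k u) b) ->
  forall k, lex_le (shiftn k (apply_subs l u)) (Bsubs l b).
Proof.
  intros Hb H; induction l as [|t l IH]; [exact H|].
  apply orbit_le_subst; auto. now apply Bsubs_0.
Qed.

(* The orbit of [u] lies in [a, b]; [a] is approached by tails preceded by a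
   [1] and [b] by tails preceded by a [0], which is what substitutions preserve. *)
Definition bounds (u a b : bword) : Prop :=
  (forall k, lex_le a (shiftn k u)) /\ (forall k, lex_le (shiftn k u) b) /\
  (forall N, exists k, u k = true /\ agr N (shiftn (S k) u) a) /\
  (forall N, exists k, u k = false /\ agr N (shiftn (S k) u) b).

(** [infw] is an epsilon: an infimum must be exhibited before antisymmetry identifies the two. Lower
    bounds of the orbit pass to the limit a of tails. *)
Lemma infw_eq u a : (forall k, lex_le a (shiftn k u)) ->
  (forall N, exists k, agr N (shiftn k u) a) -> infw u = a.
Proof.
  intros H1 H2.
  assert (Ha : is_lex_inf (orbit u) a).
  { split.
    - intros v [k Hk]. apply functional_extensionality in Hk; subst. apply H1.
    - intros b Hb.
      destruct (choice (fun N k => agr N (shiftn k u) a) H2) as [h Hh].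
      apply (lex_le_limit_r (fun n => shiftn (h n) u)); auto.
      intros n; apply Hb. now exists (h n). }
  assert (Hi : is_lex_inf (orbit u) (infw u)) by (unfold infw, supw; apply epsilon_spec; eauto).
  destruct Ha as [A1 A2], Hi as [I1 I2]. apply lex_le_antisym; auto.
Qed.

Lemma supw_eq u b : (forall k, lex_le (shiftn k u) b) ->
  (forall N, exists k, agr N (shiftn k u) b) -> supw u = b.
Proof.
  intros H1 H2.
  assert (Ha : is_lex_sup (orbit u) b).
  { split.
    - intros v [k Hk]. apply functional_extensionality in Hk; subst. apply H1.
    - intros c Hc.
      destruct (choice (fun N k => agr N (shiftn k u) b) H2) as [h Hh].
      apply (lex_le_limit_l (fun n => shiftn (h n) u)); auto.
      intros n; apply Hc. now exists (h n). }
  assert (Hi : is_lex_sup (orbit u) (supw u)) by (unfold infw, supw; apply epsilon_spec; eauto).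
  destruct Ha as [A1 A2], Hi as [I1 I2]. apply lex_le_antisym; auto.
Qed.

Lemma bounds_infw u a b : bounds u a b -> infw u = a.
Proof.
  intros (H1 & _ & H2 & _). apply infw_eq; auto.
  intros N; destruct (H2 N) as (k & _ & Hk); eauto.
Qed.

Lemma bounds_supw u a b : bounds u a b -> supw u = b.
Proof.
  intros (_ & H1 & _ & H2). apply supw_eq; auto.
  intros N; destruct (H2 N) as (k & _ & Hk); eauto.
Qed.

(** The origin of [Asub]: it is what follows the 1 inside the image of a letter 1, namely the rest
    of the block (the 0 of 10 for M, nothing otherwise) and the image of the tail. *)
Lemma subst_tail_true t u k : u k = true ->
  exists j, subst_inf t u j = true /\
    shiftn (S j) (subst_inf t u) = Asub t (shiftn (S k) u).
Proof.
  intros Hk. destruct (shiftn_subst_of t u k) as (j & _ & E).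
  rewrite (shiftn_expand k u), Hk, subst_cons in E.
  assert (E' : forall i, subst_inf t u (j + i)%nat =
     wapp (img t true) (subst_inf t (shiftn (S k) u)) i).
  { intros i. exact (f_equal (fun w => w i) E). }
  assert (Es : forall i, shiftn (j + i) (subst_inf t u) = shiftn i (wapp (img t true) (subst_inf t (shiftn (S k) u)))).
  { intros i. now rewrite <- shiftn_shiftn, E. }
  destruct t; simpl in *.
  - exists (j + 1)%nat; split; [apply E'|].
    rewrite <- Nat.add_succ_r. apply (Es 2%nat).
  - exists (j + 0)%nat; split; [apply E'|].
    rewrite <- Nat.add_succ_r. apply (Es 1%nat).
  - exists (j + 0)%nat; split; [apply E'|].
    rewrite <- Nat.add_succ_r. apply (Es 1%nat).
Qed.

(** The origin of [Bsub]. For L the 0 chosen is not the image of the letter 0 but the next one,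
    which opens the following block; hence the [shift] in [Bsub SL]. *)
Lemma subst_tail_false t u k : u k = false ->
  exists j, subst_inf t u j = false /\
    shiftn (S j) (subst_inf t u) = Bsub t (shiftn (S k) u).
Proof.
  intros Hk. destruct (shiftn_subst_of t u k) as (j & _ & E).
  rewrite (shiftn_expand k u), Hk, subst_cons in E.
  assert (E' : forall i, subst_inf t u (j + i)%nat =
     wapp (img t false) (subst_inf t (shiftn (S k) u)) i).
  { intros i. exact (f_equal (fun w => w i) E). }
  assert (Es : forall i, shiftn (j + i) (subst_inf t u) = shiftn i (wapp (img t false) (subst_inf t (shiftn (S k) u)))).
  { intros i. now rewrite <- shiftn_shiftn, E. }
  destruct t; simpl in *.
  - exists (j + 1)%nat; split; [rewrite E'; apply subst_L_0|].
    rewrite <- Nat.add_succ_r. apply (Es 2%nat).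
  - exists (j + 0)%nat; split; [apply E'|].
    rewrite <- Nat.add_succ_r. apply (Es 1%nat).
  - exists (j + 0)%nat; split; [apply E'|].
    rewrite <- Nat.add_succ_r. apply (Es 1%nat).
Qed.

Lemma Asub_agr_weak N t x y : agr (S N) x y -> agr N (Asub t x) (Asub t y).
Proof.
  intros H; destruct t; simpl.
  - eapply agr_le; [|apply agr_subst, H]; lia.
  - eapply agr_le; [|apply agr_wcons, agr_subst, H]; lia.
  - eapply agr_le; [|apply agr_subst, H]; lia.
Qed.

Lemma Bsub_agr_weak N t x y : agr (S N) x y -> agr N (Bsub t x) (Bsub t y).
Proof.
  intros H; destruct t; simpl.
  - now apply agr_shift, agr_subst.
  - eapply agr_le; [|apply agr_wcons, agr_subst, H]; lia.
  - eapply agr_le; [|apply agr_wcons, agr_subst, H]; lia.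
Qed.

Lemma bounds_subst t u a b : b 0%nat = true -> bounds u a b ->
  bounds (subst_inf t u) (Asub t a) (Bsub t b).
Proof.
  intros Hb (H1 & H2 & H3 & H4). split; [|split; [|split]].
  - now apply orbit_ge_subst.
  - now apply orbit_le_subst.
  - intros N. destruct (H3 (S N)) as (k & Hk & A).
    destruct (subst_tail_true t u k Hk) as (j & Hj & E).
    exists j; split; auto. rewrite E. now apply Asub_agr_weak.
  - intros N. destruct (H4 (S N)) as (k & Hk & A).
    destruct (subst_tail_false t u k Hk) as (j & Hj & E).
    exists j; split; auto. rewrite E. now apply Bsub_agr_weak.
Qed.

Lemma bounds_substs l u a b : b 0%nat = true -> bounds u a b ->
  bounds (apply_subs l u) (Asubs l a) (Bsubs l b).
Proof.
  intros Hb H; induction l as [|t l IH]; [exact H|].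
  apply bounds_subst; [now apply Bsubs_0|exact IH].
Qed.

(** * The boundary words and their images *)

Lemma w10_eq : w10 = wcons true (cst false).
Proof. apply functional_extensionality; intros [|n]; reflexivity. Qed.
Lemma w01_eq : w01 = wcons false (cst true).
Proof. apply functional_extensionality; intros [|n]; reflexivity. Qed.
Lemma w010_eq : w010 = wcons false w10.
Proof. apply functional_extensionality; intros [|[|n]]; reflexivity. Qed.
Lemma w101_eq : w101 = wcons true w01.
Proof. apply functional_extensionality; intros [|[|n]]; reflexivity. Qed.

Lemma le_w01 x : x 0%nat = false -> lex_le x w01.
Proof.
  intros H. rewrite w01_eq, <- (wcons_shift x), H. apply lex_le_wcons, le_cst_true.
Qed.

Lemma ge_w10 x : x 0%nat = true -> lex_le w10 x.
Proof.
  intros H. rewrite w10_eq, <- (wcons_shift x), H. apply lex_le_wcons, cst_false_le.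
Qed.

(** The leading 0 is there so that 10^w occurs after a 0, as [bounds] requires; in 10^w itself it
    does not. *)
Lemma bounds_w010 : bounds w010 (cst false) w10.
Proof.
  split; [|split; [|split]].
  - intros; apply cst_false_le.
  - intros [|[|k]].
    + now apply lex_le_heads.
    + apply lex_le_refl.
    + now apply lex_le_heads.
  - intros N; exists 1%nat; split; auto. now intros i _.
  - intros N; exists 0%nat; split; auto. now intros i _.
Qed.

Lemma bounds_w101 : bounds w101 w01 (cst true).
Proof.
  split; [|split; [|split]].
  - intros [|[|k]].
    + now apply lex_le_heads.
    + apply lex_le_refl.
    + now apply lex_le_heads.
  - intros; apply le_cst_true.
  - intros N; exists 0%nat; split; auto. now intros i _.
  - intros N; exists 1%nat; split; auto. now intros i _.
Qed.

(** In 01^w no tail starting with 0 follows a 1, so [bounds] fails for this word and infimum and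
    supremum are found directly. *)
Lemma infw_w01 : infw w01 = w01.
Proof.
  apply infw_eq; [intros k|intros N; exists 0%nat; apply agr_refl].
  destruct k; [apply lex_le_refl|]. now apply lex_le_heads.
Qed.

Lemma supw_w01 : supw w01 = cst true.
Proof.
  apply supw_eq; [intros k; apply le_cst_true|intros N; exists 1%nat; apply agr_refl].
Qed.

(** Coinduction by blocks: a relation that survives removing a letter on one side and its image on
    the other determines every prefix. *)
Lemma subst_coind t (P : bword -> bword -> Prop) :
  (forall x y, P x y -> exists c x' y', x = wcons c x' /\ y = wapp (img t c) y' /\ P x' y') ->
  forall x y, P x y -> y = subst_inf t x.
Proof.
  intros Hstep x y H. apply agr_eq. intros N; revert x y H.
  induction N as [|N IH]; intros x y H; [intros i Hi; lia|].
  destruct (Hstep x y H) as (c & x' & y' & -> & -> & H').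
  rewrite subst_cons. eapply agr_le; [|apply agr_wapp, IH, H'].
  generalize (img_nonempty t c); lia.
Qed.

Definition alt (b : bool) : bword := fun n => xorb b (Nat.odd n).

Lemma alt_wcons b : alt b = wcons b (alt (negb b)).
Proof.
  apply functional_extensionality; intros [|n]; unfold alt; simpl.
  - apply Bool.xorb_false_r.
  - rewrite Nat.odd_succ, <- Nat.negb_odd. destruct b, (Nat.odd n); reflexivity.
Qed.

Lemma alt_wcons2 b : alt b = wcons b (wcons (negb b) (alt b)).
Proof. rewrite alt_wcons, alt_wcons at 1. now rewrite Bool.negb_involutive. Qed.

Lemma M_cst b : subst_inf SM (cst b) = alt b.
Proof.
  symmetry. apply (subst_coind SM (fun x y => x = cst b /\ y = alt b)); auto.
  intros x y [-> ->]. exists b, (cst b), (alt b). split; [apply cst_wcons|split; auto].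
  rewrite alt_wcons2 at 1. now destruct b.
Qed.

Lemma L_cst_true : subst_inf SL (cst true) = alt false.
Proof.
  symmetry. apply (subst_coind SL (fun x y => x = cst true /\ y = alt false)); auto.
  intros x y [-> ->]. exists true, (cst true), (alt false). split; [apply cst_wcons|split; auto].
  apply alt_wcons2.
Qed.

Lemma R_cst_false : subst_inf SR (cst false) = alt false.
Proof.
  symmetry. apply (subst_coind SR (fun x y => x = cst false /\ y = alt false)); auto.
  intros x y [-> ->]. exists false, (cst false), (alt false). split; [apply cst_wcons|split; auto].
  apply alt_wcons2.
Qed.

Lemma L_cst_false : subst_inf SL (cst false) = cst false.
Proof.
  symmetry. apply (subst_coind SL (fun x y => x = cst false /\ y = cst false)); auto.
  intros x y [-> ->]. exists false, (cst false), (cst false). repeat split; apply cst_wcons.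
Qed.

Lemma R_cst_true : subst_inf SR (cst true) = cst true.
Proof.
  symmetry. apply (subst_coind SR (fun x y => x = cst true /\ y = cst true)); auto.
  intros x y [-> ->]. exists true, (cst true), (cst true). repeat split; apply cst_wcons.
Qed.

(** The pair (0^w, 10^w) is fixed by L and the pair (01^w, 1^w) by R: the curve starts where its
    L-image starts and ends where its R-image ends. *)
Lemma AL_0 : Asub SL (cst false) = cst false.
Proof. apply L_cst_false. Qed.
Lemma BL_w10 : Bsub SL w10 = w10.
Proof. simpl. rewrite w10_eq, subst_cons, L_cst_false. reflexivity. Qed.
Lemma AR_w01 : Asub SR w01 = w01.
Proof. simpl. rewrite w01_eq, subst_cons, R_cst_true. simpl. now rewrite <- cst_wcons. Qed.
Lemma BR_1 : Bsub SR (cst true) = cst true.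
Proof. simpl. rewrite R_cst_true. now rewrite <- cst_wcons. Qed.

(** The first junction: the end of the L-image and the start of the M-image share the lower word and
    differ in the upper one. Between them the critical base follows g. *)
Lemma AL_w01 : Asub SL w01 = Asub SM (cst false).
Proof. simpl. rewrite w01_eq, subst_cons, L_cst_true, M_cst. reflexivity. Qed.
Lemma BL_1 : Bsub SL (cst true) = alt true.
Proof. simpl. rewrite L_cst_true, alt_wcons. reflexivity. Qed.
(** The second junction: the end of the M-image and the start of the R-image share the upper word,
    and the critical base follows f between them. *)
Lemma BR_w10 : Bsub SR w10 = Bsub SM (cst true).
Proof.
  simpl. rewrite w10_eq, subst_cons, R_cst_false, M_cst, (alt_wcons true). reflexivity.
Qed.

Lemma M_w01 : subst_inf SM w01 = subst_inf SR w010.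
Proof.
  rewrite w010_eq, w10_eq, w01_eq, !subst_cons, R_cst_false, M_cst. simpl.
  now rewrite (alt_wcons true).
Qed.

Lemma bounds_M_w01 : bounds (subst_inf SM w01) (Asub SR (cst false)) (Bsub SR w10).
Proof. rewrite M_w01. apply bounds_subst; [reflexivity|apply bounds_w010]. Qed.

(** 0M(10^w) = L(101^w), so the inequalities are inherited from the L-image; the extreme tails are
    then located explicitly in 10(01)^w. *)
Lemma bounds_M_w10 : bounds (subst_inf SM w10) (Asub SL w01) (Bsub SL (cst true)).
Proof.
  assert (E : subst_inf SL w101 = wcons false (subst_inf SM w10)).
  { rewrite w101_eq, w01_eq, w10_eq, !subst_cons, L_cst_true, M_cst. reflexivity. }
  destruct (bounds_subst SL _ _ _ eq_refl bounds_w101) as (H1 & H2 & _ & _).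
  assert (EM : subst_inf SM w10 = wcons true (wcons false (alt false))).
  { rewrite w10_eq, subst_cons, M_cst; reflexivity. }
  split; [|split; [|split]].
  - intros k. specialize (H1 (S k)). now rewrite E in H1.
  - intros k. specialize (H2 (S k)). now rewrite E in H2.
  - intros N; exists 0%nat. rewrite EM; split; [reflexivity|].
    rewrite AL_w01; simpl; rewrite M_cst. apply agr_refl.
  - intros N; exists 2%nat. rewrite EM, BL_1; split; [reflexivity|].
    rewrite (alt_wcons false). apply agr_refl.
Qed.

(** * Limit words *)

Definition eventually_cst (b : bool) (u : bword) : Prop := exists N, shiftn N u = cst b.

Lemma cst_of_constant u : (forall k, u (S k) = u k) -> u = cst (u 0%nat).
Proof.
  intros H; apply functional_extensionality; intros n; unfold cst.
  induction n; congruence.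
Qed.

Lemma exists_10 u : ~ eventually_cst false u -> ~ eventually_cst true u ->
  exists k, u k = true /\ u (S k) = false.
Proof.
  intros H0 H1. apply NNPP; intros H.
  destruct (classic (exists k, u k = true)) as [[k Hk]|Hn].
  - apply H1; exists k.
    assert (A : forall i, shiftn k u i = true).
    { induction i as [|i IH]; unfold shiftn in *; [now rewrite Nat.add_0_r|].
      rewrite Nat.add_succ_r. destruct (u (S (k + i))) eqn:E; auto.
      exfalso; eauto. }
    apply functional_extensionality; intros; now rewrite A.
  - apply H0; exists 0%nat. apply functional_extensionality; intros i.
    unfold shiftn, cst; simpl. destruct (u i) eqn:E; auto. exfalso; eauto.
Qed.

Lemma exists_01 u : ~ eventually_cst false u -> ~ eventually_cst true u ->
  exists k, u k = false /\ u (S k) = true.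
Proof.
  intros H0 H1. apply NNPP; intros H.
  destruct (classic (exists k, u k = false)) as [[k Hk]|Hn].
  - apply H0; exists k.
    assert (A : forall i, shiftn k u i = false).
    { induction i as [|i IH]; unfold shiftn in *; [now rewrite Nat.add_0_r|].
      rewrite Nat.add_succ_r. destruct (u (S (k + i))) eqn:E; auto.
      exfalso; eauto. }
    apply functional_extensionality; intros; now rewrite A.
  - apply H1; exists 0%nat. apply functional_extensionality; intros i.
    unfold shiftn, cst; simpl. destruct (u i) eqn:E; auto. exfalso; eauto.
Qed.

Lemma eventually_cst_le b u N N' : (N <= N')%nat -> shiftn N u = cst b -> shiftn N' u = cst b.
Proof.
  intros H E. replace N' with (N + (N' - N))%nat by lia.
  now rewrite <- shiftn_shiftn, E.
Qed.

(** The R-block of 1 is the only block made of ones alone. *)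
Lemma subst_eventually_true t u : eventually_cst true (subst_inf t u) ->
  t = SR /\ eventually_cst true u.
Proof.
  intros [N E].
  assert (A : forall k, (N <= k)%nat -> subst_inf t (shiftn k u) = cst true).
  { intros k Hk. destruct (shiftn_subst_of t u k) as (j & Hj & Ej).
    rewrite <- Ej. apply (eventually_cst_le _ _ N); auto; lia. }
  assert (B : forall k, (N <= k)%nat -> t = SR /\ u k = true).
  { intros k Hk. specialize (A k Hk). rewrite shiftn_expand, subst_cons in A.
    assert (A0 := f_equal (fun w => w 0%nat) A).
    assert (A1 := f_equal (fun w => w 1%nat) A).
    destruct t, (u k); simpl in A0, A1; auto; discriminate. }
  split; [apply (B N); lia|]. exists N.
  apply functional_extensionality; intros i; apply (B (N + i)%nat); lia.
Qed.

Lemma subst_eventually_false t u : eventually_cst false (subst_inf t u) ->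
  t = SL /\ eventually_cst false u.
Proof.
  intros [N E].
  assert (A : forall k, (N <= k)%nat -> subst_inf t (shiftn k u) = cst false).
  { intros k Hk. destruct (shiftn_subst_of t u k) as (j & Hj & Ej).
    rewrite <- Ej. apply (eventually_cst_le _ _ N); auto; lia. }
  assert (B : forall k, (N <= k)%nat -> t = SL /\ u k = false).
  { intros k Hk. specialize (A k Hk). rewrite shiftn_expand, subst_cons in A.
    assert (A0 := f_equal (fun w => w 0%nat) A).
    assert (A1 := f_equal (fun w => w 1%nat) A).
    destruct t, (u k); simpl in A0, A1; auto; discriminate. }
  split; [apply (B N); lia|]. exists N.
  apply functional_extensionality; intros i; apply (B (N + i)%nat); lia.
Qed.

Definition pref (s : nat -> sub) (n : nat) : list sub := map s (seq 0 n).

Lemma pref_S s n : pref s (S n) = pref s n ++ [s n].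
Proof. unfold pref. now rewrite seq_S, map_app. Qed.

Lemma length_pref s n : length (pref s n) = n.
Proof. unfold pref. now rewrite length_map, length_seq. Qed.

Lemma limit_word_pref s U : (forall n, U n = subst_inf (s n) (U (S n))) ->
  forall n, U 0%nat = apply_subs (pref s n) (U n).
Proof.
  intros H n; induction n as [|n IH]; [reflexivity|].
  rewrite pref_S. unfold apply_subs. rewrite fold_right_app. simpl.
  rewrite <- H. exact IH.
Qed.

(** A constant tail at level n would lift to all later levels, and each lift forces the substitution
    used to be L (for zeros) or R (for ones). *)
Lemma primitive_not_eventually_cst s U b : primitive s ->
  (forall n, U n = subst_inf (s n) (U (S n))) -> forall n, ~ eventually_cst b (U n).
Proof.
  intros [PL PR] H n E.
  assert (A : forall k, s (n + k)%nat = (if b then SR else SL) /\ eventually_cst b (U (n + k)%nat)).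
  { induction k as [|k [_ IH]].
    - rewrite Nat.add_0_r. split; auto. rewrite H in E.
      destruct b; [apply subst_eventually_true in E|apply subst_eventually_false in E]; tauto.
    - rewrite H in IH. rewrite Nat.add_succ_r.
      assert (E' : eventually_cst b (U (S (n + k)))).
      { destruct b; [apply subst_eventually_true in IH|apply subst_eventually_false in IH]; tauto. }
      split; auto. rewrite H in E'.
      destruct b; [apply subst_eventually_true in E'|apply subst_eventually_false in E']; tauto. }
  destruct b; [apply PR|apply PL]; exists n; intros k Hk;
    replace k with (n + (k - n))%nat by lia; apply (A (k - n)%nat).
Qed.

(** A diagonal limit: letter i is settled by the first [S i] substitutions, whichever word starting
    with 0 they act on; [w01] is a placeholder. *)
Definition limA (s : nat -> sub) : bword := fun i => Asubs (pref s (S i)) w01 i.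
Definition limB (s : nat -> sub) : bword := fun i => Bsubs (pref s (S i)) w10 i.

Lemma limA_agr s n x : x 0%nat = false -> agr n (Asubs (pref s n) x) (limA s).
Proof.
  intros Hx i Hi. unfold limA.
  replace (pref s n) with (pref s (S i) ++ map s (seq (S i) (n - S i))).
  - rewrite Asubs_app. apply (Asubs_agr_0 (pref s (S i))); auto using Asubs_0.
    rewrite length_pref; lia.
  - unfold pref. rewrite <- map_app. f_equal.
    replace n with (S i + (n - S i))%nat at 2 by lia. now rewrite seq_app.
Qed.

Lemma limB_agr s n x : x 0%nat = true -> agr n (Bsubs (pref s n) x) (limB s).
Proof.
  intros Hx i Hi. unfold limB.
  replace (pref s n) with (pref s (S i) ++ map s (seq (S i) (n - S i))).
  - rewrite Bsubs_app. apply (Bsubs_agr_0 (pref s (S i))); auto using Bsubs_0.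
    rewrite length_pref; lia.
  - unfold pref. rewrite <- map_app. f_equal.
    replace n with (S i + (n - S i))%nat at 2 by lia. now rewrite seq_app.
Qed.

Lemma substs_tail_true l u k : u k = true ->
  exists j, apply_subs l u j = true /\
    shiftn (S j) (apply_subs l u) = Asubs l (shiftn (S k) u).
Proof.
  intros Hk; induction l as [|t l (j & Hj & E)]; [now exists k|].
  destruct (subst_tail_true t _ _ Hj) as (j' & Hj' & E').
  exists j'; split; auto. simpl. now rewrite E', E.
Qed.

Lemma substs_tail_false l u k : u k = false ->
  exists j, apply_subs l u j = false /\
    shiftn (S j) (apply_subs l u) = Bsubs l (shiftn (S k) u).
Proof.
  intros Hk; induction l as [|t l (j & Hj & E)]; [now exists k|].
  destruct (subst_tail_false t _ _ Hj) as (j' & Hj' & E').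
  exists j'; split; auto. simpl. now rewrite E', E.
Qed.

(** The inequalities come from 0^w and 1^w at level n, letting n grow. For the approach, a factor 10
    of [U N] puts after some 1 of u a word [Asubs (pref s N) v] with v starting with 0, which has N
    letters in common with [limA s]; a factor 01 serves [limB s]. *)
Lemma bounds_limit_word s u : primitive s -> limit_word s u -> bounds u (limA s) (limB s).
Proof.
  intros Hs (U & <- & HU).
  assert (Hp := limit_word_pref s U HU).
  assert (H0 := primitive_not_eventually_cst s U false Hs HU).
  assert (H1 := primitive_not_eventually_cst s U true Hs HU).
  split; [|split; [|split]].
  - intros k. apply (lex_le_limit_l (fun n => Asubs (pref s n) (cst false))).
    + intros n; now apply limA_agr.
    + intros n. rewrite (Hp n). apply orbit_ge_substs. intros; apply cst_false_le.
  - intros k. apply (lex_le_limit_r (fun n => Bsubs (pref s n) (cst true))).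
    + intros n; now apply limB_agr.
    + intros n. rewrite (Hp n). apply orbit_le_substs; [reflexivity|].
      intros; apply le_cst_true.
  - intros N. destruct (exists_10 (U N)) as (k & Hk & Hk'); auto.
    destruct (substs_tail_true (pref s N) _ _ Hk) as (j & Hj & E).
    exists j. rewrite (Hp N); split; auto. rewrite E. apply limA_agr.
    unfold shiftn; now rewrite Nat.add_0_r.
  - intros N. destruct (exists_01 (U N)) as (k & Hk & Hk'); auto.
    destruct (substs_tail_false (pref s N) _ _ Hk) as (j & Hj & E).
    exists j. rewrite (Hp N); split; auto. rewrite E. apply limB_agr.
    unfold shiftn; now rewrite Nat.add_0_r.
Qed.

(** The k substitutions from index n on, applied to 0^w. All these words start with 0, so each
    further substitution settles one more letter and the limit word starting with 0 exists. *)
Fixpoint approx (s : nat -> sub) (k n : nat) : bword :=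
  match k with
  | O => cst false
  | S k' => subst_inf (s n) (approx s k' (S n))
  end.

Lemma approx_0 s k n : approx s k n 0%nat = false.
Proof. revert n; induction k; intros n; simpl; auto using subst_0. Qed.

Lemma agr_subst_0 N t x y : x 0%nat = false ->
  agr (S N) x y -> agr (S (S N)) (subst_inf t x) (subst_inf t y).
Proof.
  intros H0 H. rewrite (subst_unfold t x), (subst_unfold t y), <- (H 0%nat), H0 by lia.
  destruct t; simpl.
  - apply agr_wcons, agr_subst_L, agr_shift, H.
  - apply agr_wcons, agr_wcons, agr_subst, agr_shift, H.
  - apply agr_wcons, agr_wcons, agr_subst, agr_shift, H.
Qed.

Lemma approx_agr s k k' n : (k <= k')%nat -> agr (S k) (approx s k n) (approx s k' n).
Proof.
  revert k' n; induction k as [|k IH]; intros k' n H.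
  - intros i Hi. replace i with 0%nat by lia. now rewrite !approx_0.
  - destruct k' as [|k']; [lia|]. simpl. apply agr_subst_0; [apply approx_0|].
    apply IH; lia.
Qed.

Lemma limit_word_exists s : exists u, limit_word s u.
Proof.
  set (U n := (fun i => approx s i n i) : bword). exists (U 0%nat), U. split; auto.
  intros n. apply agr_eq. intros N i Hi. unfold U at 1.
  rewrite (approx_agr s i (S i) n) by lia. simpl.
  apply (agr_subst (S i)); [|lia]. intros j Hj. unfold U.
  symmetry. apply approx_agr; lia.
Qed.

(** * Eventually periodic words *)

Definition eperiodic (u : bword) : Prop :=
  exists N p, (0 < p)%nat /\ shiftn (N + p) u = shiftn N u.

Lemma eperiodic_wapp l u : eperiodic u -> eperiodic (wapp l u).
Proof.
  intros (N & p & Hp & E). exists (length l + N)%nat, p; split; auto.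
  rewrite <- Nat.add_assoc, <- !shiftn_shiftn, shiftn_wapp.
  now rewrite shiftn_shiftn.
Qed.

Lemma eperiodic_subst t u : eperiodic u -> eperiodic (subst_inf t u).
Proof.
  intros (N & p & Hp & E).
  destruct (shiftn_subst_of t u N) as (j & _ & Ej).
  destruct (shiftn_subst_of t (shiftn N u) p) as (j' & Hj' & Ej').
  exists j, j'; split; [lia|].
  now rewrite <- shiftn_shiftn, Ej, Ej', shiftn_shiftn, E.
Qed.

Lemma eperiodic_eventually_cst b u : eventually_cst b u -> eperiodic u.
Proof.
  intros (N & E). exists N, 1%nat; split; [lia|].
  now rewrite <- shiftn_shiftn, E.
Qed.

Fixpoint code (l : list bool) : nat :=
  match l with
  | [] => 0%nat
  | b :: l => S (2 * code l + if b then 1 else 0)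
  end.

Lemma code_inj l l' : code l = code l' -> l = l'.
Proof.
  revert l'; induction l as [|b l IH]; intros [|b' l'] H; simpl in H; try lia; auto.
  assert (code l = code l' /\ b = b') as [H1 ->] by (destruct b, b'; split; auto; lia).
  now rewrite (IH l').
Qed.

(** A word is recovered from a preperiod N, a period p and its first N + p letters. *)
Lemma countable_eperiodic : countable eperiodic.
Proof.
  destruct (choice (fun (u : bword) (q : nat * nat) => eperiodic u ->
    (0 < snd q)%nat /\ shiftn (fst q + snd q) u = shiftn (fst q) u)) as [h Hh].
  { intros u. destruct (classic (eperiodic u)) as [(N & p & Hp)|Hn].
    - now exists (N, p).
    - exists (0, 0)%nat; tauto. }
  exists (fun u => Cantor.to_nat (Cantor.to_nat (h u),
    code (map u (seq 0 (fst (h u) + snd (h u)))))).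
  intros x y Hx Hy E. apply Cantor.to_nat_inj in E.
  injection E as E1 E2. apply Cantor.to_nat_inj in E1. apply code_inj in E2.
  rewrite <- E1 in E2.
  destruct (Hh x Hx) as [Hp Sx], (Hh y Hy) as [_ Sy]. rewrite <- E1 in Sy.
  destruct (h x) as [N p]. simpl in *.
  assert (A : forall n, (n < N + p)%nat -> x n = y n).
  { intros n Hn. assert (B := f_equal (fun l => nth n l (x 0%nat)) E2). simpl in B.
    rewrite (nth_indep (map y _) (x 0%nat) (y 0%nat)) in B; [|rewrite length_map, length_seq; lia].
    rewrite !map_nth in B.
    rewrite !seq_nth in B by lia. exact B. }
  apply functional_extensionality. intros n.
  induction n as [n IH] using (well_founded_induction Wf_nat.lt_wf).
  destruct (Nat.lt_ge_cases n (N + p)) as [L|L]; auto.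
  assert (Bx := f_equal (fun w => w (n - (N + p))%nat) Sx).
  assert (By := f_equal (fun w => w (n - (N + p))%nat) Sy).
  unfold shiftn in Bx, By. replace (N + p + (n - (N + p)))%nat with n in Bx, By by lia.
  rewrite Bx, By. apply IH. lia.
Qed.

(** * Desubstitution *)

Definition downset (Lo : bword -> Prop) := forall x y, lex_le x y -> Lo y -> Lo x.
Definition upset (Hi : bword -> Prop) := forall x y, lex_le x y -> Hi x -> Hi y.

(** Forbidden tails are given by predicates rather than by two extreme words, so that desubstitution
    is mere precomposition with [Asub t] and [Bsub t]. *)
Definition avoids (Lo Hi : bword -> Prop) (u : bword) : Prop :=
  forall k, (u k = true -> ~ Lo (shiftn (S k) u)) /\
            (u k = false -> ~ Hi (shiftn (S k) u)).

Lemma avoids_shiftn Lo Hi u k : avoids Lo Hi u -> avoids Lo Hi (shiftn k u).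
Proof.
  intros H j. rewrite shiftn_shiftn, Nat.add_succ_r. apply H.
Qed.

Lemma avoids_desubst Lo Hi t u : avoids Lo Hi (subst_inf t u) ->
  avoids (fun v => Lo (Asub t v)) (fun v => Hi (Bsub t v)) u.
Proof.
  intros H k; split; intros Hk.
  - destruct (subst_tail_true t u k Hk) as (j & Hj & <-). now apply H.
  - destruct (subst_tail_false t u k Hk) as (j & Hj & <-). now apply H.
Qed.

(** Iterating a chosen removal of one block inside the invariant P reads the preimage off letter by
    letter. *)
Lemma parse_subst t (P : bword -> Prop) :
  (forall w, P w -> exists c w', w = wapp (img t c) w' /\ P w') ->
  forall w, P w -> exists u, w = subst_inf t u.
Proof.
  intros H.
  destruct (choice (fun (w : bword) (q : bool * bword) => P w ->
     w = wapp (img t (fst q)) (snd q) /\ P (snd q))) as [h Hh].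
  { intros w. destruct (classic (P w)) as [Hw|]; [|exists (true, w); tauto].
    destruct (H w Hw) as (c & w' & Hc). now exists (c, w'). }
  intros w Hw.
  set (u w := (fun n => fst (h (Nat.iter n (fun x => snd (h x)) w))) : bword).
  exists (u w). apply (subst_coind t (fun x y => P y /\ x = u y)); auto.
  intros x y [Hy ->]. destruct (Hh y Hy) as [E1 E2].
  exists (fst (h y)), (u (snd (h y))), (snd (h y)). repeat split; auto.
  apply functional_extensionality; intros [|n]; [reflexivity|]. unfold u; simpl.
  f_equal. f_equal. clear. induction n as [|n IH]; simpl; congruence.
Qed.

Definition desubstitutable Lo Hi t (u : bword) : Prop := exists p u',
  u = wapp p (subst_inf t u') /\
  avoids (fun v => Lo (Asub t v)) (fun v => Hi (Bsub t v)) u'.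

Lemma desubstitutable_shiftn Lo Hi t u k u' : avoids Lo Hi u ->
  shiftn k u = subst_inf t u' -> desubstitutable Lo Hi t u.
Proof.
  intros H E. destruct (wapp_shiftn k u) as (p & _ & Ep).
  exists p, u'. rewrite <- E; split; auto.
  apply avoids_desubst. rewrite <- E. now apply avoids_shiftn.
Qed.

(** [Bsub SL y] starts with 0 or 10, hence lies below every word 11..., and the factor 011 is
    excluded. From its first 0 on, the word splits into blocks 0 and 01. *)
Lemma desubst_L Lo Hi u y : upset Hi -> Hi (Bsub SL y) -> avoids Lo Hi u ->
  eperiodic u \/ desubstitutable Lo Hi SL u.
Proof.
  intros HU Hy H.
  destruct (classic (exists k, u k = false)) as [[k Hk]|Hn].
  2:{ left; apply (eperiodic_eventually_cst true). exists 0%nat.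
      apply functional_extensionality; intros i. unfold shiftn, cst; simpl.
      destruct (u i) eqn:E; auto; exfalso; eauto. }
  right.
  destruct (parse_subst SL (fun w => w 0%nat = false /\ avoids Lo Hi w)) with (w := shiftn k u)
    as [u' E].
  - intros w [W0 HW].
    assert (W12 : ~ (w 1%nat = true /\ w 2%nat = true)).
    { intros [W1 W2]. apply (proj2 (HW 0%nat) W0). eapply HU; [|exact Hy].
      simpl. rewrite (subst_unfold SL y).
      rewrite (shiftn_expand 1 w), (shiftn_expand 2 w), W1, W2.
      destruct (y 0%nat); simpl; rewrite shift_wcons.
      - apply lex_le_wcons, lex_le_heads; auto using subst_L_0.
      - apply lex_le_heads; auto using subst_L_0. }
    destruct (w 1%nat) eqn:W1.
    + exists true, (shiftn 2 w); split.
      * simpl. now rewrite <- W0, <- W1, <- !shiftn_expand, shiftn0 .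
      * split; [|now apply avoids_shiftn]. unfold shiftn; simpl.
        destruct (w 2%nat); auto; tauto.
    + exists false, (shiftn 1 w); split.
      * simpl. now rewrite <- W0, <- shiftn_expand.
      * split; [exact W1|now apply avoids_shiftn].
  - split; [unfold shiftn; now rewrite Nat.add_0_r|now apply avoids_shiftn].
  - eapply desubstitutable_shiftn; eauto.
Qed.

(** [Asub SR x] starts with 1 or 01, hence lies above every word 00..., and the factor 100 is
    excluded. From its first 1 on, the word splits into blocks 1 and 01. *)
Lemma desubst_R Lo Hi u x : downset Lo -> Lo (Asub SR x) -> avoids Lo Hi u ->
  eperiodic u \/ desubstitutable Lo Hi SR u.
Proof.
  intros HU Hy H.
  destruct (classic (exists k, u k = true)) as [[k Hk]|Hn].
  2:{ left; apply (eperiodic_eventually_cst false). exists 0%nat.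
      apply functional_extensionality; intros i. unfold shiftn, cst; simpl.
      destruct (u i) eqn:E; auto; exfalso; eauto. }
  right.
  destruct (parse_subst SR (fun w => (w 0%nat = false -> w 1%nat = true) /\ avoids Lo Hi w))
    with (w := shiftn k u) as [u' E].
  - intros w [W01 HW].
    assert (W1 : forall j, w j = true -> shiftn (S j) w 0%nat = false -> shiftn (S j) w 1%nat = true).
    { intros j Wj Wj0. destruct (shiftn (S j) w 1%nat) eqn:Wj1; auto. exfalso.
      apply (proj1 (HW j) Wj). eapply HU; [|exact Hy].
      simpl. rewrite (subst_unfold SR x), <- (wcons_shift (shiftn (S j) w)), Wj0.
      destruct (x 0%nat); simpl.
      - now apply lex_le_heads.
      - apply lex_le_wcons. now apply lex_le_heads. }
    destruct (w 0%nat) eqn:W0.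
    + exists true, (shiftn 1 w); split.
      * simpl. now rewrite <- W0, <- shiftn_expand.
      * split; [now apply W1|now apply avoids_shiftn].
    + exists false, (shiftn 2 w); split.
      * simpl. rewrite <- W0, <- (W01 eq_refl), <- !shiftn_expand. reflexivity.
      * split; [apply W1; auto|now apply avoids_shiftn].
  - split; [unfold shiftn; rewrite Nat.add_0_r; congruence|now apply avoids_shiftn].
  - eapply desubstitutable_shiftn; eauto.
Qed.

(* After a factor [100] or [011] the word is forced to split into blocks
   [01] and [10]: the invariant is that the rest lies between the alternating words. *)
Lemma desubst_M Lo Hi u x y : downset Lo -> upset Hi ->
  Lo (Asub SM x) -> Hi (Bsub SM y) -> avoids Lo Hi u ->
  eperiodic u \/ desubstitutable Lo Hi SM u.
Proof.
  intros HD HU Hx Hy H.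
  assert (HLo : forall v, avoids Lo Hi v -> forall k, v k = true ->
    lex_le (wcons false (alt false)) (shiftn (S k) v)).
  { intros v Hv k Hk. destruct (lex_total (wcons false (alt false)) (shiftn (S k) v)) as [|Hl]; auto.
    exfalso. apply (proj1 (Hv k) Hk). eapply HD; [|exact Hx]. simpl.
    eapply lex_le_trans; [right; exact Hl|]. rewrite <- M_cst.
    apply lex_le_wcons, subst_le, cst_false_le. }
  assert (HHi : forall v, avoids Lo Hi v -> forall k, v k = false ->
    lex_le (shiftn (S k) v) (wcons true (alt true))).
  { intros v Hv k Hk. destruct (lex_total (shiftn (S k) v) (wcons true (alt true))) as [|Hl]; auto.
    exfalso. apply (proj2 (Hv k) Hk). eapply HU; [|exact Hy]. simpl.
    eapply lex_le_trans; [|right; exact Hl]. rewrite <- M_cst.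
    apply lex_le_wcons, subst_le, le_cst_true. }
  assert (Hparse : forall w, avoids Lo Hi w -> lex_le (alt false) w -> lex_le w (alt true) ->
     exists u', w = subst_inf SM u').
  { intros w W1 W2 W3.
    apply (parse_subst SM (fun w => avoids Lo Hi w /\ lex_le (alt false) w /\ lex_le w (alt true))); auto.
    clear w W1 W2 W3. intros w (W1 & W2 & W3).
    assert (Ew : w = wcons (w 0%nat) (wcons (w 1%nat) (shiftn 2 w))).
    { now rewrite <- !shiftn_expand. }
    assert (E1 : shiftn 1 w = wcons (w 1%nat) (shiftn 2 w)) by now rewrite <- shiftn_expand.
    rewrite Ew in W2, W3. rewrite alt_wcons2 in W2, W3. simpl in W2, W3.
    destruct (w 0%nat) eqn:W00, (w 1%nat) eqn:W11.
    - exfalso. apply lex_le_wcons_inv in W3.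
      now apply (lex_lt_not_le _ _ (lex_lt_01 (alt true) (shiftn 2 w))).
    (* After a block 10 the upper bound on the rest is inherited from w, while the lower one comes
       from what may follow the 1; a block 01 exchanges the two. *)
    - exists true, (shiftn 2 w). split; [exact Ew|]. split; [|split].
      + now apply avoids_shiftn.
      + apply (lex_le_wcons_inv false). rewrite <- E1. now apply HLo.
      + now apply lex_le_wcons_inv, lex_le_wcons_inv in W3.
    - exists false, (shiftn 2 w). split; [exact Ew|]. split; [|split].
      + now apply avoids_shiftn.
      + now apply lex_le_wcons_inv, lex_le_wcons_inv in W2.
      + apply (lex_le_wcons_inv true). rewrite <- E1. now apply HHi.
    - exfalso. apply lex_le_wcons_inv in W2.
      now apply (lex_lt_not_le _ _ (lex_lt_01 (shiftn 2 w) (alt false))). }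
  destruct (classic (exists k, u k <> u (S k) /\ u (S k) = u (S (S k)))) as [(k & Hk & Hk')|Hn].
  - right. destruct (Hparse (shiftn (S (S k)) u)) as [u' E].
    + now apply avoids_shiftn.
    + destruct (u k) eqn:Ek.
      * apply (lex_le_wcons_inv false). replace false with (u (S k)) by (destruct (u (S k)); congruence).
        rewrite <- shiftn_expand. replace (u (S k)) with false by (destruct (u (S k)); congruence).
        now apply HLo.
      * apply lex_le_heads; [reflexivity|]. rewrite shiftn_expand; simpl.
        destruct (u (S k)); congruence.
    + destruct (u k) eqn:Ek.
      * apply lex_le_heads; [|reflexivity]. rewrite shiftn_expand; simpl.
        destruct (u (S k)); congruence.
      * apply (lex_le_wcons_inv true). replace true with (u (S k)) at 1 by (destruct (u (S k)); congruence).
        rewrite <- shiftn_expand. now apply HHi.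
    + eapply desubstitutable_shiftn; eauto.
  (* Without such a factor every change of letter is followed at once by another: the word is
     constant or alternates from some place on. *)
  - left.
    destruct (classic (exists k, u k <> u (S k))) as [(k & Hk)|Hc].
    + assert (A : forall i, u (k + i)%nat <> u (S (k + i))).
      { induction i as [|i IH]; [now rewrite Nat.add_0_r|].
        rewrite Nat.add_succ_r. intros E. apply Hn. eauto. }
      exists k, 2%nat; split; [lia|]. apply functional_extensionality; intros i.
      unfold shiftn. assert (A0 := A i). assert (A1 := A (S i)).
      rewrite Nat.add_succ_r in A1. replace (k + 2 + i)%nat with (S (S (k + i))) by lia.
      destruct (u (k + i)%nat), (u (S (k + i))), (u (S (S (k + i)))); congruence.
    + apply (eperiodic_eventually_cst (u 0%nat)). exists 0%nat. apply cst_of_constant.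
      intros k. destruct (Bool.bool_dec (u (S k)) (u k)) as [|D]; auto. exfalso; eauto.
Qed.

Lemma desubst t Lo Hi u x y : downset Lo -> upset Hi ->
  Lo (Asub t x) -> Hi (Bsub t y) -> avoids Lo Hi u ->
  eperiodic u \/ desubstitutable Lo Hi t u.
Proof.
  intros; destruct t; eauto using desubst_L, desubst_M, desubst_R.
Qed.

Lemma Asub_le t x y : lex_le x y -> lex_le (Asub t x) (Asub t y).
Proof. intros H; destruct t; simpl; auto using subst_le, lex_le_wcons. Qed.

Lemma Bsub_le t x y : lex_le x y -> lex_le (Bsub t x) (Bsub t y).
Proof.
  intros H; destruct t; simpl; auto using subst_le, lex_le_wcons.
  apply (lex_le_wcons_inv false).
  rewrite <- (subst_L_0 x) at 1. rewrite <- (subst_L_0 y) at 1.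
  rewrite !wcons_shift. now apply subst_le.
Qed.

(** Every word starting with 0 is at most 01^w, so no 0 can follow a 1. *)
Lemma avoids_w01 Lo Hi u : downset Lo -> Lo w01 -> avoids Lo Hi u -> eperiodic u.
Proof.
  intros HD Hw H. destruct (classic (exists k, u k = true)) as [[k Hk]|Hn].
  - apply (eperiodic_eventually_cst true). exists k.
    assert (A : forall i, u (k + i)%nat = true).
    { induction i as [|i IH]; [now rewrite Nat.add_0_r|]. rewrite Nat.add_succ_r.
      destruct (u (S (k + i))) eqn:E; auto. exfalso.
      apply (proj1 (H (k + i)%nat) IH). eapply HD; [apply le_w01|exact Hw].
      unfold shiftn; now rewrite Nat.add_0_r. }
    apply functional_extensionality; exact A.
  - apply (eperiodic_eventually_cst false). exists 0%nat.
    apply functional_extensionality; intros i. unfold shiftn, cst; simpl.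
    destruct (u i) eqn:E; auto; exfalso; eauto.
Qed.

Lemma avoids_w10 Lo Hi u : upset Hi -> Hi w10 -> avoids Lo Hi u -> eperiodic u.
Proof.
  intros HD Hw H. destruct (classic (exists k, u k = false)) as [[k Hk]|Hn].
  - apply (eperiodic_eventually_cst false). exists k.
    assert (A : forall i, u (k + i)%nat = false).
    { induction i as [|i IH]; [now rewrite Nat.add_0_r|]. rewrite Nat.add_succ_r.
      destruct (u (S (k + i))) eqn:E; auto. exfalso.
      apply (proj2 (H (k + i)%nat) IH). eapply HD; [apply ge_w10|exact Hw].
      unfold shiftn; now rewrite Nat.add_0_r. }
    apply functional_extensionality; exact A.
  - apply (eperiodic_eventually_cst true). exists 0%nat.
    apply functional_extensionality; intros i. unfold shiftn, cst; simpl.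
    destruct (u i) eqn:E; auto; exfalso; eauto.
Qed.

(** The induction runs over all [Lo] and [Hi], since each desubstitution replaces them by their
    preimages under [Asub t] and [Bsub t]; monotonicity keeps these a down-set and an up-set. *)
Lemma avoids_eperiodic l Lo Hi p q : downset Lo -> upset Hi ->
  p = w01 \/ q = w10 -> Lo (Asubs l p) -> Hi (Bsubs l q) ->
  forall u, avoids Lo Hi u -> eperiodic u.
Proof.
  intros HD HU Hpq. revert Lo Hi HD HU.
  induction l as [|t l IH]; intros Lo Hi HD HU HL HH u Hu.
  - destruct Hpq; subst; eauto using avoids_w01, avoids_w10.
  - destruct (desubst t Lo Hi u _ _ HD HU HL HH Hu) as [|(pr & u' & -> & Hu')]; auto.
    apply eperiodic_wapp, eperiodic_subst.
    apply (IH (fun v => Lo (Asub t v)) (fun v => Hi (Bsub t v))); auto.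
    + intros a b Hab. apply HD. now apply Asub_le.
    + intros a b Hab. apply HU. now apply Bsub_le.
Qed.

(** * Values of bounded digit sequences *)

Definition val (beta : R) (d : nat -> R) : R := Series (fun k => d k / beta ^ S k).
Definition dig (M : R) (d : nat -> R) : Prop := forall k, 0 <= d k <= M.

Lemma dig_S M d : dig M d -> dig M (fun k => d (S k)).
Proof. intros H k; apply H. Qed.

Lemma ex_series_val beta M d : 1 < beta -> dig M d ->
  ex_series (fun k => d k / beta ^ S k).
Proof.
  intros Hb Hd.
  apply (ex_series_le (K := R_AbsRing) (V := R_CompleteNormedModule))
    with (fun k => (M / beta) * (/ beta) ^ k).
  - intros k. change (Rabs (d k / beta ^ S k) <= M / beta * (/ beta) ^ k).
    assert (0 < beta ^ k) by (apply pow_lt; lra).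
    rewrite pow_inv. simpl.
    replace (M / beta * / beta ^ k) with (M / (beta * beta ^ k)) by (field; lra).
    destruct (Hd k).
    assert (0 < / (beta * beta ^ k)) by (apply Rinv_0_lt_compat, Rmult_lt_0_compat; lra).
    rewrite Rabs_pos_eq; unfold Rdiv.
    + apply Rmult_le_compat_r; lra.
    + apply Rmult_le_pos; lra.
  - apply (ex_series_scal_l (M / beta) (fun k => (/ beta) ^ k)).
    apply ex_series_geom. rewrite Rabs_pos_eq.
    + rewrite <- Rinv_1. apply Rinv_lt_contravar; lra.
    + left; apply Rinv_0_lt_compat; lra.
Qed.

Lemma pi_is_val beta M d : 1 < beta -> dig M d -> pi_is beta d (val beta d).
Proof.
  intros Hb Hd. apply is_series_Reals. apply Series_correct.
  eapply ex_series_val; eauto.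
Qed.

Lemma pi_is_unique beta d x : pi_is beta d x -> x = val beta d.
Proof.
  intros H. symmetry. apply is_series_unique. now apply is_series_Reals.
Qed.

Lemma val_cons beta M d : 1 < beta -> dig M d ->
  val beta d = (d 0%nat + val beta (fun k => d (S k))) / beta.
Proof.
  intros Hb Hd. unfold val at 1.
  rewrite Series_incr_1 by (eapply ex_series_val; eauto).
  rewrite (Series_ext _ (fun k => / beta * (d (S k) / beta ^ S k))).
  - rewrite Series_scal_l. unfold val. simpl. field; lra.
  - intros k. simpl. assert (0 < beta ^ k) by (apply pow_lt; lra). field; lra.
Qed.

Lemma val_cst beta c : 1 < beta -> val beta (fun _ => c) = c / (beta - 1).
Proof.
  intros Hb. unfold val.
  rewrite (Series_ext _ (fun k => (c / beta) * (/ beta) ^ k)).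
  - rewrite Series_scal_l, Series_geom.
    + field; lra.
    + rewrite Rabs_pos_eq.
      * rewrite <- Rinv_1. apply Rinv_lt_contravar; lra.
      * left; apply Rinv_0_lt_compat; lra.
  - intros k. simpl. rewrite pow_inv.
    assert (0 < beta ^ k) by (apply pow_lt; lra). field; lra.
Qed.

Lemma val_le beta M d e : 1 < beta -> dig M e -> (forall k, 0 <= d k <= e k) ->
  val beta d <= val beta e.
Proof.
  intros Hb He H. apply Series_le; [|eapply ex_series_val; eauto].
  intros k. assert (0 < / beta ^ S k) by (apply Rinv_0_lt_compat, pow_lt; lra).
  destruct (H k). unfold Rdiv; split.
  - apply Rmult_le_pos; lra.
  - apply Rmult_le_compat_r; lra.
Qed.

Lemma val_bounds beta M d : 1 < beta -> dig M d -> 0 <= val beta d <= M / (beta - 1).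
Proof.
  intros Hb Hd. assert (HM : 0 <= M) by (destruct (Hd 0%nat); lra). split.
  - replace 0 with (val beta (fun _ => 0)) by (rewrite val_cst by lra; lra).
    apply (val_le beta M); auto. intros k; destruct (Hd k); lra.
  - rewrite <- val_cst by lra. apply (val_le beta M); auto. intros k; lra.
Qed.

Lemma val_shiftn_le beta M d k : 1 < beta -> dig M d ->
  val beta (fun i => d (k + i)%nat) / beta ^ k <= val beta d.
Proof.
  intros Hb. revert d; induction k as [|k IH]; intros d Hd.
  - simpl. change (fun i => d i) with d. lra.
  - specialize (IH _ (dig_S _ _ Hd)). simpl in IH.
    rewrite (val_cons beta M d Hb Hd).
    assert (0 < beta ^ k) by (apply pow_lt; lra). simpl.
    replace (val beta (fun i => d (S (k + i))) / (beta * beta ^ k)) with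
      ((val beta (fun i => d (S (k + i))) / beta ^ k) / beta) by (field; lra).
    unfold Rdiv at 1 3. apply Rmult_le_compat_r.
    + left; apply Rinv_0_lt_compat; lra.
    + destruct (Hd 0%nat). lra.
Qed.

Lemma val_pos beta M d k : 1 < beta -> dig M d -> 0 < d k -> 0 < val beta d.
Proof.
  intros Hb Hd Hk. eapply Rlt_le_trans; [|apply (val_shiftn_le beta M d k); auto].
  rewrite (val_cons beta M) by (auto; intros i; apply Hd).
  rewrite Nat.add_0_r. destruct (val_bounds beta M (fun i => d (k + S i)%nat) Hb) as [H _].
  { intros i; apply Hd. }
  repeat apply Rdiv_lt_0_compat; try lra. apply pow_lt; lra.
Qed.

(** Each term keeps a factor b1/b2 to spare; in front of a positive value it gives strict
    monotonicity without a strict comparison of series. *)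
Lemma val_decr_factor b1 b2 M d : 1 < b1 <= b2 -> dig M d ->
  val b2 d <= b1 / b2 * val b1 d.
Proof.
  intros [Hb H12] Hd. unfold val. rewrite <- Series_scal_l.
  apply Series_le.
  - intros k. assert (0 < b1 ^ k) by (apply pow_lt; lra).
    assert (b1 ^ k <= b2 ^ k) by (apply pow_incr; lra).
    assert (I : / b2 ^ k <= / b1 ^ k) by (apply Rinv_le_contravar; lra).
    assert (0 < / b2 ^ k) by (apply Rinv_0_lt_compat; lra).
    assert (0 < / b2) by (apply Rinv_0_lt_compat; lra).
    destruct (Hd k). simpl. split.
    + apply Rmult_le_pos; [lra|]. left; apply Rinv_0_lt_compat, Rmult_lt_0_compat; lra.
    + replace (b1 / b2 * (d k / (b1 * b1 ^ k))) with (d k * / b2 * / b1 ^ k) by (field; lra).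
      replace (d k / (b2 * b2 ^ k)) with (d k * / b2 * / b2 ^ k) by (field; lra).
      apply Rmult_le_compat_l; auto. apply Rmult_le_pos; lra.
  - apply (ex_series_scal_l (b1 / b2) (fun k => d k / b1 ^ S k)).
    eapply ex_series_val; eauto.
Qed.

Lemma val_decr b1 b2 M d : 1 < b1 <= b2 -> dig M d -> val b2 d <= val b1 d.
Proof.
  intros Hb Hd. eapply Rle_trans; [apply (val_decr_factor b1 b2 M); auto|].
  destruct (val_bounds b1 M d) as [H _]; auto; [lra|].
  rewrite <- (Rmult_1_l (val b1 d)) at 2. apply Rmult_le_compat_r; auto.
  apply Rmult_le_reg_r with b2; [lra|]. field_simplify; lra.
Qed.

Lemma val_strict_decr b1 b2 M d k : 1 < b1 < b2 -> dig M d -> 0 < d k ->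
  val b2 d < val b1 d.
Proof.
  intros Hb Hd Hk. eapply Rle_lt_trans; [apply (val_decr_factor b1 b2 M); auto; lra|].
  assert (H : 0 < val b1 d) by (eapply val_pos; eauto; lra).
  rewrite <- (Rmult_1_l (val b1 d)) at 2. apply Rmult_lt_compat_r; auto.
  apply Rmult_lt_reg_r with b2; [lra|]. field_simplify; lra.
Qed.

Lemma val_ext_tail beta M d e k : 1 < beta -> dig M d -> dig M e ->
  (forall i, (i < k)%nat -> d i = e i) ->
  val beta (fun i => d (k + i)%nat) = val beta (fun i => e (k + i)%nat) ->
  val beta d = val beta e.
Proof.
  intros Hb. revert d e; induction k as [|k IH]; intros d e Hd He H E; [exact E|].
  rewrite (val_cons beta M d), (val_cons beta M e), (H 0%nat) by (auto; lia).
  f_equal. f_equal. apply IH; auto using dig_S. intros i Hi; apply H; lia.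
Qed.

(** A power series in 1/beta with bounded coefficients, so of radius at least 1. *)
Lemma val_continuous M d beta : 1 < beta -> dig M d ->
  continuity_pt (fun b => val b d) beta.
Proof.
  intros Hb Hd.
  assert (E : forall b, 0 < b -> (/ b) * PSeries d (/ b) = val b d).
  { intros b Hb0. unfold PSeries, val. rewrite <- Series_scal_l.
    apply Series_ext. intros k. simpl. rewrite pow_inv.
    assert (0 < b ^ k) by (apply pow_lt; lra). field; lra. }
  apply continuity_pt_ext_loc with (fun b => (/ b) * PSeries d (/ b)).
  { exists (mkposreal (beta - 1) (proj2 (Rlt_0_minus _ _) Hb)). simpl. intros b Hbb.
    apply E. change (Rabs (b - beta) < beta - 1) in Hbb.
    apply Rabs_def2 in Hbb; lra. }
  assert (Ci : continuity_pt Rinv beta).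
  { apply (continuity_pt_inv (fun x => x)); [apply continuity_pt_id|lra]. }
  apply continuity_pt_mult; [exact Ci|].
  apply (continuity_pt_comp Rinv (PSeries d)); [exact Ci|].
  apply PSeries_continuity.
  eapply Rbar_lt_le_trans; [|apply (proj1 (CV_radius_bounded d) 1)].
  - simpl. rewrite Rabs_pos_eq.
    + rewrite <- Rinv_1. apply Rinv_lt_contravar; lra.
    + left; apply Rinv_0_lt_compat; lra.
  - exists M. intros n. rewrite pow1, Rmult_1_r. destruct (Hd n).
    rewrite Rabs_pos_eq; lra.
Qed.

(** * Values of binary words *)

Definition P (beta : R) (u : bword) : R := val beta (bin u).
Definition F (beta : R) (b : bword) : R := beta * P beta b.
Definition G (beta : R) (a : bword) : R := (beta - 1) * (1 + P beta a).

Lemma dig_bin u : dig 1 (bin u).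
Proof. intros k; unfold bin; destruct (u k); lra. Qed.

Lemma P_cons beta c u : 1 < beta ->
  P beta (wcons c u) = ((if c then 1 else 0) + P beta u) / beta.
Proof. intros Hb. unfold P. now rewrite (val_cons beta 1) by (auto using dig_bin). Qed.

Lemma P_bounds beta u : 1 < beta -> 0 <= P beta u <= 1 / (beta - 1).
Proof. intros Hb. apply val_bounds; auto using dig_bin. Qed.

Lemma P_cst beta c : 1 < beta -> P beta (cst c) = (if c then 1 else 0) / (beta - 1).
Proof. intros Hb. unfold P, bin, cst. now rewrite val_cst. Qed.

Lemma F_head beta b : 1 < beta -> b 0%nat = true -> F beta b = 1 + P beta (shift b).
Proof.
  intros Hb H. unfold F. rewrite <- (wcons_shift b) at 1. rewrite P_cons, H by auto.
  field; lra.
Qed.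

(** A first difference of 0 against 1 outweighs the tails because 1/(beta-1) <= 1. *)
Lemma P_le beta x y : 2 <= beta -> lex_le x y -> P beta x <= P beta y.
Proof.
  intros Hb [H|(n & H & H1 & H2)].
  - apply functional_extensionality in H; subst; lra.
  - revert x y H H1 H2; induction n as [|n IH]; intros x y H H1 H2;
      rewrite <- (wcons_shift x), <- (wcons_shift y), !P_cons by lra;
      unfold Rdiv; (apply Rmult_le_compat_r; [left; apply Rinv_0_lt_compat; lra|]).
    + rewrite H1, H2. destruct (P_bounds beta (shift x)) as [_ Hx]; [lra|].
      destruct (P_bounds beta (shift y)) as [Hy _]; [lra|].
      assert (1 / (beta - 1) <= 1).
      { apply Rmult_le_reg_r with (beta - 1); [lra|]. field_simplify; lra. }
      lra.
    + rewrite (H 0%nat) by lia. apply Rplus_le_compat_l, IH; auto.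
      intros i Hi; apply H; lia.
Qed.

Lemma F_le beta x y : 2 <= beta -> lex_le x y -> F beta x <= F beta y.
Proof. intros Hb H. apply Rmult_le_compat_l; [lra|]. now apply P_le. Qed.

Lemma G_le beta x y : 2 <= beta -> lex_le x y -> G beta x <= G beta y.
Proof.
  intros Hb H. apply Rmult_le_compat_l; [lra|]. apply Rplus_le_compat_l, P_le; auto.
Qed.

Lemma P_agr beta N x y : 1 < beta -> agr N x y ->
  P beta x <= P beta y + / beta ^ N / (beta - 1).
Proof.
  intros Hb. revert x y; induction N as [|N IH]; intros x y H.
  - simpl. destruct (P_bounds beta x Hb), (P_bounds beta y Hb).
    rewrite Rinv_1. lra.
  - rewrite <- (wcons_shift x), <- (wcons_shift y), (H 0%nat), !P_cons by (auto; lia).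
    specialize (IH (shift x) (shift y) (agr_shift _ _ _ H)).
    assert (0 < beta ^ N) by (apply pow_lt; lra). simpl.
    apply Rmult_le_reg_r with beta; [lra|].
    replace (((if y 0%nat then 1 else 0) + P beta (shift x)) / beta * beta)
      with ((if y 0%nat then 1 else 0) + P beta (shift x)) by (field; lra).
    replace ((((if y 0%nat then 1 else 0) + P beta (shift y)) / beta +
      / (beta * beta ^ N) / (beta - 1)) * beta)
      with ((if y 0%nat then 1 else 0) + (P beta (shift y) + / beta ^ N / (beta - 1)))
      by (field; lra).
    lra.
Qed.

Lemma P_agr_eps beta eps : 1 < beta -> 0 < eps ->
  exists N, forall x y, agr N x y -> P beta x < P beta y + eps.
Proof.
  intros Hb He.
  destruct (pow_lt_1_zero (/ beta)) with (y := eps * (beta - 1)) as [N HN].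
  - rewrite Rabs_pos_eq; [|left; apply Rinv_0_lt_compat; lra].
    rewrite <- Rinv_1. apply Rinv_lt_contravar; lra.
  - apply Rmult_lt_0_compat; lra.
  - exists N. intros x y H. eapply Rle_lt_trans; [apply (P_agr beta N); eauto|].
    apply Rplus_lt_compat_l. specialize (HN N (le_n N)).
    rewrite pow_inv, Rabs_pos_eq in HN.
    + assert (0 < beta ^ N) by (apply pow_lt; lra).
      apply Rmult_lt_reg_r with (beta - 1); [lra|].
      replace (/ beta ^ N / (beta - 1) * (beta - 1)) with (/ beta ^ N) by (field; lra).
      exact HN.
    + left; apply Rinv_0_lt_compat, pow_lt; lra.
Qed.

Lemma F_lt_agr beta b m : 1 < beta -> F beta b < m ->
  exists N, forall x, agr N x b -> F beta x < m.
Proof.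
  intros Hb H. destruct (P_agr_eps beta ((m - F beta b) / beta)) as [N HN]; auto.
  { apply Rdiv_lt_0_compat; lra. }
  exists N; intros x Hx. specialize (HN x b Hx). unfold F in *.
  apply Rmult_lt_compat_l with (r := beta) in HN; [|lra].
  replace (beta * (P beta b + (m - beta * P beta b) / beta)) with m in HN by (field; lra).
  exact HN.
Qed.

Lemma F_gt_agr beta b m : 1 < beta -> m < F beta b ->
  exists N, forall x, agr N x b -> m < F beta x.
Proof.
  intros Hb H. destruct (P_agr_eps beta ((F beta b - m) / beta)) as [N HN]; auto.
  { apply Rdiv_lt_0_compat; lra. }
  exists N; intros x Hx. specialize (HN b x (agr_sym _ _ _ Hx)). unfold F in *.
  apply Rmult_lt_compat_l with (r := beta) in HN; [|lra].
  replace (beta * (P beta x + (beta * P beta b - m) / beta))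
    with (beta * P beta x + beta * P beta b - m) in HN by (field; lra).
  lra.
Qed.

Lemma G_lt_agr beta b m : 1 < beta -> G beta b < m ->
  exists N, forall x, agr N x b -> G beta x < m.
Proof.
  intros Hb H. destruct (P_agr_eps beta ((m - G beta b) / (beta - 1))) as [N HN]; auto.
  { apply Rdiv_lt_0_compat; lra. }
  exists N; intros x Hx. specialize (HN x b Hx). unfold G in *.
  apply Rmult_lt_compat_l with (r := beta - 1) in HN; [|lra].
  replace ((beta - 1) * (P beta b + (m - (beta - 1) * (1 + P beta b)) / (beta - 1)))
    with (m - (beta - 1)) in HN by (field; lra).
  lra.
Qed.

Lemma G_gt_agr beta b m : 1 < beta -> m < G beta b ->
  exists N, forall x, agr N x b -> m < G beta x.
Proof.
  intros Hb H. destruct (P_agr_eps beta ((G beta b - m) / (beta - 1))) as [N HN]; auto.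
  { apply Rdiv_lt_0_compat; lra. }
  exists N; intros x Hx. specialize (HN b x (agr_sym _ _ _ Hx)). unfold G in *.
  apply Rmult_lt_compat_l with (r := beta - 1) in HN; [|lra].
  replace ((beta - 1) * (P beta x + ((beta - 1) * (1 + P beta b) - m) / (beta - 1)))
    with ((beta - 1) * P beta x + ((beta - 1) * (1 + P beta b) - m)) in HN by (field; lra).
  lra.
Qed.

(** The leading 1 gives [F beta b] the form 1 + P; the further ones make it strictly decreasing and
    larger than 2 near [beta = 1], and make the series diverge for [beta <= 1]. *)
Definition ones (b : bword) : Prop :=
  b 0%nat = true /\ forall N, exists n, (N <= n)%nat /\ b n = true.

Lemma F_decr b1 b2 b : 1 < b1 <= b2 -> b 0%nat = true -> F b2 b <= F b1 b.
Proof.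
  intros Hb H. rewrite !F_head by (auto; lra).
  apply Rplus_le_compat_l. apply (val_decr b1 b2 1); auto using dig_bin.
Qed.

Lemma F_strict_decr b1 b2 b : 1 < b1 < b2 -> ones b -> F b2 b < F b1 b.
Proof.
  intros Hb [H0 H]. rewrite !F_head by (auto; lra).
  apply Rplus_lt_compat_l. destruct (H 1%nat) as ([|k] & Hk & E); [lia|].
  apply (val_strict_decr b1 b2 1 _ k); auto using dig_bin.
  unfold bin, shift. rewrite E; lra.
Qed.

(* [G] need not be increasing in [beta] on (1,2), but [G beta a > m] means that the
   series with positive digits [m - a_k] has value less than 1. *)
Lemma G_val beta a m : 1 < beta -> 1 < m ->
  val beta (fun k => m - bin a k) = m / (beta - 1) - P beta a.
Proof.
  intros Hb Hm. rewrite <- (val_cst beta m) by auto. unfold P, val.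
  rewrite <- Series_minus.
  - apply Series_ext. intros k. unfold Rdiv; ring.
  - apply (ex_series_val beta m); auto. intros k; lra.
  - apply (ex_series_val beta 1); auto using dig_bin.
Qed.

Lemma dig_m_bin m a : 1 < m -> dig m (fun k => m - bin a k).
Proof. intros Hm k. destruct (dig_bin a k). lra. Qed.

Lemma G_lt_iff beta a m : 1 < beta -> 1 < m ->
  (G beta a < m <-> 1 < val beta (fun k => m - bin a k)).
Proof.
  intros Hb Hm. rewrite G_val by auto. unfold G.
  assert (E : m / (beta - 1) - P beta a - 1 = (m - (beta - 1) * (1 + P beta a)) / (beta - 1))
    by (field; lra).
  split; intros H.
  - assert (0 < (m - (beta - 1) * (1 + P beta a)) / (beta - 1)) by (apply Rdiv_lt_0_compat; lra).
    lra.
  - assert (H' : 0 < (m - (beta - 1) * (1 + P beta a)) / (beta - 1)) by lra.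
    apply Rmult_lt_compat_r with (r := beta - 1) in H'; [|lra].
    unfold Rdiv in H'. rewrite Rmult_assoc, Rinv_l in H' by lra. lra.
Qed.

Lemma G_gt_iff beta a m : 1 < beta -> 1 < m ->
  (m < G beta a <-> val beta (fun k => m - bin a k) < 1).
Proof.
  intros Hb Hm. rewrite G_val by auto. unfold G.
  assert (E : m / (beta - 1) - P beta a - 1 = - (((beta - 1) * (1 + P beta a) - m) / (beta - 1)))
    by (field; lra).
  split; intros H.
  - assert (0 < ((beta - 1) * (1 + P beta a) - m) / (beta - 1)) by (apply Rdiv_lt_0_compat; lra).
    lra.
  - assert (H' : 0 < ((beta - 1) * (1 + P beta a) - m) / (beta - 1)) by lra.
    apply Rmult_lt_compat_r with (r := beta - 1) in H'; [|lra].
    unfold Rdiv in H'. rewrite Rmult_assoc, Rinv_l in H' by lra. lra.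
Qed.

(** The substitute for monotonicity of [G] in the base: the level m can only be crossed upwards,
    hence once. *)
Lemma G_level b1 b2 a m : 1 < m -> 1 < b1 < b2 -> m <= G b1 a -> m < G b2 a.
Proof.
  intros Hm Hb H. apply G_gt_iff; auto; [lra|].
  apply Rlt_le_trans with (val b1 (fun k => m - bin a k)).
  - apply (val_strict_decr b1 b2 m _ 0%nat); auto using dig_m_bin.
    destruct (dig_bin a 0%nat); lra.
  - apply Rnot_lt_le. intros H1. apply G_lt_iff in H1; lra.
Qed.

Lemma F_continuous b beta : 1 < beta -> continuity_pt (fun x => F x b) beta.
Proof.
  intros Hb. apply (continuity_pt_mult (fun x => x) (fun x => P x b)).
  - apply continuity_pt_id.
  - apply (val_continuous 1); auto using dig_bin.
Qed.

Lemma G_continuous a beta : 1 < beta -> continuity_pt (fun x => G x a) beta.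
Proof.
  intros Hb. apply (continuity_pt_mult (fun x => x - 1) (fun x => 1 + P x a)).
  - apply (continuity_pt_minus (fun x => x) (fun _ => 1));
      [apply continuity_pt_id|apply continuity_pt_const; intros ? ?; reflexivity].
  - apply (continuity_pt_plus (fun _ => 1) (fun x => P x a));
      [apply continuity_pt_const; intros ? ?; reflexivity|].
    apply (val_continuous 1); auto using dig_bin.
Qed.

Lemma IVT_le (h : R -> R) x y : x <= y ->
  (forall z, x <= z <= y -> continuity_pt h z) -> h x <= 0 <= h y ->
  exists z, x <= z <= y /\ h z = 0.
Proof.
  intros Hxy Hc [H1 H2].
  destruct (Req_dec (h x) 0) as [|N1]; [exists x; lra|].
  destruct (Req_dec (h y) 0) as [|N2]; [exists y; lra|].
  destruct Hxy as [Hxy| ->]; [|lra].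
  destruct (IVT_interv h x y) as [z Hz]; auto; try lra. now exists z.
Qed.

Lemma F_large b m : ones b -> m <= 2 -> exists beta, 1 < beta < 2 /\ m < F beta b.
Proof.
  intros [H0 H] Hm.
  destruct (H 1%nat) as (i & Hi & Bi). destruct (H (S i)) as (j & Hj & Bj).
  (* With beta^j = 3/2, the ones at i and j give P(shift b) >= 2/3 (1 + 2/3) = 10/9, so F > 2 >=
     m. *)
  set (beta := Rpower (3 / 2) (/ INR j)).
  assert (Hj0 : 1 <= INR j) by (apply (le_INR 1); lia).
  assert (Hb : 1 < beta).
  { rewrite <- (Rpower_O (3 / 2)) by lra. apply Rpower_lt; [lra|].
    apply Rinv_0_lt_compat; lra. }
  assert (Ej : beta ^ j = 3 / 2).
  { rewrite <- Rpower_pow by lra. unfold beta. rewrite Rpower_mult, Rinv_l, Rpower_1; lra. }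
  assert (Hbj : forall k, (k <= j)%nat -> 0 < beta ^ k <= 3 / 2).
  { intros k Hk; split; [apply pow_lt; lra|]. rewrite <- Ej. apply Rle_pow; [lra|lia]. }
  assert (Hb2 : beta < 2).
  { assert (K := Hbj 1%nat). simpl in K. lapply K; [lra|lia]. }
  exists beta; split; [lra|].
  rewrite F_head by auto.
  assert (B1 : forall x k, x k = true -> (S k <= j)%nat ->
     2 / 3 * (1 + P beta (shiftn (S k) x)) <= P beta x).
  { intros x k Hk Hkj. eapply Rle_trans; [|apply (val_shiftn_le beta 1 (bin x) k); auto using dig_bin].
    change (val beta (fun i => bin x (k + i)%nat)) with (P beta (shiftn k x)).
    rewrite (shiftn_expand k x), Hk, P_cons by auto.
    destruct (P_bounds beta (shiftn (S k) x) Hb) as [Hp _].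
    assert (Hs := Hbj (S k) Hkj). simpl in Hs.
    assert (0 < beta ^ k) by (apply pow_lt; lra).
    replace ((1 + P beta (shiftn (S k) x)) / beta / beta ^ k)
      with ((1 + P beta (shiftn (S k) x)) * / (beta * beta ^ k)) by (field; lra).
    rewrite Rmult_comm. apply Rmult_le_compat_l; [lra|].
    replace (2 / 3) with (/ (3 / 2)) by lra. apply Rinv_le_contravar; lra. }
  assert (Bi' : shift b (i - 1)%nat = true).
  { unfold shift. now replace (S (i - 1)) with i by lia. }
  assert (K1 := B1 (shift b) (i - 1)%nat Bi').
  lapply K1; [clear K1; intros K1|lia].
  replace (S (i - 1)) with i in K1 by lia.
  assert (K2 := B1 (shiftn i (shift b)) (j - i - 1)%nat).
  lapply K2; [clear K2; intros K2|].
  - lapply K2; [clear K2; intros K2|lia].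
    destruct (P_bounds beta (shiftn (S (j - i - 1)) (shiftn i (shift b))) Hb) as [Hp _].
    lra.
  - unfold shiftn, shift. now replace (S (i + (j - i - 1))) with j by lia.
Qed.

Lemma F_solution b m : ones b -> 1 < m <= 2 -> exists beta, 1 < beta /\ F beta b = m.
Proof.
  intros Hb Hm. destruct (F_large b m) as (b1 & Hb1 & H1); auto; [lra|].
  set (b2 := Rmax 2 (1 + / (m - 1))).
  assert (0 < / (m - 1)) by (apply Rinv_0_lt_compat; lra).
  assert (Hb2 : 2 <= b2 /\ 1 + / (m - 1) <= b2).
  { split; [apply Rmax_l|apply Rmax_r]. }
  assert (H2 : F b2 b <= m).
  { rewrite F_head by (apply Hb || lra).
    destruct (P_bounds b2 (shift b)) as [_ K]; [lra|].
    assert (1 / (b2 - 1) <= m - 1).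
    { unfold Rdiv; rewrite Rmult_1_l. rewrite <- (Rinv_inv (m - 1)).
      apply Rinv_le_contravar; lra. }
    lra. }
  destruct (IVT_le (fun x => m - F x b) b1 b2) as (z & Hz & E); try lra.
  - intros z Hz. apply (continuity_pt_minus (fun _ => m) (fun x => F x b)).
    + apply continuity_pt_const; intros ? ?; reflexivity.
    + apply F_continuous; lra.
  - exists z; split; lra.
Qed.

Lemma G_solution a m : 1 < m -> exists beta, 1 < beta /\ G beta a = m.
Proof.
  intros Hm.
  (* [G m a] is at most (m-1)(1 + 1/(m-1)) = m, and [G (m + 1) a] is at least m. *)
  destruct (IVT_le (fun x => G x a - m) m (m + 1)) as (z & Hz & E); try lra.
  - intros z Hz. apply (continuity_pt_minus (fun x => G x a) (fun _ => m)).
    + apply G_continuous; lra.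
    + apply continuity_pt_const; intros ? ?; reflexivity.
  - unfold G. split.
    + destruct (P_bounds m a) as [_ K]; [lra|].
      apply Rmult_le_compat_l with (r := m - 1) in K; [|lra].
      replace ((m - 1) * (1 / (m - 1))) with 1 in K by (field; lra). lra.
    + destruct (P_bounds (m + 1) a) as [K _]; [lra|].
      replace (m + 1 - 1) with m by ring.
      assert (0 <= m * P (m + 1) a) by (apply Rmult_le_pos; lra). lra.
  - exists z; split; lra.
Qed.

(** * The functions [f], [g] and [mu] *)

(** The last clause places the crossing of the two curves at a base of at least 2, because [G 2 a]
    is 1 + P 2 a and [F 2 b] is 1 + P 2 (shift b). *)
Definition inf_sup (u a b : bword) : Prop :=
  infw u = a /\ supw u = b /\ ones b /\ lex_le a (shift b).

(** The definition of [f_fun] allows any positive base; for [beta <= 1] infinitely many terms are at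
    least 1. *)
Lemma pi_is_ones_gt1 beta b x : ones b -> 0 < beta -> pi_is beta (bin b) x -> 1 < beta.
Proof.
  intros [_ Hb] H0 Hx. apply Rnot_le_lt. intros H1.
  assert (L : is_lim_seq (fun k => bin b k / beta ^ S k) 0).
  { apply ex_series_lim_0.
    exists x. now apply is_series_Reals. }
  apply is_lim_seq_Reals in L. destruct (L 1 Rlt_0_1) as [N HN].
  destruct (Hb N) as (n & Hn & En). specialize (HN n Hn).
  unfold R_dist, bin in HN. rewrite En, Rminus_0_r in HN.
  assert (Hp : beta ^ S n <= 1).
  { rewrite <- (pow1 (S n)). apply pow_incr; lra. }
  assert (0 < beta ^ S n) by (apply pow_lt; lra).
  assert (1 <= 1 / beta ^ S n).
  { unfold Rdiv; rewrite Rmult_1_l. rewrite <- Rinv_1. apply Rinv_le_contravar; lra. }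
  rewrite Rabs_pos_eq in HN; lra.
Qed.

Lemma f_fun_spec u a b m : inf_sup u a b -> 1 < m <= 2 ->
  1 < f_fun u m /\ F (f_fun u m) b = m.
Proof.
  intros (_ & E & Hb & _) Hm.
  assert (H : 0 < f_fun u m /\
    exists x, pi_is (f_fun u m) (bin (supw u)) x /\ f_fun u m * x = m).
  { unfold f_fun. apply epsilon_spec. rewrite E.
    destruct (F_solution b m Hb Hm) as (beta & H1 & H2).
    exists beta; split; [lra|]. exists (P beta b); split; auto.
    apply (pi_is_val beta 1); auto using dig_bin. }
  destruct H as (H0 & x & Hx & Ex). rewrite E in Hx.
  split; [eapply pi_is_ones_gt1; eauto|]. apply pi_is_unique in Hx.
  subst x. exact Ex.
Qed.

Lemma g_fun_spec u a b m : inf_sup u a b -> 1 < m ->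
  1 < g_fun u m /\ G (g_fun u m) a = m.
Proof.
  intros (E & _) Hm.
  assert (H : 0 < g_fun u m /\
    exists x, pi_is (g_fun u m) (bin (infw u)) x /\ (g_fun u m - 1) * (1 + x) = m).
  { unfold g_fun. apply epsilon_spec. rewrite E.
    destruct (G_solution a m Hm) as (beta & H1 & H2).
    exists beta; split; [lra|]. exists (P beta a); split; auto.
    apply (pi_is_val beta 1); auto using dig_bin. }
  destruct H as (H0 & x & Hx & Ex). rewrite E in Hx.
  assert (Hx0 : 0 <= x).
  { eapply Rle_trans; [|apply (sum_incr _ 0 x Hx)].
    - simpl. destruct (dig_bin a 0%nat). apply Rmult_le_pos; [lra|].
      left; apply Rinv_0_lt_compat; lra.
    - intros n. destruct (dig_bin a n). apply Rmult_le_pos; [lra|].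
      left; apply Rinv_0_lt_compat, pow_lt; lra. }
  assert (H1 : 1 < g_fun u m).
  { apply Rnot_le_lt; intros H1.
    assert (0 <= (1 - g_fun u m) * (1 + x)) by (apply Rmult_le_pos; lra). lra. }
  split; auto. apply pi_is_unique in Hx. subst x. exact Ex.
Qed.

Section AtLevel.
Variables (u a b : bword) (m : R).
Hypotheses (Hu : inf_sup u a b) (Hm : 1 < m <= 2).

Let Hf : 1 < f_fun u m /\ F (f_fun u m) b = m := f_fun_spec u a b m Hu Hm.
Let Hg : 1 < g_fun u m /\ G (g_fun u m) a = m := g_fun_spec u a b m Hu (proj1 Hm).
Let Hb : ones b := proj1 (proj2 (proj2 Hu)).

Lemma lt_f_fun beta : 1 < beta -> (beta < f_fun u m <-> m < F beta b).
Proof.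
  intros H; split; intros K.
  - rewrite <- (proj2 Hf) at 1. apply F_strict_decr; auto.
  - apply Rnot_le_lt. intros L. assert (F beta b <= F (f_fun u m) b).
    { apply F_decr; [lra|apply Hb]. }
    lra.
Qed.

Lemma f_fun_lt beta : 1 < beta -> (f_fun u m < beta <-> F beta b < m).
Proof.
  intros H; split; intros K.
  - rewrite <- (proj2 Hf). apply F_strict_decr; auto. lra.
  - apply Rnot_le_lt. intros L. assert (F (f_fun u m) b <= F beta b).
    { apply F_decr; [lra|apply Hb]. }
    lra.
Qed.

Lemma lt_g_fun beta : 1 < beta -> (beta < g_fun u m <-> G beta a < m).
Proof.
  intros H; split; intros K.
  - apply Rnot_le_lt; intros L.
    assert (m < G (g_fun u m) a) by (apply (G_level beta); lra). lra.
  - apply Rnot_le_lt. intros [L|L].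
    + assert (m < G beta a) by (apply (G_level (g_fun u m)); lra). lra.
    + rewrite L in Hg. lra.
Qed.

Lemma g_fun_lt beta : 1 < beta -> (g_fun u m < beta <-> m < G beta a).
Proof.
  intros H; split; intros K.
  - apply (G_level (g_fun u m)); lra.
  - apply Rnot_le_lt. intros L. assert (~ G beta a < m) by lra.
    destruct L as [L|L].
    + now apply lt_g_fun in L.
    + rewrite <- L in Hg. lra.
Qed.
End AtLevel.

Lemma mu_spec u a b : inf_sup u a b ->
  1 < mu u <= 2 /\ f_fun u (mu u) = g_fun u (mu u).
Proof.
  intros Hu. unfold mu. apply epsilon_spec.
  assert (Hb : ones b) by apply Hu.
  (* At base 2, G <= F by the last clause of [inf_sup]; at base 3, G >= 2 > 3/2 >= F. The value of
     [F] at the crossing z is the m sought. *)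
  destruct (IVT_le (fun x => G x a - F x b) 2 3) as (z & Hz & E).
  - lra.
  - intros z Hz. apply (continuity_pt_minus (fun x => G x a) (fun x => F x b)).
    + apply G_continuous; lra.
    + apply F_continuous; lra.
  - split.
    + rewrite F_head by (apply Hb || lra). unfold G.
      assert (P 2 a <= P 2 (shift b)) by (apply P_le; [lra|apply Hu]). lra.
    + unfold G, F. destruct (P_bounds 3 a) as [K _]; [lra|].
      destruct (P_bounds 3 b) as [_ K']; [lra|]. lra.
  - assert (Hm : 1 < F z b <= 2).
    { rewrite F_head by (apply Hb || lra).
      destruct (P_bounds z (shift b)) as [_ K]; [lra|].
      assert (1 / (z - 1) <= 1).
      { apply Rmult_le_reg_r with (z - 1); [lra|]. field_simplify; lra. }
      destruct (proj2 Hb 1%nat) as ([|k] & Hk & Ek); [lia|].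
      assert (0 < P z (shift b)); [|lra].
      apply (val_pos z 1 _ k); [lra|apply dig_bin|]. unfold bin, shift. rewrite Ek; lra. }
    exists (F z b). split; auto.
    assert (Ef : f_fun u (F z b) = z).
    { destruct (Rtotal_order (f_fun u (F z b)) z) as [L|[L|L]]; auto.
      - apply (f_fun_lt u a b _ Hu Hm) in L; lra.
      - apply (lt_f_fun u a b _ Hu Hm) in L; lra. }
    assert (Eg : g_fun u (F z b) = z).
    { destruct (Rtotal_order (g_fun u (F z b)) z) as [L|[L|L]]; auto.
      - apply (g_fun_lt u a b _ Hu Hm) in L; lra.
      - apply (lt_g_fun u a b _ Hu Hm) in L; lra. }
    congruence.
Qed.

Lemma f_fun_anti u a b m1 m2 : inf_sup u a b -> 1 < m1 -> m1 < m2 -> m2 <= 2 ->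
  f_fun u m2 < f_fun u m1.
Proof.
  intros Hu H1 H12 H2.
  destruct (f_fun_spec u a b m1 Hu) as [K1 E1]; [lra|].
  apply (f_fun_lt u a b m2 Hu); lra.
Qed.

Lemma g_fun_mono u a b m1 m2 : inf_sup u a b -> 1 < m1 -> m1 < m2 -> m2 <= 2 ->
  g_fun u m1 < g_fun u m2.
Proof.
  intros Hu H1 H12 H2.
  destruct (g_fun_spec u a b m1 Hu) as [K1 E1]; [lra|].
  apply (lt_g_fun u a b m2 Hu); lra.
Qed.

Lemma mu_le u a b m : inf_sup u a b -> 1 < m <= 2 ->
  (mu u <= m <-> f_fun u m <= g_fun u m).
Proof.
  intros Hu Hm. destruct (mu_spec u a b Hu) as [Hmu E]. split; intros H.
  - destruct H as [H|H]; [|rewrite <- H; lra].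
    assert (A := f_fun_anti u a b (mu u) m Hu). assert (B := g_fun_mono u a b (mu u) m Hu). lra.
  - apply Rnot_lt_le; intros L.
    assert (A := f_fun_anti u a b m (mu u) Hu). assert (B := g_fun_mono u a b m (mu u) Hu). lra.
Qed.

Lemma le_mu u a b m : inf_sup u a b -> 1 < m <= 2 ->
  (m <= mu u <-> g_fun u m <= f_fun u m).
Proof.
  intros Hu Hm. destruct (mu_spec u a b Hu) as [Hmu E]. split; intros H.
  - destruct H as [H|H]; [|rewrite H; lra].
    assert (A := f_fun_anti u a b m (mu u) Hu). assert (B := g_fun_mono u a b m (mu u) Hu). lra.
  - apply Rnot_lt_le; intros L.
    assert (A := f_fun_anti u a b (mu u) m Hu). assert (B := g_fun_mono u a b (mu u) m Hu). lra.
Qed.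

(* [below m a b] and [above m a b] say that [m] is smaller, respectively larger,
   than the abscissa where the curves [F beta b = m] and [G beta a = m] cross. *)
Definition below (m : R) (a b : bword) : Prop :=
  exists beta, 1 < beta /\ m < F beta b /\ m < G beta a.
Definition above (m : R) (a b : bword) : Prop :=
  exists beta, 1 < beta /\ F beta b < m /\ G beta a < m.

Lemma mu_le_iff u a b m : inf_sup u a b -> 1 < m <= 2 -> (mu u <= m <-> ~ below m a b).
Proof.
  intros Hu Hm. rewrite (mu_le u a b m Hu Hm). split.
  - intros H (beta & Hb & H1 & H2).
    apply (lt_f_fun u a b m Hu Hm) in H1; auto.
    apply (g_fun_lt u a b m Hu Hm) in H2; auto. lra.
  - intros H. apply Rnot_lt_le; intros L. apply H.
    destruct (g_fun_spec u a b m Hu) as [K _]; [lra|].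
    exists ((g_fun u m + f_fun u m) / 2). split; [lra|].
    split; [apply (lt_f_fun u a b m Hu Hm)|apply (g_fun_lt u a b m Hu Hm)]; lra.
Qed.

Lemma le_mu_iff u a b m : inf_sup u a b -> 1 < m <= 2 -> (m <= mu u <-> ~ above m a b).
Proof.
  intros Hu Hm. rewrite (le_mu u a b m Hu Hm). split.
  - intros H (beta & Hb & H1 & H2).
    apply (f_fun_lt u a b m Hu Hm) in H1; auto.
    apply (lt_g_fun u a b m Hu Hm) in H2; auto. lra.
  - intros H. apply Rnot_lt_le; intros L. apply H.
    destruct (f_fun_spec u a b m Hu) as [K _]; [lra|].
    exists ((g_fun u m + f_fun u m) / 2). split; [lra|].
    split; [apply (f_fun_lt u a b m Hu Hm)|apply (lt_g_fun u a b m Hu Hm)]; lra.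
Qed.

(** [F] decreases with the base and [G] crosses m upwards only, so the two witness bases cannot be
    ordered either way. *)
Lemma above_not_below m a b : 1 < m -> b 0%nat = true -> above m a b -> ~ below m a b.
Proof.
  intros Hm H0 (b1 & H1 & F1 & G1) (b2 & H2 & F2 & G2).
  destruct (Rle_lt_dec b1 b2) as [L|L].
  - assert (F b2 b <= F b1 b) by (apply F_decr; auto; lra). lra.
  - assert (m < G b1 a) by (apply (G_level b2); lra). lra.
Qed.

(** Strict inequalities at a fixed base survive a change of far letters; this is how a finite prefix
    decides the side of [mu]. *)
Lemma above_agr m a b : above m a b ->
  exists N, forall a' b', agr N a' a -> agr N b' b -> above m a' b'.
Proof.
  intros (beta & H1 & H2 & H3).
  destruct (F_lt_agr beta b m) as [N1 K1]; auto.
  destruct (G_lt_agr beta a m) as [N2 K2]; auto.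
  exists (N1 + N2)%nat. intros a' b' Ha Hb. exists beta; repeat split; auto.
  - apply K1. eapply agr_le; [|exact Hb]; lia.
  - apply K2. eapply agr_le; [|exact Ha]; lia.
Qed.

Lemma below_agr m a b : below m a b ->
  exists N, forall a' b', agr N a' a -> agr N b' b -> below m a' b'.
Proof.
  intros (beta & H1 & H2 & H3).
  destruct (F_gt_agr beta b m) as [N1 K1]; auto.
  destruct (G_gt_agr beta a m) as [N2 K2]; auto.
  exists (N1 + N2)%nat. intros a' b' Ha Hb. exists beta; repeat split; auto.
  - apply K1. eapply agr_le; [|exact Hb]; lia.
  - apply K2. eapply agr_le; [|exact Ha]; lia.
Qed.

Lemma max_fg_ge2 u a b m : inf_sup u a b -> 1 < m <= 2 ->
  2 <= Rmax (f_fun u m) (g_fun u m).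
Proof.
  intros Hu Hm. apply Rnot_lt_le; intros H.
  assert (A := Rmax_l (f_fun u m) (g_fun u m)).
  assert (B := Rmax_r (f_fun u m) (g_fun u m)).
  assert (H1 : F 2 b < m) by (apply (f_fun_lt u a b m Hu Hm); lra).
  assert (H2 : m < G 2 a) by (apply (g_fun_lt u a b m Hu Hm); lra).
  destruct Hu as (_ & _ & Hb & Hab).
  rewrite F_head in H1 by (apply Hb || lra). unfold G in H2.
  assert (P 2 a <= P 2 (shift b)) by (apply P_le; auto; lra). lra.
Qed.

(** * Unique expansions *)

Lemma dig_digits01m m d : 1 < m -> digits01m m d -> dig m d.
Proof. intros Hm H k. destruct (H k) as [->|[->| ->]]; lra. Qed.

Lemma pow_inv_small beta c eps : 1 < beta -> 0 < eps -> exists N, c / beta ^ N < eps.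
Proof.
  intros Hb He.
  destruct (pow_lt_1_zero (/ beta)) with (y := eps / (Rabs c + 1)) as [N HN].
  - rewrite Rabs_pos_eq; [|left; apply Rinv_0_lt_compat; lra].
    rewrite <- Rinv_1. apply Rinv_lt_contravar; lra.
  - assert (0 <= Rabs c) by apply Rabs_pos. apply Rdiv_lt_0_compat; lra.
  - exists N. specialize (HN N (le_n N)).
    assert (0 < / beta ^ N) by (apply Rinv_0_lt_compat, pow_lt; lra).
    rewrite pow_inv, Rabs_pos_eq in HN by lra.
    assert (Hc : 0 <= Rabs c) by apply Rabs_pos.
    assert (c <= Rabs c) by apply Rle_abs.
    apply Rmult_lt_compat_l with (r := Rabs c + 1) in HN; [|lra].
    replace ((Rabs c + 1) * (eps / (Rabs c + 1))) with eps in HN by (field; lra).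
    eapply Rle_lt_trans; [|exact HN]. unfold Rdiv. apply Rmult_le_compat_r; lra.
Qed.

Lemma expansion_exists beta m x : 1 < m <= 2 -> 1 < beta <= m + 1 ->
  0 <= x <= m / (beta - 1) -> exists w, digits01m m w /\ val beta w = x.
Proof.
  intros Hm Hb. set (K := m / (beta - 1)).
  assert (HK : 1 <= K).
  { apply Rmult_le_reg_r with (beta - 1); [lra|]. unfold K. field_simplify; lra. }
  assert (HbK : beta * K = m + K) by (unfold K; field; lra).
  (* The smallest admissible digit is taken. The intervals d + [0, K] cover [0, beta K] =
     [0, m + K], because the digit gaps 1 and m - 1 are at most 1 <= K. *)
  destruct (choice (fun y d => (d = 0 \/ d = 1 \/ d = m) /\
     (0 <= y <= K -> 0 <= beta * y - d <= K))) as [dg Hdg].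
  { intros y. destruct (classic (0 <= y <= K)) as [Hy|Hy]; [|exists 0; tauto].
    assert (B1 : 0 <= beta * y) by (apply Rmult_le_pos; lra).
    assert (B2 : beta * y <= m + K) by (rewrite <- HbK; apply Rmult_le_compat_l; lra).
    destruct (Rle_dec (beta * y) K); [exists 0; split; auto; lra|].
    destruct (Rle_dec (beta * y) (1 + K)); [exists 1; split; auto; lra|].
    exists m; split; auto; lra. }
  set (st y := beta * y - dg y).
  set (w y := fun n => dg (Nat.iter n st y)).
  assert (Hw : forall y, digits01m m (w y)) by (intros y n; apply Hdg).
  assert (Ew : forall y, (fun k => w y (S k)) = w (st y)).
  { intros y. apply functional_extensionality; intros n. unfold w. f_equal.
    induction n as [|n IH]; [reflexivity|]. simpl in *. now rewrite IH. }
  assert (A : forall N y, 0 <= y <= K -> Rabs (val beta (w y) - y) <= K / beta ^ N).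
  { induction N as [|N IH]; intros y Hy.
    - destruct (val_bounds beta m (w y)) as [V1 V2]; [lra|apply dig_digits01m; auto; lra|].
      fold K in V2. simpl. apply Rabs_le. lra.
    - rewrite (val_cons beta m) by (try lra; apply dig_digits01m; auto; lra).
      rewrite Ew. specialize (IH (st y) (proj2 (Hdg y) Hy)).
      replace ((w y 0%nat + val beta (w (st y))) / beta - y)
        with ((val beta (w (st y)) - st y) * / beta) by (unfold st, w; simpl; field; lra).
      assert (0 < / beta) by (apply Rinv_0_lt_compat; lra).
      rewrite Rabs_mult, (Rabs_pos_eq (/ beta)) by lra.
      assert (0 < beta ^ N) by (apply pow_lt; lra). simpl.
      replace (K / (beta * beta ^ N)) with (K / beta ^ N * / beta) by (field; lra).
      apply Rmult_le_compat_r; lra. }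
  intros Hx. exists (w x); split; auto.
  destruct (Req_dec (val beta (w x)) x) as [|D]; auto. exfalso.
  destruct (pow_inv_small beta K (Rabs (val beta (w x) - x))) as [N HN]; [lra|apply Rabs_pos_lt; lra|].
  specialize (A N x Hx). lra.
Qed.

Lemma val_tail_eq beta M d e k : 1 < beta -> dig M d -> dig M e ->
  (forall i, (i < k)%nat -> d i = e i) -> val beta d = val beta e ->
  val beta (fun i => d (k + i)%nat) = val beta (fun i => e (k + i)%nat).
Proof.
  intros Hb. revert d e; induction k as [|k IH]; intros d e Hd He H E; [exact E|].
  rewrite (val_cons beta M d), (val_cons beta M e), (H 0%nat) in E by (auto; lia).
  apply (IH (fun i => d (S i)) (fun i => e (S i))); auto using dig_S.
  - intros i Hi; apply H; lia.
  - apply Rmult_eq_compat_r with (r := beta) in E. field_simplify in E; lra.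
Qed.

Lemma G_gt_P beta m v : 1 < beta -> (m < G beta v <-> m / (beta - 1) < 1 + P beta v).
Proof.
  intros Hb. unfold G. split; intros H.
  - apply Rmult_lt_reg_l with (beta - 1); [lra|].
    replace ((beta - 1) * (m / (beta - 1))) with m by (field; lra). exact H.
  - apply Rmult_lt_compat_l with (r := beta - 1) in H; [|lra].
    replace ((beta - 1) * (m / (beta - 1))) with m in H by (field; lra). exact H.
Qed.

(** At the first differing digit, a 0 of u is worth too little to be replaced, since the tail is
    below 1. Replacing a 1 by 0 leaves too much by the bound on [G], and replacing it by m exceeds
    the value by the bound on [F]. *)
Lemma Ubeta_intro beta m u : 2 < beta -> 1 < m ->
  (forall k, u k = true -> m < G beta (shiftn (S k) u) /\ F beta (shiftn k u) < m) ->
  Ubeta beta m (bin u).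
Proof.
  intros Hb Hm H. split.
  { intros k. unfold bin; destruct (u k); auto. }
  intros v Hv Hne x y Hx Hy Exy.
  apply pi_is_unique in Hx. apply pi_is_unique in Hy. subst x y.
  destruct (first_diff _ _ Hne) as (k & Hk & Dk).
  assert (Dv : dig m v) by now apply dig_digits01m.
  assert (Du : dig m (bin u)).
  { intros i. destruct (dig_bin u i); lra. }
  assert (E := val_tail_eq beta m v (bin u) k).
  specialize (E ltac:(lra) Dv Du Hk (eq_sym Exy)).
  change (val beta (fun i => bin u (k + i)%nat)) with (P beta (shiftn k u)) in E.
  rewrite (val_cons beta m) in E by (try lra; intros i; apply Dv).
  rewrite Nat.add_0_r in E.
  destruct (val_bounds beta m (fun i => v (k + S i)%nat)) as [V1 V2]; [lra|intros i; apply Dv|].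
  rewrite shiftn_expand, P_cons in E by lra.
  destruct (P_bounds beta (shiftn (S k) u)) as [P1 P2]; [lra|].
  assert (1 / (beta - 1) < 1).
  { apply Rmult_lt_reg_r with (beta - 1); [lra|]. field_simplify; lra. }
  assert (E' : v k + val beta (fun i => v (k + S i)%nat)
      = (if u k then 1 else 0) + P beta (shiftn (S k) u)).
  { apply Rmult_eq_compat_r with (r := beta) in E. field_simplify in E; lra. }
  unfold bin in Dk. destruct (u k) eqn:Ek.
  - destruct (H k Ek) as [H1 H2]. apply G_gt_P in H1; [|lra].
    rewrite F_head in H2; [|lra|unfold shiftn; now rewrite Nat.add_0_r].
    rewrite shift_shiftn in H2.
    destruct (Hv k) as [Ev|[Ev|Ev]]; rewrite Ev in *; lra.
  - destruct (Hv k) as [Ev|[Ev|Ev]]; rewrite Ev in *; lra.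
Qed.

(** If the bound on [G] fails, the 1 can become 0; if the bound on [F] fails, it can become m. In
    both cases the remainder lies in [0, m/(beta-1)], and an expansion of it is spliced in after
    position k. *)
Lemma Ubeta_elim beta m u k : 1 < m <= 2 -> 1 < beta <= m + 1 ->
  Ubeta beta m (bin u) -> u k = true ->
  m < G beta (shiftn (S k) u) /\ F beta (shiftn k u) < m.
Proof.
  intros Hm Hb [_ HU] Hk.
  assert (Du : dig m (bin u)).
  { intros i. destruct (dig_bin u i); lra. }
  assert (A : forall d, d = 0 \/ d = m ->
    ~ 0 <= 1 + P beta (shiftn (S k) u) - d <= m / (beta - 1)).
  { intros d Hd Hr.
    destruct (expansion_exists beta m _ Hm Hb Hr) as (w & Hw & Ew).
    set (v := fun i => if Nat.ltb i k then bin u i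
                       else if Nat.eqb i k then d else w (i - S k)%nat).
    assert (Hv : digits01m m v).
    { intros i. unfold v. destruct (Nat.ltb i k).
      - unfold bin; destruct (u i); auto.
      - destruct (Nat.eqb i k); auto. destruct Hd; auto. }
    assert (Dv : dig m v) by (apply dig_digits01m; auto; lra).
    apply (HU v Hv) with (val beta (bin u)) (val beta v).
    - intros E. assert (Ek := f_equal (fun h => h k) E). unfold v, bin in Ek.
      rewrite Nat.ltb_irrefl, Nat.eqb_refl, Hk in Ek. destruct Hd; lra.
    - apply (pi_is_val beta m); auto; lra.
    - apply (pi_is_val beta m); auto; lra.
    - apply (val_ext_tail beta m _ _ k); auto; [lra| |].
      + intros i Hi. unfold v. apply Nat.ltb_lt in Hi. now rewrite Hi.
      + change (val beta (fun i => bin u (k + i)%nat)) with (P beta (shiftn k u)).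
        rewrite shiftn_expand, Hk, P_cons by lra.
        rewrite (val_cons beta m) by (try lra; intros i; apply Dv).
        replace (v (k + 0)%nat) with d.
        2:{ unfold v. now rewrite Nat.add_0_r, Nat.ltb_irrefl, Nat.eqb_refl. }
        replace (fun i => v (k + S i)%nat) with w.
        2:{ apply functional_extensionality; intros i. unfold v.
            replace (Nat.ltb (k + S i) k) with false by (symmetry; apply Nat.ltb_ge; lia).
            replace (Nat.eqb (k + S i) k) with false by (symmetry; apply Nat.eqb_neq; lia).
            f_equal; lia. }
        rewrite Ew. f_equal. lra. }
  destruct (P_bounds beta (shiftn (S k) u)) as [P1 P2]; [lra|].
  assert (P3 : 1 / (beta - 1) <= m / (beta - 1)).
  { unfold Rdiv. apply Rmult_le_compat_r; [|lra].
    left; apply Rinv_0_lt_compat; lra. }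
  split.
  - apply G_gt_P; [lra|]. apply Rnot_le_lt. intros L. apply (A 0); auto. lra.
  - rewrite F_head; [|lra|unfold shiftn; now rewrite Nat.add_0_r].
    rewrite shift_shiftn. apply Rnot_le_lt. intros L. apply (A m); auto. lra.
Qed.

Lemma digits01_bin d : digits01 d -> exists u, d = bin u.
Proof.
  intros H. exists (fun k => if Req_EM_T (d k) 1 then true else false).
  apply functional_extensionality; intros k. unfold bin.
  destruct (H k) as [E|E]; rewrite E; destruct (Req_EM_T _ 1); lra.
Qed.

Lemma bin_inj u v : bin u = bin v -> u = v.
Proof.
  intros H. apply functional_extensionality; intros k.
  assert (E := f_equal (fun h => h k) H). unfold bin in E.
  destruct (u k), (v k); auto; lra.
Qed.

Lemma countable_of_eperiodic beta m :
  (forall u, Ubeta beta m (bin u) -> eperiodic u) ->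
  countable (fun d => Ubeta beta m d /\ digits01 d).
Proof.
  intros H. destruct countable_eperiodic as [h Hh].
  destruct (choice (fun (d : nat -> R) u => digits01 d -> d = bin u)) as [w Hw].
  { intros d. destruct (classic (digits01 d)) as [D|D].
    - destruct (digits01_bin d D) as [u Hu]; eauto.
    - exists (cst true); tauto. }
  exists (fun d => h (w d)). intros x y [Ux Dx] [Uy Dy] E.
  assert (Ex := Hw x Dx). assert (Ey := Hw y Dy).
  rewrite Ex, Ey. f_equal. apply Hh; auto; apply H; congruence.
Qed.

(** * Positive Hausdorff dimension *)

Lemma no_injection_to_nat (g : bword -> nat) : ~ (forall c c', g c = g c' -> c = c').
Proof.
  intros H.
  set (D := (fun n => if excluded_middle_informative (exists c, g c = n /\ c n = false)
                     then true else false) : bword).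
  destruct (D (g D)) eqn:E; unfold D at 1 in E;
    destruct (excluded_middle_informative _) as [X|X]; try discriminate.
  - destruct X as (c & Hc & Ec). apply H in Hc. subst c.
    unfold D at 1 in Ec. destruct (excluded_middle_informative _) as [Y|Y]; [discriminate|].
    apply Y. exists D. split; auto. unfold D at 1.
    destruct (excluded_middle_informative _); tauto.
  - apply X. exists D; split; auto. unfold D at 1.
    destruct (excluded_middle_informative _); tauto.
Qed.

Lemma term_le_Series (a : nat -> R) n :
  (forall k, 0 <= a k) -> ex_series a -> a n <= Series a.
Proof.
  intros Ha He. apply Series_correct, is_series_Reals in He.
  eapply Rle_trans; [|apply (sum_incr a n _ He Ha)].
  destruct n; simpl; [lra|].
  assert (0 <= sum_f_R0 a n) by (apply cond_pos_sum, Ha). lra.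
Qed.

Section CantorCover.
Variables (q : nat -> nat) (c : nat -> bword).
Hypothesis Hex : ex_series (fun i => (/ 2) ^ q i).
Hypothesis Hsum : Series (fun i => (/ 2) ^ q i) < 1.

(* the fair-coin measure of the intersection of the [i]-th cylinder with the
   cylinder given by the first [n] letters of [p] *)
Let mass (n : nat) (p : bword) (i : nat) : R :=
  if excluded_middle_informative (agr (Nat.min n (q i)) p (c i))
  then (/ 2) ^ Nat.max n (q i) else 0.

Let ext (p : bword) (n : nat) (b : bool) : bword :=
  fun i => if Nat.eqb i n then b else p i.

Lemma agr_ext p n b N x : (N <= n)%nat -> (agr N (ext p n b) x <-> agr N p x).
Proof.
  intros H; split; intros A i Hi; specialize (A i Hi); unfold ext in *;
    (replace (Nat.eqb i n) with false in * by (symmetry; apply Nat.eqb_neq; lia)); auto.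
Qed.

Lemma agr_ext_S p n b x : agr (S n) (ext p n b) x <-> (agr n p x /\ x n = b).
Proof.
  split.
  - intros A. split.
    + apply (agr_ext p n b n x); auto. eapply agr_le; [|exact A]; lia.
    + rewrite <- A by lia. unfold ext. now rewrite Nat.eqb_refl.
  - intros [A E] i Hi. destruct (Nat.eq_dec i n) as [->|D].
    + unfold ext. now rewrite Nat.eqb_refl.
    + apply (proj2 (agr_ext p n b n x (le_n n)) A). lia.
Qed.

Lemma mass_bounds n p i : 0 <= mass n p i <= (/ 2) ^ q i.
Proof.
  unfold mass.
  assert (Hp : forall k, 0 < (/ 2) ^ k) by (intros; apply pow_lt; lra).
  destruct (excluded_middle_informative _).
  - split; [left; apply Hp|].
    replace (Nat.max n (q i)) with (q i + (Nat.max n (q i) - q i))%nat by lia.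
    rewrite pow_add. rewrite <- (Rmult_1_r ((/ 2) ^ q i)) at 2.
    apply Rmult_le_compat_l; [left; apply Hp|].
    rewrite <- (pow1 (Nat.max n (q i) - q i)). apply pow_incr; lra.
  - split; [lra|left; apply Hp].
Qed.

Lemma mass_split n p i :
  mass n p i = mass (S n) (ext p n false) i + mass (S n) (ext p n true) i.
Proof.
  unfold mass. destruct (Nat.le_gt_cases (q i) n) as [L|L].
  - replace (Nat.min n (q i)) with (q i) by lia.
    replace (Nat.min (S n) (q i)) with (q i) by lia.
    replace (Nat.max n (q i)) with n by lia.
    replace (Nat.max (S n) (q i)) with (S n) by lia.
    assert (A := fun b => agr_ext p n b (q i) (c i) L).
    destruct (excluded_middle_informative (agr (q i) p (c i))) as [X|X];
    destruct (excluded_middle_informative (agr (q i) (ext p n false) (c i))) as [Y|Y];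
    destruct (excluded_middle_informative (agr (q i) (ext p n true) (c i))) as [Z|Z];
    try (exfalso; apply A in Y; tauto); try (exfalso; apply A in Z; tauto);
    try (exfalso; apply Y, A; tauto); try (exfalso; apply Z, A; tauto).
    + simpl. field.
    + lra.
  - replace (Nat.min n (q i)) with n by lia.
    replace (Nat.min (S n) (q i)) with (S n) by lia.
    replace (Nat.max n (q i)) with (q i) by lia.
    replace (Nat.max (S n) (q i)) with (q i) by lia.
    assert (A := fun b => agr_ext_S p n b (c i)).
    destruct (excluded_middle_informative (agr n p (c i))) as [X|X];
    destruct (excluded_middle_informative (agr (S n) (ext p n false) (c i))) as [Y|Y];
    destruct (excluded_middle_informative (agr (S n) (ext p n true) (c i))) as [Z|Z];
    try (assert (Y' := proj1 (A false) Y)); try (assert (Z' := proj1 (A true) Z));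
    try lra; try tauto; exfalso.
    + destruct Y' as [_ Y'], Z' as [_ Z']; congruence.
    + destruct (c i n) eqn:E; [apply Z|apply Y]; apply A; auto.
Qed.

Lemma ex_series_mass n p : ex_series (mass n p).
Proof.
  apply (ex_series_le (K := R_AbsRing) (V := R_CompleteNormedModule))
    with (fun i => (/ 2) ^ q i); auto.
  intros i. change (Rabs (mass n p i) <= (/ 2) ^ q i).
  destruct (mass_bounds n p i). rewrite Rabs_pos_eq; lra.
Qed.

(** Of the two halves of a cylinder, one keeps the total mass below its own measure; x follows these
    halves. If x met the i-th cylinder, that one alone would have full mass at depth [q i]. *)
Lemma cantor_cover : exists x, forall i, ~ agr (q i) x (c i).
Proof.
  destruct (choice (fun (np : nat * bword) b => Series (mass (fst np) (snd np)) < (/ 2) ^ fst np ->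
     Series (mass (S (fst np)) (ext (snd np) (fst np) b)) < (/ 2) ^ S (fst np))) as [bit Hbit].
  { intros [n p]; simpl fst; simpl snd.
    destruct (Rlt_dec (Series (mass (S n) (ext p n false))) ((/ 2) ^ S n)) as [L|L];
      [now exists false|]. exists true. intros H.
    rewrite (Series_ext _ (fun i => mass (S n) (ext p n false) i + mass (S n) (ext p n true) i)) in H
      by (intros; apply mass_split).
    rewrite Series_plus in H by apply ex_series_mass.
    simpl pow in *. lra. }
  set (p := fix p n := match n with O => cst false | S n => ext (p n) n (bit (n, p n)) end).
  assert (Hp : forall n, Series (mass n (p n)) < (/ 2) ^ n).
  { induction n as [|n IH].
    - rewrite (Series_ext _ (fun i => (/ 2) ^ q i)); [exact Hsum|].
      intros i. unfold mass. simpl Nat.min. destruct (excluded_middle_informative _) as [|X].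
      + reflexivity.
      + exfalso; apply X. intros j Hj; lia.
    - apply (Hbit (n, p n)). exact IH. }
  exists (fun n => p (S n) n). intros i A.
  assert (B : forall n k, (k < n)%nat -> p n k = p (S k) k).
  { induction n as [|n IH]; intros k Hk; [lia|].
    destruct (Nat.eq_dec k n) as [->|D]; auto.
    rewrite <- IH by lia. simpl. unfold ext.
    replace (Nat.eqb k n) with false by (symmetry; apply Nat.eqb_neq; lia). reflexivity. }
  specialize (Hp (q i)).
  assert (M : mass (q i) (p (q i)) i = (/ 2) ^ q i).
  { unfold mass. rewrite Nat.min_id, Nat.max_id.
    destruct (excluded_middle_informative _) as [|X]; auto. exfalso; apply X.
    intros k Hk. rewrite B by auto. now apply A. }
  assert (T := term_le_Series (mass (q i) (p (q i))) i (fun k => proj1 (mass_bounds _ _ k))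
    (ex_series_mass _ _)).
  lra.
Qed.
End CantorCover.

(** The mass distribution principle. Since B^s <= 2, a covering set inside a cylinder of depth q has
    d^s >= delta^s / 2^q, so a cover with sum below delta^s would cover all words by cylinders of
    total measure below 1. *)
Lemma hausdorff_not_null (A : R -> Prop) (phi : bword -> R) B delta s :
  1 < B -> 0 < delta -> (forall c, A (phi c)) ->
  (forall n c c', agr n c c' -> c n <> c' n -> delta / B ^ n <= Rabs (phi c - phi c')) ->
  0 <= s -> s * ln B <= ln 2 -> ~ hausdorff_null s A.
Proof.
  intros HB Hd HA Hsep Hs0 Hs Hnull.
  destruct (Hnull (delta / 2) (Rpower delta s)) as (C & d & Hcov & Hdd & Hdiam & S & HS & HSlt).
  { lra. } { apply exp_pos. }
  (* Words that first differ before this least index have images more than [d i] apart, so the words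
     mapped into [C i] share that many letters. *)
  assert (Hq : forall i, exists N, delta / B ^ N <= d i /\ forall n, (n < N)%nat -> d i < delta / B ^ n).
  { intros i. destruct (Hdd i) as [Hd1 Hd2].
    destruct (Wf_nat.dec_inh_nat_subset_has_unique_least_element
       (fun n => delta / B ^ n <= d i)) as (n & [Hn1 Hn2] & _).
    - intros n. destruct (Rle_dec (delta / B ^ n) (d i)); auto.
    - destruct (pow_inv_small B delta (d i)) as [N HN]; auto. exists N; lra.
    - exists n; split; auto. intros k Hk. apply Rnot_le_lt. intros L.
      specialize (Hn2 k L). lia. }
  destruct (choice _ Hq) as [q Hq'].
  destruct (choice (fun i x => (exists x', C i (phi x')) -> C i (phi x))) as [c Hc].
  { intros i. destruct (classic (exists x', C i (phi x'))) as [[x Hx]|Hn].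
    - now exists x.
    - exists (cst true); tauto. }
  assert (HRd : 0 < Rpower delta s) by apply exp_pos.
  assert (Hterm : forall i, (/ 2) ^ q i <= / Rpower delta s * Rpower (d i) s).
  { intros i. destruct (Hq' i) as [H1 _]. destruct (Hdd i) as [Hd1 _].
    assert (0 < B ^ q i) by (apply pow_lt; lra).
    assert (Hi : 0 < / B ^ q i) by (apply Rinv_0_lt_compat; lra).
    apply Rmult_le_reg_l with (Rpower delta s); auto.
    rewrite <- Rmult_assoc, Rinv_r, Rmult_1_l by lra.
    apply Rle_trans with (Rpower (delta / B ^ q i) s).
    - unfold Rdiv. rewrite <- Rpower_mult_distr by auto.
      apply Rmult_le_compat_l; [lra|].
      rewrite <- !pow_inv. rewrite <- !Rpower_pow by (try apply Rinv_0_lt_compat; lra).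
      rewrite Rpower_mult. unfold Rpower. rewrite !ln_Rinv by lra.
      assert (0 <= INR (q i)) by apply pos_INR.
      assert (INR (q i) * (s * ln B) <= INR (q i) * ln 2) by (apply Rmult_le_compat_l; lra).
      destruct (Rle_lt_or_eq_dec (INR (q i) * - ln 2) (INR (q i) * s * - ln B)) as [L|L].
      + lra.
      + left; now apply exp_increasing.
      + rewrite L; lra.
    - apply Rle_Rpower_l; auto. split; auto. apply Rdiv_lt_0_compat; lra. }
  assert (Hser : is_series (fun i => / Rpower delta s * Rpower (d i) s) (/ Rpower delta s * S)).
  { apply (is_series_scal (K := R_AbsRing) (V := R_NormedModule) (/ Rpower delta s) (fun i => Rpower (d i) s) S). now apply is_series_Reals. }
  assert (Hp : forall k, 0 < (/ 2) ^ k) by (intros; apply pow_lt; lra).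
  assert (Hex : ex_series (fun i => (/ 2) ^ q i)).
  { apply (ex_series_le (K := R_AbsRing) (V := R_CompleteNormedModule))
      with (fun i => / Rpower delta s * Rpower (d i) s); [|eexists; eauto].
    intros i. change (Rabs ((/ 2) ^ q i) <= / Rpower delta s * Rpower (d i) s).
    rewrite Rabs_pos_eq; auto. left; apply Hp. }
  destruct (cantor_cover q c Hex) as [x Hx].
  { apply Rle_lt_trans with (/ Rpower delta s * S).
    - rewrite <- (is_series_unique _ _ Hser). apply Series_le; [|eexists; eauto].
      intros i; split; auto. left; apply Hp.
    - apply Rmult_lt_reg_l with (Rpower delta s); auto.
      rewrite <- Rmult_assoc, Rinv_r; lra. }
  destruct (Hcov (phi x) (HA x)) as [i Hi].
  apply (Hx i). intros k Hk. apply NNPP. intros D.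
  assert (Hne : x <> c i) by congruence.
  destruct (first_diff _ _ Hne) as (n & Hn & Dn).
  assert (n <= k)%nat.
  { apply Nat.nlt_ge. intros L. apply D. now apply Hn. }
  assert (K1 := Hsep n x (c i) Hn Dn).
  assert (K2 := Hdiam i _ _ Hi (Hc i (ex_intro _ x Hi))).
  destruct (Hq' i) as [_ K3]. specialize (K3 n ltac:(lia)). lra.
Qed.

(** Ensures that the infimum defining the dimension ranges over a nonempty set. N intervals of
    length h = K'/N contribute h K', which tends to 0 with h. *)
Lemma hausdorff_null_2 (A : R -> Prop) K : (forall x, A x -> 0 <= x < K) -> hausdorff_null 2 A.
Proof.
  intros HA delta eps Hd He.
  set (K' := Rmax K 1).
  assert (HK1 : 1 <= K') by apply Rmax_r. assert (HK : K <= K') by apply Rmax_l.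
  assert (Hmin : 0 < Rmin (Rmin delta 1) (eps / (K' + 3))).
  { repeat apply Rmin_pos; try lra. apply Rdiv_lt_0_compat; lra. }
  destruct (archimed_cor1 (Rmin (Rmin delta 1) (eps / (K' + 3)) / K')) as (N & HN & HN0).
  { apply Rdiv_lt_0_compat; lra. }
  assert (HNR : 0 < INR N) by (apply lt_0_INR; auto).
  set (h := K' / INR N).
  assert (Hh0 : 0 < h) by (apply Rdiv_lt_0_compat; lra).
  assert (Hh : h < Rmin (Rmin delta 1) (eps / (K' + 3))).
  { apply Rmult_lt_compat_l with (r := K') in HN; [|lra].
    replace (K' * (Rmin (Rmin delta 1) (eps / (K' + 3)) / K'))
      with (Rmin (Rmin delta 1) (eps / (K' + 3))) in HN by (field; lra).
    exact HN. }
  assert (B1 := Rmin_l (Rmin delta 1) (eps / (K' + 3))).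
  assert (B2 := Rmin_r (Rmin delta 1) (eps / (K' + 3))).
  assert (B3 := Rmin_l delta 1). assert (B4 := Rmin_r delta 1).
  assert (Hp : forall k, 0 < (/ 2) ^ k <= 1).
  { intros k; split; [apply pow_lt; lra|]. rewrite <- (pow1 k). apply pow_incr; lra. }
  (* From index N on the sets are empty, but their diameters must still be positive with a small
     sum. *)
  set (d := fun i => if Nat.ltb i N then h else h * (/ 2) ^ i).
  assert (Hd0 : forall i, 0 < d i <= h).
  { intros i. unfold d. destruct (Nat.ltb i N); [lra|]. destruct (Hp i). split.
    - apply Rmult_lt_0_compat; lra.
    - rewrite <- (Rmult_1_r h) at 2. apply Rmult_le_compat_l; lra. }
  exists (fun i x => (i < N)%nat /\ INR i * h <= x < INR (S i) * h), d.
  split; [|split; [|split]].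
  - intros x Hx. apply HA in Hx.
    assert (Hu : x / h < INR N).
    { apply Rmult_lt_reg_r with h; auto.
      replace (x / h * h) with x by (field; lra).
      replace (INR N * h) with K' by (unfold h; field; lra). lra. }
    assert (Hq : 0 <= x / h) by (apply Rmult_le_pos; [lra|left; now apply Rinv_0_lt_compat]).
    destruct (nfloor_ex (x / h) Hq) as [i [I1 I2]].
    exists i. split.
    + apply INR_lt. lra.
    + rewrite S_INR. split.
      * apply Rmult_le_compat_r with (r := h) in I1; [|lra].
        replace (x / h * h) with x in I1 by (field; lra). exact I1.
      * apply Rmult_lt_compat_r with (r := h) in I2; [|lra].
        replace (x / h * h) with x in I2 by (field; lra). exact I2.
  - intros i. destruct (Hd0 i). lra.
  - intros i x y [Hi Hx] [_ Hy]. unfold d. apply Nat.ltb_lt in Hi. rewrite Hi.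
    rewrite S_INR in Hx, Hy. apply Rabs_le. lra.
  - assert (Epow : forall i, Rpower (d i) 2 = d i * d i).
    { intros i. replace 2 with (1 + 1) by ring. destruct (Hd0 i).
      rewrite Rpower_plus, Rpower_1; lra. }
    assert (Hsum : forall n, sum_f_R0 (fun i => Rpower (d i) 2) n
       <= h * h * INR (Nat.min (S n) N) + h * h * (2 - (/ 2) ^ n)).
    { induction n as [|n IH].
      - simpl sum_f_R0. rewrite Epow.
        assert (d 0%nat * d 0%nat <= h * h) by (destruct (Hd0 0%nat); apply Rmult_le_compat; lra).
        assert (0 <= h * h * INR (Nat.min 1 N)).
        { apply Rmult_le_pos; [apply Rmult_le_pos; lra|apply pos_INR]. }
        simpl ((/ 2) ^ 0). lra.
      - simpl sum_f_R0. rewrite Epow. assert (0 <= h * h) by (apply Rmult_le_pos; lra).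
        destruct (Hp n), (Hp (S n)).
        assert (E2 : (/ 2) ^ n = 2 * (/ 2) ^ S n) by (simpl; field).
        destruct (Nat.le_gt_cases N (S n)) as [L|L].
        + assert (Nat.min (S n) N = N) as E1 by lia. rewrite E1 in IH.
          assert (Nat.min (S (S n)) N = N) as E3 by lia. rewrite E3.
          assert (E4 : d (S n) = h * (/ 2) ^ S n).
          { unfold d. replace (Nat.ltb (S n) N) with false; auto.
            symmetry; apply Nat.ltb_ge; auto. }
          rewrite E4. set (z := (/ 2) ^ S n) in *.
          assert (h * z * (h * z) <= h * h * z).
          { replace (h * z * (h * z)) with (h * h * z * z) by ring.
            rewrite <- (Rmult_1_r (h * h * z)) at 2. apply Rmult_le_compat_l; [|lra].
            apply Rmult_le_pos; lra. }
          rewrite E2 in IH. lra.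
        + assert (Nat.min (S n) N = S n) as E1 by lia. rewrite E1 in IH.
          assert (Nat.min (S (S n)) N = S (S n)) as E3 by lia. rewrite E3.
          assert (d (S n) * d (S n) <= h * h)
            by (destruct (Hd0 (S n)); apply Rmult_le_compat; lra).
          rewrite (S_INR (S n)). rewrite E2 in IH.
          assert (0 <= h * h * (/ 2) ^ S n) by (apply Rmult_le_pos; lra). lra. }
    assert (Hbd : forall n, sum_f_R0 (fun i => Rpower (d i) 2) n <= h * (K' + 2)).
    { intros n. eapply Rle_trans; [apply Hsum|].
      assert (0 <= h * h) by (apply Rmult_le_pos; lra).
      assert (INR (Nat.min (S n) N) <= INR N) by (apply le_INR; lia).
      assert (h * h * INR (Nat.min (S n) N) <= h * h * INR N) by (apply Rmult_le_compat_l; lra).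
      assert (h * h * INR N = h * K') by (unfold h; field; lra).
      destruct (Hp n).
      assert (h * h * (2 - (/ 2) ^ n) <= h * h * 2) by (apply Rmult_le_compat_l; lra).
      assert (h * h * 2 <= h * 2).
      { assert (h * h <= h * 1) by (apply Rmult_le_compat_l; lra). lra. }
      lra. }
    assert (Hgrow : Un_growing (sum_f_R0 (fun i => Rpower (d i) 2))).
    { intros n. simpl. assert (0 < Rpower (d (S n)) 2) by apply exp_pos. lra. }
    destruct (growing_cv _ Hgrow) as [S HS].
    { exists (h * (K' + 2)). intros x [n ->]. apply Hbd. }
    exists S; split; [exact HS|].
    apply Rle_lt_trans with (h * (K' + 2)).
    + apply Rnot_lt_le. intros L.
      destruct (HS (S - h * (K' + 2))) as [n Hn]; [lra|].
      specialize (Hn n (le_n n)). unfold R_dist in Hn. apply Rabs_def2 in Hn.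
      specialize (Hbd n). lra.
    + apply Rmult_lt_compat_r with (r := K' + 3) in Hh; [|lra].
      assert (Rmin (Rmin delta 1) (eps / (K' + 3)) * (K' + 3) <= eps).
      { apply Rmult_le_compat_r with (r := K' + 3) in B2; [|lra].
        replace (eps / (K' + 3) * (K' + 3)) with eps in B2 by (field; lra). exact B2. }
      lra.
Qed.

(** The admissible exponents contain 2 and are all at least ln 2 / ln B, so their infimum exists
    (completeness is applied to the opposites) and is positive. *)
Lemma hausdorff_dim_pos (A : R -> Prop) (phi : bword -> R) B delta K :
  1 < B -> 0 < delta -> (forall c, A (phi c)) ->
  (forall n c c', agr n c c' -> c n <> c' n -> delta / B ^ n <= Rabs (phi c - phi c')) ->
  (forall x, A x -> 0 <= x < K) ->
  exists dim, hausdorff_dim A dim /\ 0 < dim.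
Proof.
  intros HB Hd HA Hsep HK.
  assert (HlB : 0 < ln B) by (rewrite <- ln_1; apply ln_increasing; lra).
  assert (Hl2 : 0 < ln 2) by (rewrite <- ln_1; apply ln_increasing; lra).
  set (E := fun s => 0 <= s /\ hausdorff_null s A).
  assert (HE : forall s, E s -> ln 2 / ln B <= s).
  { intros s [Hs0 Hs]. apply Rnot_lt_le. intros L.
    apply (hausdorff_not_null A phi B delta s); auto.
    apply Rmult_lt_compat_r with (r := ln B) in L; auto.
    replace (ln 2 / ln B * ln B) with (ln 2) in L by (field; lra). lra. }
  destruct (completeness (fun x => E (- x))) as [M [HM1 HM2]].
  - exists 0. intros x [Hx _]. lra.
  - exists (- 2). unfold E. replace (- - 2) with 2 by ring.
    split; [lra|]. now apply hausdorff_null_2 with K.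
  - exists (- M). split.
    + split.
      * intros s Hs. assert (- s <= M); [|lra]. apply HM1. now rewrite Ropp_involutive.
      * intros z Hz. assert (M <= - z); [|lra]. apply HM2.
        intros x Hx. specialize (Hz _ Hx). lra.
    + apply Rlt_le_trans with (ln 2 / ln B); [now apply Rdiv_lt_0_compat|].
      assert (M <= - (ln 2 / ln B)); [|lra]. apply HM2.
      intros x Hx. specialize (HE _ Hx). lra.
Qed.

(** * Bases above the critical one *)

Definition subst_list (l : list sub) (x : list bool) : list bool :=
  fold_right (fun t y => flat_map (img t) y) x l.

Lemma subst_wapp t x u : subst_inf t (wapp x u) = wapp (flat_map (img t) x) (subst_inf t u).
Proof.
  induction x as [|b x IH]; [reflexivity|]. simpl.
  rewrite subst_cons, IH. unfold wapp. now rewrite fold_right_app.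
Qed.

Lemma substs_wapp l x u : apply_subs l (wapp x u) = wapp (subst_list l x) (apply_subs l u).
Proof.
  induction l as [|t l IH]; [reflexivity|]. simpl. now rewrite IH, subst_wapp.
Qed.

Lemma subst_list_perm l x y : Permutation x y -> Permutation (subst_list l x) (subst_list l y).
Proof. intros H; induction l; simpl; auto. now apply Permutation_flat_map. Qed.

Lemma apply_subs_inj l x y : apply_subs l x = apply_subs l y -> x = y.
Proof. induction l as [|t l IH]; auto. intros H. apply IH, (subst_inj t), H. Qed.

Lemma P_gap beta n u v : 2 < beta -> agr n u v -> u n <> v n ->
  (beta - 2) / (beta - 1) / beta ^ S n <= Rabs (P beta u - P beta v).
Proof.
  intros Hb. revert u v; induction n as [|n IH]; intros u v H D;
    rewrite <- (wcons_shift u), <- (wcons_shift v), !P_cons by lra.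
  - destruct (P_bounds beta (shift u)) as [U1 U2]; [lra|].
    destruct (P_bounds beta (shift v)) as [V1 V2]; [lra|].
    assert (0 < / beta) by (apply Rinv_0_lt_compat; lra).
    assert (E : (beta - 2) / (beta - 1) = 1 - 1 / (beta - 1)) by (field; lra).
    assert (E1 : forall c d x y, (c + x) / beta - (d + y) / beta = (c - d + (x - y)) * / beta)
      by (intros; unfold Rdiv; ring).
    rewrite E1, Rabs_mult, (Rabs_pos_eq (/ beta)), E by lra.
    rewrite pow_1. unfold Rdiv at 1. apply Rmult_le_compat_r; [lra|].
    destruct (u 0%nat), (v 0%nat); try congruence.
    + eapply Rle_trans; [|apply Rle_abs]. lra.
    + rewrite <- Rabs_Ropp. eapply Rle_trans; [|apply Rle_abs]. lra.
  - rewrite (H 0%nat) by lia.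
    specialize (IH (shift u) (shift v) (agr_shift _ _ _ H) D).
    assert (0 < / beta) by (apply Rinv_0_lt_compat; lra).
    assert (E1 : forall c x y, (c + x) / beta - (c + y) / beta = (x - y) * / beta)
      by (intros; unfold Rdiv; ring).
    rewrite E1, Rabs_mult, (Rabs_pos_eq (/ beta)) by lra.
    assert (0 < beta ^ S n) by (apply pow_lt; lra).
    change (beta ^ S (S n)) with (beta * beta ^ S n).
    replace ((beta - 2) / (beta - 1) / (beta * beta ^ S n))
      with ((beta - 2) / (beta - 1) / beta ^ S n * / beta) by (field; lra).
    apply Rmult_le_compat_r; lra.
Qed.

Lemma P_wapp_diff beta z u v : 1 < beta ->
  P beta (wapp z u) - P beta (wapp z v) = (P beta u - P beta v) / beta ^ length z.
Proof.
  intros Hb. induction z as [|b z IH]; simpl; [field|].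
  rewrite !P_cons by auto.
  assert (0 < beta ^ length z) by (apply pow_lt; lra).
  replace ((P beta u - P beta v) / (beta * beta ^ length z))
    with ((P beta u - P beta v) / beta ^ length z / beta) by (field; lra).
  rewrite <- IH. field; lra.
Qed.

Section Above.
Variables (m beta : R) (l : list sub).
Hypotheses (Hm : 1 < m <= 2) (Hb : 2 < beta).
Hypothesis (HA : m < G beta (Asubs l (cst false))).
Hypothesis (HB : F beta (Bsubs l (cst true)) < m).

(* precomposing with M makes the two blocks equally long *)
Let W (c : bword) : bword := apply_subs l (subst_inf SM c).
Let x := subst_list l [true; false].
Let y := subst_list l [false; true].

Lemma W_Ubeta c : Ubeta beta m (bin (W c)).
Proof.
  apply Ubeta_intro; auto; [lra|]. intros k _. split.
  - eapply Rlt_le_trans; [exact HA|]. apply G_le; [lra|].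
    apply orbit_ge_substs. intros; apply cst_false_le.
  - eapply Rle_lt_trans; [|exact HB]. apply F_le; [lra|].
    apply orbit_le_substs; [reflexivity|]. intros; apply le_cst_true.
Qed.

Lemma W_block c : W c = wapp (if c 0%nat then x else y) (W (shift c)).
Proof.
  unfold W. rewrite subst_unfold, substs_wapp. f_equal.
  now destruct (c 0%nat).
Qed.

(** 10 and 01 are permutations of each other, a property that substitutions preserve. *)
Lemma blocks_length : length x = length y.
Proof. apply Permutation_length, subst_list_perm. constructor. Qed.

Lemma blocks_neq : x <> y.
Proof.
  intros E. assert (H : W w10 = W (cst false)).
  { rewrite (W_block w10), (W_block (cst false)). simpl. now rewrite E. }
  apply apply_subs_inj, subst_inj in H.
  assert (K := f_equal (fun w => w 0%nat) H). discriminate.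
Qed.

(** Equal block lengths make every common letter of c and c' divide the distance by exactly
    beta^(length x). The constant allows for a first difference anywhere in the first differing
    block. *)
Lemma W_separated n c c' : agr n c c' -> c n <> c' n ->
  (beta - 2) / (beta - 1) / beta ^ length x / (beta ^ length x) ^ n
    <= Rabs (P beta (W c) - P beta (W c')).
Proof.
  revert c c'; induction n as [|n IH]; intros c c' H D.
  - assert (Hl := blocks_length).
    assert (Hd : exists j, (j < length x)%nat /\ nth j x false <> nth j y false).
    { apply NNPP. intros N. apply blocks_neq. apply (nth_ext _ _ false false Hl).
      intros j Hj. apply NNPP. intros Nj. apply N. eauto. }
    destruct Hd as (j & Hj & Dj).
    assert (Dj' : W c j <> W c' j).
    { rewrite (W_block c), (W_block c'), !nth_wapp.
      apply Nat.ltb_lt in Hj.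
      destruct (c 0%nat), (c' 0%nat); try congruence; rewrite <- Hl, Hj; congruence. }
    assert (Hne : W c <> W c') by congruence.
    destruct (first_diff _ _ Hne) as (k & Hk & Dk).
    assert (k <= j)%nat by (apply Nat.nlt_ge; intros L; apply Dj'; now apply Hk).
    eapply Rle_trans; [|apply (P_gap beta k); auto].
    rewrite pow_O.
    assert (B1 : 0 < beta ^ S k) by (apply pow_lt; lra).
    assert (B2 : beta ^ S k <= beta ^ length x) by (apply Rle_pow; [lra|lia]).
    assert (B3 : 0 < (beta - 2) / (beta - 1)) by (apply Rdiv_lt_0_compat; lra).
    unfold Rdiv at 1. rewrite Rinv_1, Rmult_1_r.
    apply Rmult_le_compat_l; [lra|]. apply Rinv_le_contravar; lra.
  - rewrite (W_block c), (W_block c'), (H 0%nat) by lia.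
    rewrite P_wapp_diff by lra.
    replace (length (if c' 0%nat then x else y)) with (length x)
      by (destruct (c' 0%nat); auto using blocks_length).
    specialize (IH (shift c) (shift c') (agr_shift _ _ _ H) D).
    assert (Bp : 0 < beta ^ length x) by (apply pow_lt; lra).
    set (z := beta ^ length x) in *.
    assert (0 < z ^ n) by (apply pow_lt; lra).
    assert (0 < / z) by (apply Rinv_0_lt_compat; lra).
    unfold Rdiv at 4. rewrite Rabs_mult, (Rabs_pos_eq (/ z)) by lra. simpl.
    replace ((beta - 2) / (beta - 1) / z / (z * z ^ n))
      with ((beta - 2) / (beta - 1) / z / z ^ n * / z) by (field; lra).
    apply Rmult_le_compat_r; lra.
Qed.

Lemma uncountable_above : uncountable (fun u => Ubeta beta m u /\ digits01 u).
Proof.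
  intros [h Hh]. apply (no_injection_to_nat (fun c => h (bin (W c)))).
  intros c c' E. apply subst_inj with SM, apply_subs_inj with l, bin_inj.
  apply Hh; auto; split; try apply W_Ubeta;
    intros k; unfold bin; destruct (apply_subs _ _ k); auto.
Qed.

Lemma dim_pos_above : exists dim, hausdorff_dim (piU beta m) dim /\ 0 < dim.
Proof.
  apply (hausdorff_dim_pos (piU beta m) (fun c => P beta (W c)) (beta ^ length x)
    ((beta - 2) / (beta - 1) / beta ^ length x) (m / (beta - 1) + 1)).
  (* Two different blocks of equal length are nonempty. *)
  - apply Rlt_pow_R1; [lra|]. assert (H := blocks_neq). assert (H' := blocks_length).
    destruct x, y; simpl in *; try lia. congruence.
  - repeat apply Rdiv_lt_0_compat; try lra. apply pow_lt; lra.
  - intros c. exists (bin (W c)); split; [apply W_Ubeta|].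
    apply (pi_is_val beta 1); [lra|apply dig_bin].
  - apply W_separated.
  - intros z (u & [Hu _] & Hz). apply pi_is_unique in Hz. subst z.
    destruct (val_bounds beta m u); [lra|apply dig_digits01m; auto; lra|]. lra.
Qed.
End Above.

(** * Bases below the critical one *)

Lemma countable_below m beta : 1 < m <= 2 -> 1 < beta <= m + 1 ->
  (2 < beta -> forall u,
     avoids (fun w => G beta w <= m) (fun w => m <= F beta w) u -> eperiodic u) ->
  countable (fun u => Ubeta beta m u /\ digits01 u).
Proof.
  intros Hm Hb H. apply countable_of_eperiodic. intros u Hu.
  assert (K := fun k => Ubeta_elim beta m u k Hm Hb Hu).
  destruct (Rle_lt_dec beta 2) as [L|L].
  (* For [beta <= 2] a letter 1 would give m < G <= 1 + P = F < m, so only 0^w is left. *)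
  - apply (eperiodic_eventually_cst false). exists 0%nat.
    apply functional_extensionality; intros k. unfold shiftn, cst; simpl.
    destruct (u k) eqn:Ek; auto. exfalso. destruct (K k Ek) as [K1 K2].
    rewrite F_head in K2; [|lra|unfold shiftn; now rewrite Nat.add_0_r].
    rewrite shift_shiftn in K2. unfold G in K1.
    destruct (P_bounds beta (shiftn (S k) u)) as [P1 _]; [lra|].
    assert ((beta - 1) * (1 + P beta (shiftn (S k) u)) <= 1 * (1 + P beta (shiftn (S k) u)))
      by (apply Rmult_le_compat_r; lra).
    lra.
  - apply H; auto. intros k; split; intros Ek.
    + destruct (K k Ek). lra.
    (* A tail opening with 1 is handled by [K] at the next position; for one opening with 0, [F] is
       the [P] of a tail, hence below 1. *)
    + destruct (u (S k)) eqn:Ek'.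
      * destruct (K (S k) Ek'). lra.
      * rewrite shiftn_expand, Ek'. unfold F. rewrite P_cons by lra.
        destruct (P_bounds beta (shiftn (S (S k)) u)) as [_ P2]; [lra|].
        assert (1 / (beta - 1) < 1).
        { apply Rmult_lt_reg_r with (beta - 1); [lra|]. field_simplify; lra. }
        replace (beta * ((0 + P beta (shiftn (S (S k)) u)) / beta))
          with (P beta (shiftn (S (S k)) u)) by (field; lra).
        lra.
Qed.

Lemma avoids_eperiodic_FG beta m l p q : 2 <= beta -> p = w01 \/ q = w10 ->
  G beta (Asubs l p) <= m -> m <= F beta (Bsubs l q) -> forall u,
  avoids (fun w => G beta w <= m) (fun w => m <= F beta w) u -> eperiodic u.
Proof.
  intros Hb Hpq H1 H2 u.
  apply (avoids_eperiodic l (fun w => G beta w <= m) (fun w => m <= F beta w) p q); auto.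
  - intros a b Hab. assert (G beta a <= G beta b) by now apply G_le. lra.
  - intros a b Hab. assert (F beta a <= F beta b) by now apply F_le. lra.
Qed.

(** The common target of the four cases: one argument turns it into the value of [calL] and into
    positive dimension. The bound m + 1 keeps smaller bases in the range where uniqueness forces the
    inequalities. *)
Definition critical (m L : R) : Prop :=
  2 <= L <= m + 1 /\
  (forall beta, 2 < beta < L -> forall u,
     avoids (fun w => G beta w <= m) (fun w => m <= F beta w) u -> eperiodic u) /\
  (forall beta, L < beta -> exists l,
     m < G beta (Asubs l (cst false)) /\ F beta (Bsubs l (cst true)) < m).

Lemma critical_calL m L : 1 < m <= 2 -> critical m L -> calL m = L.
Proof.
  intros Hm (HL & H1 & H2).
  set (E := fun beta => 1 < beta /\ uncountable (fun u => Ubeta beta m u /\ digits01 u)).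
  assert (HE : is_glb E L).
  { split.
    - intros beta [Hb Hu]. apply Rnot_lt_le. intros Lt. apply Hu.
      apply countable_below; auto; [lra|]. intros. eapply H1; eauto.
    - intros c Hc. apply Rnot_lt_le. intros Lt.
      assert (c <= (L + c) / 2); [|lra]. apply Hc. split; [lra|].
      destruct (H2 ((L + c) / 2)) as (l & K1 & K2); [lra|].
      apply uncountable_above with l; auto; lra. }
  assert (HC : is_glb E (calL m)) by (unfold calL; apply epsilon_spec; eauto).
  destruct HE as [A1 A2], HC as [C1 C2]. apply Rle_antisym; auto.
Qed.

Lemma critical_dim m L beta : 1 < m <= 2 -> critical m L -> calL m < beta ->
  exists dim, hausdorff_dim (piU beta m) dim /\ 0 < dim.
Proof.
  intros Hm HL. rewrite (critical_calL m L Hm HL). destruct HL as (HL & _ & H2). intros Hb.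
  destruct (H2 beta Hb) as (l & K1 & K2). apply dim_pos_above with l; auto; lra.
Qed.

(** * The plateaus *)

(** Every M-block and every R-block contains a 1, so even 10^w has an image with infinitely many
    ones. *)
Lemma ones_Bsub_MR t b : t <> SL -> ones (Bsub t b).
Proof.
  intros Ht. split; [destruct t; auto; congruence|]. intros N.
  destruct (shiftn_subst_of t b N) as (j & Hj & E).
  assert (E' : forall i, subst_inf t b (j + i)%nat = subst_inf t (shiftn N b) i).
  { intros i. exact (f_equal (fun w => w i) E). }
  assert (K : exists i, subst_inf t (shiftn N b) i = true).
  { rewrite subst_unfold. destruct t; [congruence| |]; destruct (shiftn N b 0%nat);
      solve [now exists 0%nat | now exists 1%nat]. }
  destruct K as [i Hi]. exists (S (j + i)); split; [lia|].
  rewrite <- E' in Hi. destruct t; [congruence|exact Hi|exact Hi].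
Qed.

Lemma ones_Bsub t b : ones b -> ones (Bsub t b).
Proof.
  intros Hb. destruct t; try (apply ones_Bsub_MR; discriminate).
  split; [apply Bsub_0, Hb|]. intros N.
  destruct (proj2 Hb N) as (k & Hk & Ek).
  destruct (shiftn_subst_of SL b k) as (j & Hj & E).
  exists j; split; [lia|]. simpl. unfold shift.
  assert (E' := f_equal (fun w => w 1%nat) E). simpl in E'.
  unfold shiftn at 1 in E'. rewrite Nat.add_1_r in E'. rewrite E'.
  rewrite shiftn_expand, Ek, subst_cons. reflexivity.
Qed.

Lemma ones_Bsubs l b : ones b -> ones (Bsubs l b).
Proof. intros H; induction l; simpl; auto using ones_Bsub. Qed.

Lemma ones_cst_true : ones (cst true).
Proof. split; auto. intros N; exists N; auto. Qed.

Lemma inf_sup_of_bounds u a b : bounds u a b -> ones b -> inf_sup u a b.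
Proof.
  intros H Hb. split; [eapply bounds_infw; eauto|].
  split; [eapply bounds_supw; eauto|]. split; auto.
  destruct H as (H1 & _ & _ & H2).
  destruct (choice _ (fun N => H2 (S N))) as [h Hh].
  apply (lex_le_limit_r (fun n => shiftn (S (S (h n))) u)); auto.
  intros n. destruct (Hh n) as [_ A]. rewrite <- shift_shiftn. now apply agr_shift.
Qed.

Lemma apply_subs_M l u : apply_subs (l ++ [SM]) u = apply_subs l (subst_inf SM u).
Proof. apply fold_right_app. Qed.

Lemma inf_sup_M_w10 l :
  inf_sup (apply_subs (l ++ [SM]) w10) (Asubs (l ++ [SL]) w01) (Bsubs (l ++ [SL]) (cst true)).
Proof.
  rewrite apply_subs_M, Asubs_app, Bsubs_app. apply inf_sup_of_bounds.
  - apply bounds_substs; [now apply (Bsubs_0 [SL])|apply bounds_M_w10].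
  - rewrite <- Bsubs_app. apply ones_Bsubs, ones_cst_true.
Qed.

Lemma inf_sup_M_w010 l :
  inf_sup (apply_subs (l ++ [SM]) w010) (Asubs (l ++ [SM]) (cst false)) (Bsubs (l ++ [SM]) w10).
Proof.
  apply inf_sup_of_bounds.
  - apply bounds_substs; [reflexivity|apply bounds_w010].
  - rewrite Bsubs_app. apply ones_Bsubs, ones_Bsub_MR; discriminate.
Qed.

Lemma inf_sup_M_w101 l :
  inf_sup (apply_subs (l ++ [SM]) w101) (Asubs (l ++ [SM]) w01) (Bsubs (l ++ [SM]) (cst true)).
Proof.
  apply inf_sup_of_bounds.
  - apply bounds_substs; [reflexivity|apply bounds_w101].
  - apply ones_Bsubs, ones_cst_true.
Qed.

Lemma inf_sup_M_w01 l :
  inf_sup (apply_subs (l ++ [SM]) w01) (Asubs (l ++ [SR]) (cst false)) (Bsubs (l ++ [SR]) w10).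
Proof.
  rewrite apply_subs_M, Asubs_app, Bsubs_app. apply inf_sup_of_bounds.
  - apply bounds_substs; [reflexivity|apply bounds_M_w01].
  - apply ones_Bsubs, ones_Bsub_MR; discriminate.
Qed.

Lemma inf_sup_w01 : inf_sup w01 w01 (cst true).
Proof.
  split; [apply infw_w01|]. split; [apply supw_w01|]. split; [apply ones_cst_true|].
  apply le_cst_true.
Qed.

Lemma AL_M l : Asubs (l ++ [SL]) w01 = Asubs (l ++ [SM]) (cst false).
Proof. rewrite !Asubs_app. f_equal. apply AL_w01. Qed.

Lemma BR_M l : Bsubs (l ++ [SR]) w10 = Bsubs (l ++ [SM]) (cst true).
Proof. rewrite !Bsubs_app. f_equal. apply BR_w10. Qed.

Lemma Asubs_repeat_L k : Asubs (repeat SL k) (cst false) = cst false.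
Proof. induction k; simpl; auto. rewrite IHk. apply AL_0. Qed.
Lemma Bsubs_repeat_L k : Bsubs (repeat SL k) w10 = w10.
Proof. induction k; simpl; auto. rewrite IHk. apply BL_w10. Qed.
Lemma Asubs_repeat_R k : Asubs (repeat SR k) w01 = w01.
Proof. induction k; simpl; auto. rewrite IHk. apply AR_w01. Qed.
Lemma Bsubs_repeat_R k : Bsubs (repeat SR k) (cst true) = cst true.
Proof. induction k; simpl; auto. rewrite IHk. apply BR_1. Qed.

(** 01^w is fixed by [Asub SR], and each R settles one more letter. *)
Lemma approach_R l k : agr k (Asubs (l ++ repeat SR k) (cst false)) (Asubs l w01).
Proof.
  rewrite <- (Asubs_repeat_R k). rewrite <- Asubs_app.
  eapply agr_le; [|apply Asubs_agr_0; reflexivity].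
  rewrite length_app, repeat_length; lia.
Qed.

Lemma approach_L l k : agr k (Bsubs (l ++ repeat SL k) (cst true)) (Bsubs l w10).
Proof.
  rewrite <- (Bsubs_repeat_L k). rewrite <- Bsubs_app.
  eapply agr_le; [|apply Bsubs_agr_0; reflexivity].
  rewrite length_app, repeat_length; lia.
Qed.

(** Appending enough R's turns the bound at 01^w into one at 0^w and leaves the upper word
    unchanged, since 1^w is fixed by [Bsub SR]. *)
Lemma reach_R m beta l : 1 < beta ->
  m < G beta (Asubs l w01) -> F beta (Bsubs l (cst true)) < m ->
  exists l', m < G beta (Asubs l' (cst false)) /\ F beta (Bsubs l' (cst true)) < m.
Proof.
  intros Hb H1 H2. destruct (G_gt_agr beta _ m Hb H1) as [N HN].
  exists (l ++ repeat SR N); split.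
  - apply HN, approach_R.
  - now rewrite Bsubs_app, Bsubs_repeat_R.
Qed.

Lemma reach_L m beta l : 1 < beta ->
  m < G beta (Asubs l (cst false)) -> F beta (Bsubs l w10) < m ->
  exists l', m < G beta (Asubs l' (cst false)) /\ F beta (Bsubs l' (cst true)) < m.
Proof.
  intros Hb H1 H2. destruct (F_lt_agr beta _ m Hb H2) as [N HN].
  exists (l ++ repeat SL N); split.
  - now rewrite Asubs_app, Asubs_repeat_L.
  - apply HN, approach_L.
Qed.

Lemma g_fun_le u a b m : inf_sup u a b -> 1 < m -> g_fun u m <= m + 1.
Proof.
  intros Hu Hm. destruct (g_fun_spec u a b m Hu Hm) as [H1 H2].
  unfold G in H2. destruct (P_bounds (g_fun u m) a H1) as [K _].
  assert (0 <= (g_fun u m - 1) * P (g_fun u m) a) by (apply Rmult_le_pos; lra). lra.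
Qed.

(** By [AL_M] the words u1 and u2 have the same infimum, hence the same base g; it is at least f for
    u1 and at most f for u2. Below g the M-image with 10^w leaves only eventually periodic words;
    above g the end of the L-image, followed by R's, gives the Cantor set. *)
Lemma critical_g l m : 1 < m <= 2 ->
  mu (apply_subs (l ++ [SM]) w10) <= m <= mu (apply_subs (l ++ [SM]) w010) ->
  critical m (g_fun (apply_subs (l ++ [SM]) w10) m).
Proof.
  intros Hm [H1 H2].
  assert (I1 := inf_sup_M_w10 l). assert (I2 := inf_sup_M_w010 l).
  apply (mu_le _ _ _ m I1 Hm) in H1. apply (le_mu _ _ _ m I2 Hm) in H2.
  set (u1 := apply_subs (l ++ [SM]) w10) in *.
  set (u2 := apply_subs (l ++ [SM]) w010) in *.
  assert (H3 := max_fg_ge2 _ _ _ m I1 Hm). rewrite Rmax_right in H3 by auto.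
  split; [split; [auto|eapply g_fun_le; eauto; lra]|split].
  - intros beta Hb. assert (Hb' := proj2 Hb).
    apply (lt_g_fun _ _ _ m I1 Hm) in Hb'; [|lra]. rewrite AL_M in Hb'. assert (Hb2 := Hb').
    apply (lt_g_fun _ _ _ m I2 Hm) in Hb2; [|lra].
    apply (avoids_eperiodic_FG beta m (l ++ [SM]) (cst false) w10); auto; try lra.
    left. apply (lt_f_fun _ _ _ m I2 Hm); lra.
  - intros beta Hb. apply (reach_R m beta (l ++ [SL])); [lra| |].
    + apply (g_fun_lt _ _ _ m I1 Hm); lra.
    + apply (f_fun_lt _ _ _ m I1 Hm); lra.
Qed.

(** The dual plateau: by [BR_M] the two words share their supremum, hence f. Below f the end of the
    M-image is used, above f the start of the R-image followed by L's. *)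
Lemma critical_f l m : 1 < m <= 2 ->
  mu (apply_subs (l ++ [SM]) w101) <= m <= mu (apply_subs (l ++ [SM]) w01) ->
  critical m (f_fun (apply_subs (l ++ [SM]) w01) m).
Proof.
  intros Hm [H1 H2].
  assert (I1 := inf_sup_M_w101 l). assert (I2 := inf_sup_M_w01 l).
  apply (mu_le _ _ _ m I1 Hm) in H1. apply (le_mu _ _ _ m I2 Hm) in H2.
  set (u1 := apply_subs (l ++ [SM]) w101) in *.
  set (u2 := apply_subs (l ++ [SM]) w01) in *.
  assert (H3 := max_fg_ge2 _ _ _ m I2 Hm). rewrite Rmax_left in H3 by auto.
  assert (Hlt : forall beta, 1 < beta -> beta < f_fun u2 m -> beta < f_fun u1 m).
  { intros beta Hb Hb1. apply (lt_f_fun _ _ _ m I2 Hm) in Hb1; auto.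
    rewrite BR_M in Hb1. now apply (lt_f_fun _ _ _ m I1 Hm). }
  split; [split; auto|split].
  - apply Rnot_lt_le. intros L. apply Hlt in L; [|lra].
    assert (g_fun u1 m <= m + 1) by (eapply g_fun_le; eauto; lra). lra.
  - intros beta Hb. assert (Hb1 := Hlt beta ltac:(lra) ltac:(lra)).
    apply (avoids_eperiodic_FG beta m (l ++ [SM]) w01 (cst true)); auto; try lra; left.
    + apply (lt_g_fun _ _ _ m I1 Hm); lra.
    + apply (lt_f_fun _ _ _ m I1 Hm); lra.
  - intros beta Hb. apply (reach_L m beta (l ++ [SR])); [lra| |].
    + apply (g_fun_lt _ _ _ m I2 Hm); lra.
    + apply (f_fun_lt _ _ _ m I2 Hm); lra.
Qed.

Lemma critical_w01 m : 1 < m <= 2 -> mu w01 <= m -> critical m (g_fun w01 m).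
Proof.
  intros Hm H1. assert (I := inf_sup_w01).
  apply (mu_le _ _ _ m I Hm) in H1.
  assert (H3 := max_fg_ge2 _ _ _ m I Hm). rewrite Rmax_right in H3 by auto.
  split; [split; [auto|eapply g_fun_le; eauto; lra]|split].
  - intros beta Hb u. apply avoids_w01.
    + intros a b Hab. assert (G beta a <= G beta b) by (apply G_le; auto; lra). lra.
    + left. apply (lt_g_fun _ _ _ m I Hm); lra.
  - intros beta Hb. apply (reach_R m beta []); [lra| |].
    + apply (g_fun_lt _ _ _ m I Hm); lra.
    + apply (f_fun_lt _ _ _ m I Hm); lra.
Qed.

(** * The critical base at limit words *)

Lemma pref_add s k n : pref s (k + n) = pref s k ++ pref (fun i => s (k + i)%nat) n.
Proof.
  induction n as [|n IH]; [now rewrite Nat.add_0_r, app_nil_r|].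
  now rewrite Nat.add_succ_r, !pref_S, IH, app_assoc.
Qed.

Lemma limB_split s k : limB s = Bsubs (pref s k) (limB (fun n => s (k + n)%nat)).
Proof.
  set (s' := fun n => s (k + n)%nat). apply agr_eq. intros N.
  apply agr_trans with (Bsubs (pref s (k + S N)) (cst true)).
  - apply agr_sym. eapply agr_le; [|now apply limB_agr]; lia.
  - rewrite pref_add, Bsubs_app.
    eapply agr_le; [|apply (Bsubs_agr N)].
    + lia.
    + now apply Bsubs_0.
    + now apply limB_agr.
Qed.

Lemma ones_limB s : primitive s -> ones (limB s).
Proof.
  intros [H _].
  assert (K : exists k, s k <> SL).
  { apply NNPP. intros N. apply H. exists 0%nat. intros n _.
    apply NNPP. intros Hn. apply N. eauto. }
  destruct K as [k Hk]. rewrite (limB_split s k). apply ones_Bsubs.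
  rewrite (limB_split _ 1). apply ones_Bsub_MR. now rewrite Nat.add_0_r.
Qed.

Lemma inf_sup_limit_word s u : primitive s -> limit_word s u -> inf_sup u (limA s) (limB s).
Proof.
  intros Hs Hu. apply inf_sup_of_bounds; [now apply bounds_limit_word|now apply ones_limB].
Qed.

(** At m = mu u the bases f and g coincide, so off this base both inequalities are strict and
    already hold for a long enough prefix of the substitutions. *)
Lemma critical_limit u m : 1 < m <= 2 -> S_LMR u -> m = mu u -> critical m (f_fun u m).
Proof.
  intros Hm (s & Hs & Hu) E. assert (I := inf_sup_limit_word s u Hs Hu).
  assert (Efg : f_fun u m = g_fun u m).
  { apply Rle_antisym; [apply (mu_le _ _ _ m I Hm)|apply (le_mu _ _ _ m I Hm)]; lra. }
  assert (H3 := max_fg_ge2 _ _ _ m I Hm). rewrite Rmax_left in H3 by lra.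
  split; [split; [auto|rewrite Efg; eapply g_fun_le; eauto; lra]|split].
  - intros beta Hb.
    assert (K1 : m < F beta (limB s)) by (apply (lt_f_fun _ _ _ m I Hm); lra).
    assert (K2 : G beta (limA s) < m) by (apply (lt_g_fun _ _ _ m I Hm); lra).
    destruct (F_gt_agr beta _ m ltac:(lra) K1) as [N1 HN1].
    destruct (G_lt_agr beta _ m ltac:(lra) K2) as [N2 HN2].
    apply (avoids_eperiodic_FG beta m (pref s (N1 + N2)) w01 (cst true)); auto; [lra| |]; left.
    + apply HN2. eapply agr_le; [|now apply limA_agr]; lia.
    + apply HN1. eapply agr_le; [|now apply limB_agr]; lia.
  - intros beta Hb.
    assert (K1 : F beta (limB s) < m) by (apply (f_fun_lt _ _ _ m I Hm); lra).
    assert (K2 : m < G beta (limA s)) by (apply (g_fun_lt _ _ _ m I Hm); lra).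
    destruct (F_lt_agr beta _ m ltac:(lra) K1) as [N1 HN1].
    destruct (G_gt_agr beta _ m ltac:(lra) K2) as [N2 HN2].
    exists (pref s (N1 + N2)); split.
    + apply HN2. eapply agr_le; [|now apply limA_agr]; lia.
    + apply HN1. eapply agr_le; [|now apply limB_agr]; lia.
Qed.

(** * The cases cover (1,2] *)

Definition on_plateau (m : R) (l : list sub) : Prop :=
  mu (apply_subs (l ++ [SM]) w10) <= m <= mu (apply_subs (l ++ [SM]) w010) \/
  mu (apply_subs (l ++ [SM]) w101) <= m <= mu (apply_subs (l ++ [SM]) w01).

Definition inside (m : R) (l : list sub) : Prop :=
  below m (Asubs l w01) (Bsubs l (cst true)) /\
  above m (Asubs l (cst false)) (Bsubs l w10).

(* Along the path from [(0^w, 10^w)] to [(01^w, 1^w)] one meets, in this order, the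
   image of the path under L, a plateau, the image under M, a plateau, the image under R. *)
Lemma inside_descend m l : 1 < m <= 2 -> inside m l ->
  on_plateau m l \/ exists t, inside m (l ++ [t]).
Proof.
  intros Hm [Hb Ha].
  destruct (classic (below m (Asubs (l ++ [SL]) w01) (Bsubs (l ++ [SL]) (cst true)))) as [B1|B1].
  { right; exists SL; split; auto. rewrite Asubs_app, Bsubs_app.
    now rewrite (Asubs_repeat_L 1 : Asubs [SL] _ = _), (Bsubs_repeat_L 1 : Bsubs [SL] _ = _). }
  destruct (classic (above m (Asubs (l ++ [SM]) (cst false)) (Bsubs (l ++ [SM]) w10))) as [A2|A2].
  2:{ left; left; split.
      - now apply (mu_le_iff _ _ _ m (inf_sup_M_w10 l) Hm).
      - now apply (le_mu_iff _ _ _ m (inf_sup_M_w010 l) Hm). }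
  destruct (classic (below m (Asubs (l ++ [SM]) w01) (Bsubs (l ++ [SM]) (cst true)))) as [B3|B3].
  { right; exists SM; split; auto. }
  destruct (classic (above m (Asubs (l ++ [SR]) (cst false)) (Bsubs (l ++ [SR]) w10))) as [A4|A4].
  2:{ left; right; split.
      - now apply (mu_le_iff _ _ _ m (inf_sup_M_w101 l) Hm).
      - now apply (le_mu_iff _ _ _ m (inf_sup_M_w01 l) Hm). }
  right; exists SR; split; auto. rewrite Asubs_app, Bsubs_app.
  now rewrite (Asubs_repeat_R 1 : Asubs [SR] _ = _), (Bsubs_repeat_R 1 : Bsubs [SR] _ = _).
Qed.

(** L fixes (0^w, 10^w), so the pieces l L^k shrink to the start of the piece l, which m lies
    strictly beyond; for large k it lies beyond their ends as well. *)
Lemma inside_not_repeat_L m l : 1 < m -> inside m l ->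
  exists k, ~ inside m (l ++ repeat SL k).
Proof.
  intros Hm [_ Ha]. destruct (above_agr _ _ _ Ha) as [N HN].
  exists N. intros [Hb _]. revert Hb. apply above_not_below; auto.
  - now apply Bsubs_0.
  - apply HN; [|apply approach_L].
    rewrite <- (Asubs_repeat_L N). rewrite <- Asubs_app.
    eapply agr_le; [|apply Asubs_agr_0; reflexivity].
    rewrite length_app, repeat_length; lia.
Qed.

Lemma inside_not_repeat_R m l : 1 < m -> inside m l ->
  exists k, ~ inside m (l ++ repeat SR k).
Proof.
  intros Hm [Hb _]. destruct (below_agr _ _ _ Hb) as [N HN].
  exists N. intros [_ Ha]. apply above_not_below in Ha; auto.
  - apply Ha, HN; [apply approach_R|].
    rewrite <- (Bsubs_repeat_R N). rewrite <- Bsubs_app.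
    eapply agr_le; [|apply Bsubs_agr_0; reflexivity].
    rewrite length_app, repeat_length; lia.
  - now apply Bsubs_0.
Qed.

Lemma pref_repeat s N t k : (forall n, (N <= n)%nat -> s n = t) ->
  pref s (N + k) = pref s N ++ repeat t k.
Proof.
  intros H. rewrite pref_add. f_equal. induction k as [|k IH]; [reflexivity|].
  rewrite pref_S, IH, H by lia. now rewrite <- repeat_cons.
Qed.

(** Both ends of the n-th piece share n letters with ([limA s], [limB s]), so m strictly on one side
    of [mu u] would also be on that side of both ends of a deep piece. *)
Lemma inside_all_mu s u m : 1 < m <= 2 -> (forall n, inside m (pref s n)) ->
  primitive s -> limit_word s u -> m = mu u.
Proof.
  intros Hm H Hs Hu. assert (I := inf_sup_limit_word s u Hs Hu).
  apply Rle_antisym.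
  - apply (le_mu_iff _ _ _ m I Hm). intros Ha.
    destruct (above_agr _ _ _ Ha) as [N HN]. destruct (H N) as [Hb _].
    revert Hb. apply above_not_below; [lra|now apply Bsubs_0|].
    apply HN; [now apply limA_agr|now apply limB_agr].
  - apply (mu_le_iff _ _ _ m I Hm). intros Hb.
    destruct (below_agr _ _ _ Hb) as [N HN]. destruct (H N) as [_ Ha].
    apply above_not_below in Ha; [|lra|now apply Bsubs_0].
    apply Ha, HN; [now apply limA_agr|now apply limB_agr].
Qed.

Lemma cover m : 1 < m <= 2 -> mu w01 <= m \/ (exists l, on_plateau m l) \/
  exists u, S_LMR u /\ m = mu u.
Proof.
  intros Hm. destruct (classic (mu w01 <= m)) as [|H3]; [now left|right].
  destruct (classic (exists l, on_plateau m l)) as [|Hp]; [now left|right].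
  destruct (choice (fun l t => inside m l -> inside m (l ++ [t]))) as [nxt Hnxt].
  { intros l. destruct (classic (inside m l)) as [Hl|Hl]; [|exists SL; tauto].
    destruct (inside_descend m l Hm Hl) as [Hl'|[t Ht]]; [exfalso; eauto|eauto]. }
  set (pr := fix pr n := match n with O => [] | S n => pr n ++ [nxt (pr n)] end).
  set (s := fun n => nxt (pr n)).
  assert (Epr : forall n, pref s n = pr n).
  { induction n as [|n IH]; [reflexivity|]. rewrite pref_S, IH. reflexivity. }
  assert (Hin : forall n, inside m (pref s n)).
  { induction n as [|n IH].
    - split; simpl.
      + apply NNPP. intros N. apply H3. now apply (mu_le_iff _ _ _ m inf_sup_w01 Hm).
      (* At base m, F of 10^w is 1 and G of 0^w is m - 1. *)
      + exists m. split; [lra|]. rewrite F_head by (auto; lra).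
        change (shift w10) with (cst false). unfold G. rewrite P_cst by lra.
        unfold Rdiv; split; nra.
    - rewrite pref_S, Epr. apply Hnxt. now rewrite <- Epr. }
  assert (Hs : primitive s).
  { split; intros [N HN].
    - destruct (inside_not_repeat_L m (pref s N)) as [k Hk]; auto; [lra|].
      apply Hk. rewrite <- (pref_repeat s N SL k HN). apply Hin.
    - destruct (inside_not_repeat_R m (pref s N)) as [k Hk]; auto; [lra|].
      apply Hk. rewrite <- (pref_repeat s N SR k HN). apply Hin. }
  destruct (limit_word_exists s) as [u Hu]. exists u; split; [now exists s|].
  now apply inside_all_mu with s.
Qed.

Theorem theorem1 (m : R) (Hm : 1 < m <= 2) :
  (forall sigma : list sub, ends_with_M sigma ->
     mu (apply_subs sigma w10) <= m <= mu (apply_subs sigma w010) ->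
     calL m = g_fun (apply_subs sigma w10) m) /\
  (forall sigma : list sub, ends_with_M sigma ->
     mu (apply_subs sigma w101) <= m <= mu (apply_subs sigma w01) ->
     calL m = f_fun (apply_subs sigma w01) m) /\
  (mu w01 <= m <= 2 -> calL m = g_fun w01 m) /\
  (forall u : bword, S_LMR u -> m = mu u -> calL m = f_fun u m) /\
  ((exists sigma : list sub, ends_with_M sigma /\
      mu (apply_subs sigma w10) <= m <= mu (apply_subs sigma w010)) \/
   (exists sigma : list sub, ends_with_M sigma /\
      mu (apply_subs sigma w101) <= m <= mu (apply_subs sigma w01)) \/
   (mu w01 <= m <= 2) \/
   (exists u : bword, S_LMR u /\ m = mu u)) /\
  (forall beta : R, calL m < beta ->
     exists dim : R, hausdorff_dim (piU beta m) dim /\ 0 < dim).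
Proof.
  split; [|split; [|split; [|split; [|split]]]].
  - intros sigma [l ->] H. apply critical_calL; auto. now apply critical_g.
  - intros sigma [l ->] H. apply critical_calL; auto. now apply critical_f.
  - intros [H _]. apply critical_calL; auto. now apply critical_w01.
  - intros u Hu E. apply critical_calL; auto. now apply critical_limit.
  - destruct (cover m Hm) as [H|[[l [H|H]]|H]].
    + right; right; left. split; [exact H|apply Hm].
    + left. exists (l ++ [SM]). split; [now exists l|exact H].
    + right; left. exists (l ++ [SM]). split; [now exists l|exact H].
    + right; right; right. exact H.
  - intros beta Hb. destruct (cover m Hm) as [H|[[l [H|H]]|(u & Hu & E)]].
    + eapply critical_dim; eauto using critical_w01.
    + eapply critical_dim; eauto using critical_g.
    + eapply critical_dim; eauto using critical_f.
    + eapply critical_dim; eauto using critical_limit.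
Qed.
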